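(* Let $p$ be a prime with $p\equiv 3 \pmod 4$ and $p>3$, and suppose that $10$ has multiplicative order exactly $(p-1)/2$ modulo $p$. Let $m\in\{1,\ldots,p-1\}$ be a quadratic residue modulo $p$, and write the decimal expansion $m/p=\sum_{j=1}^{\infty}a_j10^{-j}$ with digits $a_j\in\{0,\ldots,9\}$. For $k\in\{0,\ldots,9\}$ let $$n_k=|\{j : 1\le j\le (p-1)/2,\ a_j=k\}|.$$ Let $h_1$ be the class number of $\mathbb{Q}(\sqrt{-p})$ and $h_2$ the class number of $\mathbb{Q}(\sqrt{-5p})$. Then for $k=0,\ldots,4$, $$n_k=\frac12\left(\left\lfloor\frac{(k+1)p}{10}\right\rfloor-\left\lfloor\frac{kp}{10}\right\rfloor+\delta_k\right)\quad\text{and}\quad n_{9-k}=n_k-\delta_k,$$ where the numbers $\delta_k$ are given as follows. If $p\equiv 3\pmod 8$, then $$\delta_0=0,\quad \delta_1=\delta_4=\tfrac{3h_1}{2}-\tfrac{h_2}{4},\quad \delta_2=-\delta_1,\quad \delta_3=\tfrac{3h_1}{2}+\tfrac{h_2}{4}.$$ If $p\equiv 7\pmod 8$, then $$\delta_0=h_1-\tfrac{h_2}{2},\quad \delta_1=\tfrac{h_2}{4},\quad \delta_2=\tfrac{3h_2}{4},\quad \delta_3=\delta_4=-\delta_1.$$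
   Context: $\lfloor x\rfloor$ denotes the integer part of $x$. The digits $a_j$ are the (unique, non-terminating) base-10 digits of the rational number $m/p\in(0,1)$; $(a_1,\ldots,a_{(p-1)/2})$ is a period of this expansion. *)

(* Defs.v *)
From HB Require Import structures.
From mathcomp Require Import all_boot all_order all_algebra all_field.
From mathcomp Require Import finmap.
From mathcomp Require Import all_classical all_reals all_analysis.

Set Implicit Arguments.
Unset Strict Implicit.
Unset Printing Implicit Defensive.

Import Order.TTheory GRing.Theory Num.Theory.
Import numFieldNormedType.Exports.

Local Open Scope classical_set_scope.
Local Open Scope ring_scope.

(* Number fields are subfields of the algebraic closure algC of rat. *)
Definition quadratic_field (d : int) : set algC :=
  [set z | exists a b : rat, z = ratr a + ratr b * sqrtC (d%:~R)].

Definition ring_of_integers (K : set algC) : set algC :=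
  [set z | K z /\ z \in Aint].

(* 0 \in I and closure under opposite follow from the last clause, as any    *)
(* subring O contains 0 and -1.                                              *)
Definition nonzero_ideal (O I : set algC) : Prop :=
  [/\ I `<=` O,
      exists2 x, I x & x != 0,
      forall x y, I x -> I y -> I (x + y)
    & forall r x, O r -> I x -> I (r * x)].

Definition ideal_equiv (O I J : set algC) : Prop :=
  exists a b : algC, [/\ O a /\ a != 0, O b /\ b != 0 &
    [set a * x | x in I] = [set b * y | y in J]].

Definition ideal_class (O I : set algC) : set (set algC) :=
  [set J | nonzero_ideal O J /\ ideal_equiv O I J].

Definition ideal_classes (O : set algC) : set (set (set algC)) :=
  [set ideal_class O I | I in nonzero_ideal O].

(* fset_set is the underlying finite set; it would be empty on an infinite   *)
(* argument, but the class group of a number field is finite.                *)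
Definition class_number (K : set algC) : nat :=
  #|` fset_set (ideal_classes (ring_of_integers K))|%fset.

(* a j is the j-th digit after the decimal point; the value a 0 is unused.   *)
Definition decimal_expansion (R : realType) (x : R) (a : nat -> nat) : Prop :=
  (forall j, (0 < j)%N -> (a j < 10)%N) /\
  (fun n : nat => \sum_(1 <= j < n.+1) (a j)%:R / 10%:R ^+ j : R) @ \oo --> x.

Definition digit_count (a : nat -> nat) (N k : nat) : nat :=
  count (fun j => a j == k) (index_iota 1 N.+1).

Definition delta3 (h1 h2 : rat) (k : nat) : rat :=
  match k with
  | 0 => 0
  | 1 | 4 => 3%:R * h1 / 2%:R - h2 / 4%:R
  | 2 => - (3%:R * h1 / 2%:R - h2 / 4%:R)
  | 3 => 3%:R * h1 / 2%:R + h2 / 4%:R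
  | _ => 0
  end.

Definition delta7 (h1 h2 : rat) (k : nat) : rat :=
  match k with
  | 0 => h1 - h2 / 2%:R
  | 1 => h2 / 4%:R
  | 2 => 3%:R * h2 / 4%:R
  | 3 | 4 => - (h2 / 4%:R)
  | _ => 0
  end.

(* Only used for p congruent to 3 modulo 4, i.e. to 3 or 7 modulo 8, and     *)
(* for k <= 4.                                                               *)
Definition delta (p : nat) (h1 h2 : rat) (k : nat) : rat :=
  if (p %% 8 == 3)%N then delta3 h1 h2 k else delta7 h1 h2 k.

(* Main.v *)
(* Let chi be the quadratic character of Q(sqrt(-d)), for d = p and d = 5p. Both
   class numbers are given by h = L(0, chi) = - (sum of r chi(r), r < d) / d. To
   see this without complex analysis, let r(n) be the number of representations
   of n by representatives of all classes of forms, so that r(0) = h and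
   r(n) = 2 sum_(e | n) chi(e) for n > 0. The series r(n) - 4 r(n / 4) is a
   combination of alternating sums over lattice points and has Abel sum 0, while
   on the character side it is an explicit combination of the coefficients of
   eta(s) L(s, chi), whose Abel sum L(0, chi) / 2 is computed block by block.

   The digit a_(j+1) is the integer part of 10 r / p with r = 10^j m mod p, and
   10^j m runs through the quadratic residues. Thus 2 n_k is the number of
   integers in the k-th tenth of (0, p) plus the sum S_k of the Legendre symbol
   over it. The substitutions r -> -r and r -> 2r, the sums of [2r / p] and
   [5r / p] against the symbol (giving multiples of h_1), and the formula for
   h_2 reduced modulo p and 5 by the Chinese remainder theorem, determine all
   S_k. *)

From HB Require Import structures.
Require Import Defs.
From mathcomp Require Import all_boot all_order all_algebra all_fingroup.
From mathcomp Require Import all_solvable all_field finmap.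
From mathcomp Require Import all_classical all_reals all_analysis.
From mathcomp Require Import zify ring lra.

Set Implicit Arguments.
Unset Strict Implicit.
Unset Printing Implicit Defensive.

Import Order.TTheory GRing.Theory Num.Theory.
Import numFieldNormedType.Exports.
Local Open Scope ring_scope.

(** * Abel summation *)

Definition dilate (V : nmodType) d (u : nat -> V) n : V :=
  if (d %| n)%N then u (n %/ d)%N else 0.

Fact dilate_is_linear (A : pzRingType) (V : lmodType A) d :
  linear (@dilate V d).
Proof.
move=> a u v; apply/funext => n; rewrite /dilate -[RHS]/(a *: _ + _).
by case: ifP; rewrite ?scaler0 ?addr0.
Qed.

HB.instance Definition _ (A : pzRingType) (V : lmodType A) d :=
  GRing.isLinear.Build A (nat -> V) (nat -> V) *:%R (@dilate V d)
    (dilate_is_linear d).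

Lemma dilate_dilate (V : nmodType) c d (u : nat -> V) :
  dilate c (dilate d u) = dilate (c * d) u.
Proof.
apply/funext => n; rewrite /dilate.
case: ifP => [c_n|c_n]; last first.
  by rewrite ifF //; apply: contraFF c_n; apply: dvdn_trans; exact: dvdn_mulr.
by rewrite dvdn_divRL // mulnC -divnMA.
Qed.

Definition constant_term (V : nmodType) (a : V) n : V :=
  if n is 0 then a else 0.

Lemma dilate_constant_term (V : nmodType) d (a : V) : (0 < d)%N ->
  dilate d (constant_term a) = constant_term a.
Proof.
move=> d_gt0; apply/funext => n; rewrite /dilate /constant_term.
case: (posnP n) => [->|n_gt0]; first by rewrite dvdn0 div0n.
case: ifP => [d_n|_]; last by case: n n_gt0.
have : (0 < n %/ d)%N by rewrite divn_gt0 // dvdn_leq.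
by case: (n %/ d)%N; case: n n_gt0 {d_n}.
Qed.

Section AbelSummation.
Local Open Scope classical_set_scope.
Variable R : realType.
Implicit Types (u v : R^nat) (x L M : R) (k n : nat).

Definition has_abel_sum u L : Prop :=
  (forall x, 0 < x < 1 -> cvgn (pseries u x)) /\
  limn (pseries u x) @[x --> 1^'-] --> L.

Lemma near_at_left1 : \forall x \near (1 : R)^'-, 0 < x < 1.
Proof.
near=> x; apply/andP; split; last by near: x; exact: nbhs_left_lt.
by near: x; apply: nbhs_left_gt; exact: ltr01.
Unshelve. all: by end_near. Qed.

Lemma has_abel_sum_near u L (f : R -> R) :
  (forall x, 0 < x < 1 -> pseries u x @ \oo --> f x) ->
  f x @[x --> 1^'-] --> L -> has_abel_sum u L.
Proof.
move=> cvg_u cvg_f; split=> [x /cvg_u /cvgP //|].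
apply: cvg_trans cvg_f; apply: near_eq_cvg.
by apply: filterS near_at_left1 => x /cvg_u /cvg_lim ->.
Qed.

Lemma pseriesE u x n : pseries u x n = \sum_(i < n) u i * x ^+ i.
Proof. by rewrite /pseries seriesEord. Qed.

Lemma has_abel_sumD u v L M : has_abel_sum u L -> has_abel_sum v M ->
  has_abel_sum (u + v) (L + M).
Proof.
move=> [cvg_u lim_u] [cvg_v lim_v].
apply: has_abel_sum_near (cvgD lim_u lim_v) => x x01.
have -> : pseries (u + v) x = pseries u x + pseries v x.
  by rewrite -seriesD; congr series; apply/funext => n; rewrite [LHS]mulrDl.
by apply: cvgD; [exact: cvg_u | exact: cvg_v].
Qed.

Lemma has_abel_sumZ u a L : has_abel_sum u L -> has_abel_sum (a *: u) (a * L).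
Proof.
move=> [cvg_u lim_u].
apply: (has_abel_sum_near _ (cvgM (cvg_cst a) lim_u)) => x x01.
have -> : pseries (a *: u) x = a *: pseries u x.
  by rewrite -seriesZ; congr series; apply/funext => n; rewrite [RHS]mulrA.
by apply: cvgZ; [exact: cvg_cst | exact: cvg_u].
Qed.

Lemma has_abel_sum0 : has_abel_sum 0 0.
Proof.
apply: (@has_abel_sum_near _ _ (fun=> 0)); last exact: cvg_cst.
move=> x _; apply: cvg_near_cst; near=> n.
by rewrite pseriesE big1 // => i _; rewrite mul0r.
Unshelve. all: by end_near. Qed.

Lemma has_abel_sum_sum (I : eqType) (r : seq I) (u : I -> R^nat) (L : I -> R) :
  {in r, forall i, has_abel_sum (u i) (L i)} ->
  has_abel_sum (\sum_(i <- r) u i) (\sum_(i <- r) L i).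
Proof.
move=> sum_u; rewrite big_seq [X in has_abel_sum _ X]big_seq.
apply: (big_ind2 has_abel_sum); [exact: has_abel_sum0 | | by []].
by move=> v L1 w L2; exact: has_abel_sumD.
Qed.

Lemma has_abel_sum_constant_term a : has_abel_sum (constant_term a) a.
Proof.
apply: (@has_abel_sum_near _ _ (fun=> a)); last exact: cvg_cst.
move=> x _; apply: cvg_near_cst; exists 1%N => // -[//|n] _.
rewrite pseriesE big_ord_recl mulr1 big1 ?addr0 // => i _.
by rewrite mul0r.
Qed.

Lemma has_abel_sum_unique u L M : has_abel_sum u L -> has_abel_sum u M -> L = M.
Proof. by move=> [_ lim_L] [_ lim_M]; exact: cvg_unique lim_L lim_M. Qed.

Lemma pseries_dilate d u x n : (0 < d)%N ->
  pseries (dilate d u) x n = pseries u (x ^+ d) ((n + d.-1) %/ d)%N.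
Proof.
move=> d_gt0; rewrite !pseriesE.
elim: n => [|n IHn]; first by rewrite add0n divn_small ?ltn_predL // !big_ord0.
have -> : ((n.+1 + d.-1) %/ d = (n %/ d).+1)%N.
  by rewrite addSnnS prednK // divnDr // divnn d_gt0 addn1.
rewrite big_ord_recr /= IHn /dilate.
have := divn_pred (n + d) d; rewrite -subn1 -addnBA // subn1 => ->.
rewrite divnDr // divnn d_gt0 addn1 dvdn_addl //.
case: ifP => [d_n|_]; last by rewrite subn0 mul0r addr0.
by rewrite subn1 big_ord_recr /= -exprM (mulnC d) divnK.
Qed.

Lemma cvg_exprn_at_left1 d : (0 < d)%N -> x ^+ d @[x --> (1 : R)^'-] --> 1^'-.
Proof.
move=> d_gt0 P /= P1.
have : x ^+ d @[x --> (1 : R)^'-] --> (1 : R).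
  rewrite -[X in _ --> X](expr1n R d).
  by apply: cvg_at_left_filter; exact: exprn_continuous.
move=> /(_ _ P1) /=; apply: filterS2 near_at_left1 => x /andP[x_gt0 x_lt1].
apply; by rewrite exprn_ilt1 // -?lt0n // ltW.
Qed.

Lemma has_abel_sum_dilate d u L : (0 < d)%N ->
  has_abel_sum u L -> has_abel_sum (dilate d u) L.
Proof.
move=> d_gt0 [cvg_u lim_u].
pose f x := limn (pseries u (x ^+ d)).
apply: (@has_abel_sum_near _ _ f) => [x /andP[x_gt0 x_lt1]|]; last first.
  exact: cvg_comp (cvg_exprn_at_left1 d_gt0) lim_u.
have -> : pseries (dilate d u) x =
    pseries u (x ^+ d) \o divn^~ d \o addn^~ d.-1.
  by apply/funext => n /=; rewrite pseries_dilate.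
apply: cvg_comp (cvg_addnr _) _.
apply: cvg_comp; first exact: cvg_divnr.
by apply: cvg_u; rewrite exprn_gt0 // exprn_ilt1 // -?lt0n // ltW.
Qed.

Definition csum u : R^nat := fun n => series u n.+1.

Lemma csumE u n : csum u n = \sum_(i < n.+1) u i.
Proof. by rewrite /csum seriesEord. Qed.

Lemma csum_iterE u k n :
  iter k.+1 csum u n = \sum_(i < n.+1) 'C(n - i + k, k)%:R * u i.
Proof.
elim: k n => [|k IHk] n.
  by rewrite [LHS]csumE; apply: eq_bigr => i _; rewrite bin0 mul1r.
rewrite iterS csumE; under eq_bigr do rewrite IHk.
elim: n => [|n IHn]; first by rewrite !big_ord1 /= subn0 !binn.
rewrite big_ord_recr /= IHn [RHS]big_ord_recr [X in _ + X]big_ord_recr /=.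
rewrite subnn !add0n !binn addrA -big_split /=; congr (_ + _).
apply: eq_bigr => i _; rewrite -mulrDl -natrD; congr (_%:R * _).
have le_in : (i <= n)%N by rewrite -ltnS.
by rewrite (subSn le_in) [in RHS]addSn binS addSnnS.
Qed.

Lemma pseries_csum u x n :
  pseries u x n.+1 =
  (1 - x) * pseries (csum u) x n.+1 + x * (csum u n * x ^+ n).
Proof.
rewrite !pseriesE; elim: n => [|n IHn].
  by rewrite !big_ord1 csumE big_ord1 /=; ring.
rewrite big_ord_recr IHn [in RHS]big_ord_recr /= [csum u n.+1]seriesSr.
by rewrite -/(csum u n) !(exprS x n); ring.
Qed.

Lemma cvg_pseries_csum u x S :
  pseries (csum u) x @ \oo --> S -> pseries u x @ \oo --> (1 - x) * S.
Proof.
move=> cvg_S; rewrite -cvg_shiftS.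
rewrite (_ : (1 - x) * S = (1 - x) * S + x * 0); last by rewrite mulr0 addr0.
rewrite (_ : (fun n => pseries u x n.+1) = fun n =>
  (1 - x) * pseries (csum u) x n.+1 + x * (csum u n * x ^+ n)); last first.
  by apply/funext => n; exact: pseries_csum.
apply: cvgD.
  by apply: cvgM; [exact: cvg_cst | rewrite cvg_shiftS].
apply: cvgM; first exact: cvg_cst.
exact: (cvg_series_cvg_0 (cvgP _ cvg_S)).
Qed.

Lemma cvg_pseries_csum_iter u x k S :
  pseries (iter k csum u) x @ \oo --> S ->
  pseries u x @ \oo --> (1 - x) ^+ k * S.
Proof.
elim: k S => [|k IHk] S; first by rewrite mul1r.
by rewrite iterS exprSr -mulrA => /cvg_pseries_csum /IHk.
Qed.

Lemma nondecreasing_pseries u x : (forall n, 0 <= u n) -> 0 <= x ->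
  nondecreasing_seq (pseries u x).
Proof.
move=> u_ge0 x_ge0; apply: nondecreasing_series => n _ _.
by rewrite mulr_ge0 // exprn_ge0.
Qed.

Lemma is_cvg_pseries_csum u x : (forall n, 0 <= u n) -> 0 < x < 1 ->
  cvgn (pseries u x) -> cvgn (pseries (csum u) x).
Proof.
move=> u_ge0 /andP[x_gt0 x_lt1] cvg_u.
have x_ge0 := ltW x_gt0.
have csum_ge0 n : 0 <= csum u n by rewrite csumE sumr_ge0.
apply: nondecreasing_is_cvgn; first exact: nondecreasing_pseries.
exists ((1 - x)^-1 * limn (pseries u x)) => _ [n _ <-].
apply: le_trans (nondecreasing_pseries csum_ge0 x_ge0 (leqnSn n)) _.
rewrite ler_pdivlMl ?subr_gt0 //.
have := nondecreasing_cvgn_le (nondecreasing_pseries u_ge0 x_ge0) cvg_u n.+1.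
by apply: le_trans; rewrite [leRHS]pseries_csum lerDl !mulr_ge0 ?exprn_ge0.
Qed.

Lemma csum_bin k :
  csum (fun n => 'C(n + k, k)%:R) = (fun n => 'C(n + k.+1, k.+1)%:R).
Proof.
apply/funext; elim=> [|n IHn]; first by rewrite csumE big_ord1 !binn.
by rewrite [LHS]seriesSr -/(csum _ n) IHn -natrD [in RHS]addnS binS !addSnnS.
Qed.

Lemma cvg_pseries_bin k x : 0 < x < 1 ->
  pseries (fun n => 'C(n + k, k)%:R) x @ \oo --> (1 - x) ^- k.+1.
Proof.
move=> x01; have /andP[x_gt0 x_lt1] := x01.
have x1_neq0 : 1 - x != 0 by rewrite subr_eq0 gt_eqF.
elim: k => [|k IHk].
  have -> : pseries (fun n => 'C(n + 0, 0)%:R) x = series (geometric 1 x).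
    by congr series; apply/funext => n /=; rewrite bin0.
  by rewrite expr1 -div1r; apply: cvg_geometric_series; rewrite gtr0_norm.
have : cvgn (pseries (fun n => 'C(n + k.+1, k.+1)%:R) x).
  by rewrite -csum_bin; apply: is_cvg_pseries_csum x01 (cvgP _ IHk) => n.
rewrite -csum_bin => cvg_csum.
have lim_csum := cvg_unique _ IHk (cvg_pseries_csum cvg_csum).
have -> : (1 - x) ^- k.+2 = limn (pseries (csum (fun n => 'C(n + k, k)%:R)) x).
  by apply: (mulfI x1_neq0); rewrite -lim_csum // exprS invfM mulVKf.
exact: cvg_csum.
Qed.

Lemma is_cvg_pseries_le_bin u k M x : 0 < x < 1 ->
  (forall n, `|u n| <= M * 'C(n + k, k)%:R) -> cvgn (pseries u x).
Proof.
move=> x01 le_u; have /andP[x_gt0 _] := x01; apply: normed_cvg.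
have le_term n : `|u n * x ^+ n| <= M * ('C(n + k, k)%:R * x ^+ n).
  have xn_ge0 : 0 <= x ^+ n by rewrite exprn_ge0 ?ltW.
  by rewrite normrM (ger0_norm xn_ge0) mulrA ler_wpM2r.
pose bound := M *: fun n => 'C(n + k, k)%:R * x ^+ n.
apply: (@series_le_cvg _ _ bound) => [n|n||] //=.
  exact: le_trans (le_term n).
by apply: is_cvg_seriesZ; exact: cvgP (cvg_pseries_bin x01).
Qed.

Section EventuallyDominated.
Variables (u : R^nat) (k N : nat) (e x : R).
Hypotheses (x01 : 0 < x < 1) (e_ge0 : 0 <= e).
Hypothesis le_u : forall n, (N <= n)%N -> `|u n| <= e * 'C(n + k, k)%:R.

Let K : R := \sum_(i < N) `|u i|.

Let le_u_head n :
  `|u n| <= e * 'C(n + k, k)%:R + (if (n < N)%N then `|u n| else 0).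
Proof.
case: ltnP => [_|/le_u]; last by rewrite addr0.
by rewrite lerDr mulr_ge0.
Qed.

Lemma is_cvg_pseries_dominated : cvgn (pseries u x).
Proof.
apply: (@is_cvg_pseries_le_bin _ k (e + K)) => // n.
apply: le_trans (le_u_head n) _; rewrite mulrDl lerD2l.
have K_ge0 : 0 <= K by exact: sumr_ge0.
have le_K : K <= K * 'C(n + k, k)%:R.
  by rewrite ler_peMr // ler1n bin_gt0 leq_addl.
case: ifP => [n_lt_N|_]; last exact: le_trans le_K.
by apply: le_trans le_K; rewrite /K (bigD1 (Ordinal n_lt_N)) //= lerDl sumr_ge0.
Qed.

Let norm_pseries_le n :
  `|pseries u x n| <= e * pseries (fun i => 'C(i + k, k)%:R) x n + K.
Proof.
have [x_gt0 x_lt1] := andP x01.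
rewrite !pseriesE; apply: le_trans (ler_norm_sum _ _ _) _.
apply: le_trans (_ : \sum_(i < n) (e * ('C(i + k, k)%:R * x ^+ i)
    + (if (i < N)%N then `|u i| else 0)) <= _).
  apply: ler_sum => i _; have xi_ge0 : 0 <= x ^+ i by rewrite exprn_ge0 ?ltW.
  rewrite normrM (ger0_norm xi_ge0).
  apply: le_trans (ler_wpM2r xi_ge0 (le_u_head i)) _.
  rewrite mulrDl mulrA lerD2l.
  by case: ifP => _; rewrite ?mul0r // ler_piMr // exprn_ile1 ?ltW.
rewrite big_split /= -mulr_sumr lerD2l.
apply: le_trans (_ : \sum_(i < N + n) (if (i < N)%N then `|u i| else 0) <= _).
  rewrite addnC big_split_ord /= lerDl.
  by apply: sumr_ge0 => i _; case: ifP.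
rewrite big_split_ord /= [X in _ + X]big1 ?addr0 => [|i _]; last first.
  by rewrite ltnNge leq_addr.
by apply: ler_sum => i _; rewrite ltn_ord.
Qed.

Lemma norm_lim_pseries_dominated :
  `|limn (pseries u x)| <= e * (1 - x) ^- k.+1 + K.
Proof.
have cvg_norm : `|pseries u x n| @[n --> \oo] --> `|limn (pseries u x)|.
  by apply: cvg_norm; exact: is_cvg_pseries_dominated.
rewrite -(cvg_lim _ cvg_norm) //; apply: limr_le; first exact: cvgP cvg_norm.
near=> n; apply: le_trans (norm_pseries_le n) _; rewrite lerD2r ler_wpM2l //.
have cvg_bin := @cvg_pseries_bin k _ x01; rewrite -(cvg_lim _ cvg_bin) //.
apply: nondecreasing_cvgn_le (cvgP _ cvg_bin) _.
by apply: nondecreasing_pseries => //; case/andP: x01 => /ltW.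
Unshelve. all: by end_near. Qed.

End EventuallyDominated.

Lemma cvg_pseries_little_o v k :
  (forall e, 0 < e ->
     exists N, forall n, (N <= n)%N -> `|v n| <= e * 'C(n + k, k)%:R) ->
  (1 - x) ^+ k.+1 * limn (pseries v x) @[x --> 1^'-] --> (0 : R).
Proof.
move=> v_small; apply/cvgr0Pnorm_le => e e_gt0.
have e2_gt0 : 0 < e / 2 by rewrite divr_gt0.
have [N v_le] := v_small _ e2_gt0; set K := \sum_(i < N) `|v i|.
have K1_gt0 : 0 < K + 1 by rewrite ltr_wpDl // sumr_ge0.
near=> x; have x01 : 0 < x < 1 by near: x; exact: near_at_left1.
have x1_ge0 : 0 <= 1 - x by rewrite subr_ge0 ltW.
rewrite normrM ger0_norm ?exprn_ge0 //.
apply: le_trans (ler_wpM2l (exprn_ge0 _ x1_ge0)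
  (norm_lim_pseries_dominated x01 (ltW e2_gt0) v_le)) _.
rewrite -/K mulrDr mulrCA mulfV ?mulr1; last first.
  by rewrite expf_neq0 // gt_eqF // subr_gt0.
rewrite [leRHS]splitr lerD2l; apply: le_trans (_ : (1 - x) * (K + 1) <= _).
  apply: ler_pM; rewrite ?exprn_ge0 ?sumr_ge0 ?lerDl // exprS.
  by rewrite ler_piMr // exprn_ile1 // gerBl ltW.
rewrite -ler_pdivlMr // lerBlDr -lerBlDl ltW //; near: x.
by apply: nbhs_left_gt; rewrite gtrBl divr_gt0.
Unshelve. all: by end_near. Qed.

Theorem cesaro_abel u k L :
  iter k.+1 csum u n / 'C(n + k, k)%:R @[n --> \oo] --> L -> has_abel_sum u L.
Proof.
move=> cvg_mean; pose bin n : R := 'C(n + k, k)%:R.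
pose v n : R := iter k.+1 csum u n - L * bin n.
have v_small e : 0 < e -> exists N, forall n, (N <= n)%N -> `|v n| <= e * bin n.
  move=> e_gt0; have /cvgrPdist_le /(_ e e_gt0) [N _ dist_le] := cvg_mean.
  exists N => n /dist_le /= {}dist_le.
  have bin_gt0 : 0 < bin n by rewrite ltr0n bin_gt0 leq_addl.
  have -> : v n = - (L - iter k.+1 csum u n / bin n) * bin n.
    by rewrite opprB mulrBl divfK ?gt_eqF.
  by rewrite mulNr normrN normrM (gtr0_norm bin_gt0) ler_pM2r.
pose f x := (1 - x) ^+ k.+1 * limn (pseries v x) + L.
apply: (@has_abel_sum_near _ _ f) => [x x01|]; last first.
  rewrite -[X in _ --> X]add0r.
  by apply: cvgD; [exact: cvg_pseries_little_o | exact: cvg_cst].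
have x1_neq0 : 1 - x != 0.
  by case/andP: x01 => _ x_lt1; rewrite subr_eq0 gt_eqF.
have [N v_le] := v_small _ ltr01.
have cvg_v := is_cvg_pseries_dominated x01 ler01 v_le.
have -> : f x = (1 - x) ^+ k.+1 * (limn (pseries v x) + L * (1 - x) ^- k.+1).
  by rewrite mulrDr mulrCA mulfV ?mulr1 // expf_neq0.
apply: cvg_pseries_csum_iter.
rewrite (_ : pseries _ x = pseries v x + L *: pseries bin x); last first.
  have -> : iter k.+1 csum u = v + L *: bin.
    by apply/funext => n; rewrite [RHS]subrK.
  rewrite -seriesZ -seriesD; congr series; apply/funext => n.
  by rewrite /= [LHS]mulrDl -[X in _ + X = _]mulrA.
apply: cvgD; first exact: cvg_v.
by apply: cvgZ; [exact: cvg_cst | exact: cvg_pseries_bin].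
Qed.

End AbelSummation.
(** * Alternating sums over the values of a binary quadratic form *)

Section SymmetricSums.
Variable V : zmodType.
Implicit Types (G H : int -> V) (M : nat).

Definition zsum M G : V := \sum_(i < M.*2.+1) G (i%:Z - M%:Z).

Lemma zsumS M G : zsum M.+1 G = G (- M.+1%:Z) + zsum M G + G M.+1%:Z.
Proof.
rewrite /zsum doubleS big_ord_recr big_ord_recl /= -/(zsum M _).
congr (G _ + _ + G _); try lia.
by apply: eq_bigr => i _; congr G; rewrite /bump; lia.
Qed.

Lemma eq_zsum M G H : G =1 H -> zsum M G = zsum M H.
Proof. by move=> eqGH; apply: eq_bigr => i _; exact: eqGH. Qed.

Lemma zsum_widen M N G : (M <= N)%N ->
  (forall x, (M < `|x|)%N -> G x = 0) -> zsum N G = zsum M G.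
Proof.
move=> le_MN G0; elim: N le_MN => [|N IHN]; first by rewrite leqn0 => /eqP ->.
rewrite leq_eqVlt => /orP[/eqP -> //|lt_MN].
by rewrite zsumS IHN // !G0 ?addr0 ?add0r //; lia.
Qed.

Lemma zsum_shift M G : (forall x, (M <= `|x|)%N -> G x = 0) ->
  zsum M (fun x => G (x + 1)) = zsum M G.
Proof.
move=> G0; rewrite /zsum [RHS]big_ord_recl [LHS]big_ord_recr /=.
rewrite [X in _ + X = _]G0 ?[X in _ = X + _]G0 ?addr0 ?add0r; try lia.
by apply: eq_bigr => i _; congr G; rewrite /bump; lia.
Qed.

Lemma zsumD M G H : zsum M (fun x => G x + H x) = zsum M G + zsum M H.
Proof. exact: big_split. Qed.

Lemma zsumN M G : zsum M (fun x => - G x) = - zsum M G.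
Proof. exact: sumrN. Qed.

Lemma zsum0 M G : (forall x, G x = 0) -> zsum M G = 0.
Proof. by move=> G0; rewrite /zsum big1. Qed.

Lemma zsum_even M G : (forall x, odd `|x| -> G x = 0) ->
  zsum M.*2 G = zsum M (fun x => G (2 * x)).
Proof.
move=> G0; elim: M => [|M IHM]; first by rewrite /zsum !big_ord1; congr G; lia.
rewrite doubleS !zsumS IHM [X in _ + (X + _ + _)]G0; last by lia.
rewrite [X in _ + (_ + _ + X) + _]G0; last by lia.
by rewrite add0r addr0; congr (G _ + _ + G _); lia.
Qed.

Lemma zsum_pred1 M (z : int) G : (`|z| <= M)%N ->
  zsum M (fun x => if x == z then G x else 0) = G z.
Proof.
move=> le_zM; have lt_zM : (absz (z + M%:Z)%R < M.*2.+1)%N by lia.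
rewrite /zsum (bigD1 (Ordinal lt_zM)) //= big1 => [|i /eqP i_neq].
  by rewrite addr0; have -> : (absz (z + M%:Z))%:Z - M%:Z = z;
    [lia | rewrite eqxx].
by rewrite ifF //; apply/eqP => zE; apply: i_neq; apply: val_inj => /=; lia.
Qed.

Definition zsum2 M (G : int -> int -> V) : V := zsum M (fun x => zsum M (G x)).

Lemma eq_zsum2 M (G H : int -> int -> V) : G =2 H -> zsum2 M G = zsum2 M H.
Proof. by move=> eqGH; apply: eq_zsum => x; apply: eq_zsum => y. Qed.

Lemma zsum20 M (G : int -> int -> V) : (forall x y, G x y = 0) -> zsum2 M G = 0.
Proof. by move=> G0; apply: zsum0 => x; apply: zsum0. Qed.

Lemma zsum2D M (G H : int -> int -> V) :
  zsum2 M (fun x y => G x y + H x y) = zsum2 M G + zsum2 M H.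
Proof. by rewrite /zsum2 -zsumD; apply: eq_zsum => x; exact: zsumD. Qed.

Lemma zsum2N M (G : int -> int -> V) :
  zsum2 M (fun x y => - G x y) = - zsum2 M G.
Proof. by rewrite /zsum2 -zsumN; apply: eq_zsum => x; exact: zsumN. Qed.

Lemma zsum2_swap M (G : int -> int -> V) :
  zsum2 M G = zsum2 M (fun x y => G y x).
Proof. exact: exchange_big. Qed.

Lemma zsum2_sum (I : Type) (r : seq I) M (G : I -> int -> int -> V) :
  zsum2 M (fun x y => \sum_(i <- r) G i x y) = \sum_(i <- r) zsum2 M (G i).
Proof.
rewrite /zsum2 /zsum [RHS]exchange_big; apply: eq_bigr => i _.
by rewrite [RHS]exchange_big.
Qed.

Lemma zsum2_pred1 M (z w : int) (G : int -> int -> V) :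
  (`|z| <= M)%N -> (`|w| <= M)%N ->
  zsum2 M (fun x y => if (x == z) && (y == w) then G x y else 0) = G z w.
Proof.
move=> le_zM le_wM; rewrite -(zsum_pred1 (G z) le_wM).
rewrite -(zsum_pred1 (fun x => zsum M (fun y => if y == w then G x y else 0))
  le_zM).
by apply: eq_zsum => x; case: eqP => // _; exact: zsum0.
Qed.

End SymmetricSums.

Lemma norm_zsum_le (R : numDomainType) M (G : int -> R) K :
  (forall x, (`|x| <= M)%N -> `|G x| <= K) -> `|zsum M G| <= M.*2.+1%:R * K.
Proof.
move=> le_K; apply: le_trans (ler_norm_sum _ _ _) _.
apply: le_trans (_ : \sum_(i < M.*2.+1) K <= _).
  by apply: ler_sum => i _; apply: le_K; have := ltn_ord i; lia.
by rewrite sumr_const card_ord mulr_natl.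
Qed.

Lemma norm_zsum2_le (R : numDomainType) M (G : int -> int -> R) K :
  (forall x y, (`|x| <= M)%N -> (`|y| <= M)%N -> `|G x y| <= K) ->
  `|zsum2 M G| <= M.*2.+1%:R ^+ 2 * K.
Proof.
move=> le_K; rewrite expr2 -mulrA; apply: norm_zsum_le => x le_x.
by apply: norm_zsum_le => y; exact: le_K.
Qed.

Lemma mul_zsum2r (R : pzRingType) M (a : R) (G : int -> int -> R) :
  zsum2 M (fun x y => a * G x y) = a * zsum2 M G.
Proof.
rewrite /zsum2 /zsum mulr_sumr; apply: eq_bigr => i _.
by rewrite mulr_sumr.
Qed.

Lemma zsum2_pm_pair M (z w : int) :
  (`|z| <= M)%N -> (`|w| <= M)%N -> (z != 0) || (w != 0) ->
  zsum2 M (fun x y =>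
    (((x == z) && (y == w)) || ((x == - z) && (y == - w)) : nat)%:Z) = 2.
Proof.
move=> le_z le_w nonzero.
have point (u v : int) : (`|u| <= M)%N -> (`|v| <= M)%N ->
    zsum2 M (fun x y => if (x == u) && (y == v) then 1 else 0 : int) = 1.
  exact: (zsum2_pred1 (fun _ _ => 1)).
rewrite -[RHS]/(1 + 1 : int) -[X in _ = X + _](point z w) //.
rewrite -[X in _ = _ + X](point (- z) (- w)) ?abszN //.
rewrite -zsum2D; apply: eq_zsum2 => x y; move: nonzero.
by case: (x =P z); case: (y =P w); case: (x =P - z); case: (y =P - w) => //=;
  clear; lia.
Qed.

Definition parity_sign (x : int) : int := (-1) ^+ odd `|x|.

Lemma parity_signS x : parity_sign (x + 1) = - parity_sign x.
Proof.
rewrite /parity_sign; have -> : odd `|x + 1| = ~~ odd `|x| by lia.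
by case: odd.
Qed.

Lemma norm_parity_sign x : `|parity_sign x| = 1.
Proof. by rewrite /parity_sign; case: odd. Qed.

Definition alternating (sg : int -> int -> int) : Prop :=
  (forall x y, `|sg x y| = 1) /\ (forall x y, sg (x + 1) y = - sg x y).

Lemma alternating_x : alternating (fun x _ => parity_sign x).
Proof. by split=> x _; rewrite (norm_parity_sign, parity_signS). Qed.

Lemma alternating_xy : alternating (fun x y => parity_sign (x + y)).
Proof.
by split=> x y; rewrite ?norm_parity_sign // addrAC parity_signS.
Qed.

Definition xdiff (G : int -> int -> int) x y : int := G x y - G (x + 1) y.

Lemma xdiff3E G x y : iter 3 xdiff G x y =
  G x y - 3 * G (x + 1) y + 3 * G (x + 2) y - G (x + 3) y.
Proof. by rewrite /= /xdiff -!addrA; ring. Qed.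

Lemma alternating_sum_diff sg k M (G : int -> int -> int) : alternating sg ->
  (forall x y, (M <= `|x| + k)%N -> G x y = 0) ->
  2 ^+ k * zsum2 M (fun x y => sg x y * G x y) =
  zsum2 M (fun x y => sg x y * iter k xdiff G x y).
Proof.
move=> [_ sgS]; elim: k G => [|k IHk] G G0; first by rewrite mul1r.
have -> : 2 ^+ k.+1 * zsum2 M (fun x y => sg x y * G x y) =
    2 ^+ k * zsum2 M (fun x y => sg x y * xdiff G x y).
  rewrite exprSr -mulrA; congr (_ * _); rewrite mulr2n mulrDl mul1r.
  have shift : zsum2 M (fun x y => sg x y * G x y) =
      - zsum2 M (fun x y => sg x y * G (x + 1) y).
    rewrite -zsum2N /zsum2 -zsum_shift => [|x le_x]; last first.
      by apply: zsum0 => y; rewrite G0 ?mulr0 // (leq_trans le_x) ?leq_addr.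
    by apply: eq_zsum => x; apply: eq_zsum => y; rewrite sgS mulNr.
  rewrite {2}shift -zsum2N -zsum2D; apply: eq_zsum2 => x y.
  by rewrite /xdiff mulrBr.
rewrite IHk => [|x y le_M]; last by rewrite /xdiff !G0 ?subrr //; lia.
by apply: eq_zsum2 => x y; rewrite -iterSr.
Qed.

Record bqform := BQForm { coef_xx : nat; coef_xy : nat; coef_yy : nat }.

Definition form_val (Q : bqform) (x y : int) : int :=
  (coef_xx Q)%:Z * x ^+ 2 + (coef_xy Q)%:Z * x * y + (coef_yy Q)%:Z * y ^+ 2.
Coercion form_val : bqform >-> Funclass.

Definition pos_def Q : bool := (coef_xy Q ^ 2 < 4 * coef_xx Q * coef_yy Q)%N.

Definition form_swap Q := BQForm (coef_yy Q) (coef_xy Q) (coef_xx Q).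

Definition form_size Q : nat := (4 * (coef_xx Q + coef_xy Q + coef_yy Q))%N.

Lemma form_swapE (Q : bqform) x y : form_swap Q x y = Q y x.
Proof. by rewrite /form_val /=; ring. Qed.

Lemma pos_def_swap Q : pos_def (form_swap Q) = pos_def Q.
Proof. by rewrite /pos_def /= mulnAC. Qed.

Lemma form_size_swap Q : form_size (form_swap Q) = form_size Q.
Proof. by rewrite /form_size /=; lia. Qed.

Section PositiveDefinite.
Variable Q : bqform.
Hypothesis Q_pos : pos_def Q.

Lemma coef_xx_gt0 : (0 < coef_xx Q)%N.
Proof. by move: Q_pos; rewrite /pos_def; case: (coef_xx Q). Qed.

Lemma form_size_gt0 : (0 < form_size Q)%N.
Proof. by have := coef_xx_gt0; rewrite /form_size; lia. Qed.

Lemma sqr_y_le_form x y : y ^+ 2 <= 4 * (coef_xx Q)%:Z * Q x y.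
Proof.
move: Q_pos; rewrite /pos_def; set D := (4 * _ * _)%N => disc_gt0.
have -> : 4 * (coef_xx Q)%:Z * Q x y =
    (2 * (coef_xx Q)%:Z * x + (coef_xy Q)%:Z * y) ^+ 2
    + (D%:Z - (coef_xy Q)%:Z ^+ 2) * y ^+ 2.
  by rewrite /form_val /D !PoszM; ring.
rewrite -[leLHS]add0r lerD ?sqr_ge0 // ler_peMl ?sqr_ge0 //; lia.
Qed.

Lemma form_ge0 x y : 0 <= Q x y.
Proof.
have := le_trans (sqr_ge0 y) (sqr_y_le_form x y); have := coef_xx_gt0.
by move=> a_gt0; rewrite pmulr_rge0 //; lia.
Qed.

End PositiveDefinite.

Lemma sqr_x_le_form (Q : bqform) x y : pos_def Q ->
  x ^+ 2 <= 4 * (coef_yy Q)%:Z * Q x y.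
Proof.
by rewrite -pos_def_swap -form_swapE => /sqr_y_le_form.
Qed.

Lemma form_small (Q : bqform) (x y : int) M n : pos_def Q -> Q x y <= n%:Z ->
  (form_size Q * n < M ^ 2)%N -> (`|x| < M)%N /\ (`|y| < M)%N.
Proof.
move=> Q_pos le_n lt_M; have le_x := sqr_x_le_form x y Q_pos.
have le_y := sqr_y_le_form Q_pos x y.
move: le_n lt_M le_x le_y; rewrite /form_size; move: (Q x y) => q.
by split; nia.
Qed.

Lemma norm_mul_le (x y a b : int) : `|x| <= a -> `|y| <= b -> `|x * y| <= a * b.
Proof. by move=> le_x le_y; rewrite normrM; apply: ler_pM. Qed.

Lemma form_le_size (Q : bqform) (x y : int) M :
  (`|x| <= M)%N -> (`|y| <= M)%N ->
  Q x y <= (form_size Q)%:Z * M%:Z ^+ 2.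
Proof.
move=> le_x le_y; rewrite /form_val /form_size -mulrA !expr2.
have le_xx : `|x * x| <= M%:Z * M%:Z by apply: norm_mul_le; lia.
have le_xy : `|x * y| <= M%:Z * M%:Z by apply: norm_mul_le; lia.
have le_yy : `|y * y| <= M%:Z * M%:Z by apply: norm_mul_le; lia.
move: le_xx le_xy le_yy; move: (x * x) (x * y) (y * y) (M%:Z * M%:Z) => u v w m.
by nia.
Qed.

Lemma norm_xslope_le_size (Q : bqform) (x y : int) M :
  (`|x| <= M)%N -> (`|y| <= M)%N ->
  `|2 * (coef_xx Q)%:Z * x + (coef_xy Q)%:Z * y| <= (form_size Q)%:Z * M%:Z.
Proof.
move=> le_x le_y; rewrite /form_size.
have : `|2 * (coef_xx Q)%:Z * x| <= (2 * (coef_xx Q)%:Z) * M%:Z.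
  by apply: norm_mul_le; lia.
have : `|(coef_xy Q)%:Z * y| <= (coef_xy Q)%:Z * M%:Z.
  by apply: norm_mul_le; lia.
by move: (_ * x) (_ * y) => u v; clear; nia.
Qed.

(* [6 * 'C(u + 3, 3)] for [u >= 0], the weight of third order Cesaro means. *)
Definition cesaro_weight (u : int) : int :=
  if 0 <= u then (u + 1) * (u + 2) * (u + 3) else 0.

Lemma cesaro_weightE u : -3 <= u ->
  cesaro_weight u = (u + 1) * (u + 2) * (u + 3).
Proof.
move=> u_ge; rewrite /cesaro_weight; case: ifP => // u_lt0.
have : [|| u == -1, u == -2 | u == -3] by lia.
by case/or3P => /eqP ->.
Qed.

Lemma cesaro_weight_bin n : cesaro_weight n%:Z = ('C(n + 3, 3) * 6)%N%:Z.
Proof.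
have := bin_ffact (n + 3) 3; rewrite (_ : 3`! = 6)%N // => ->.
rewrite cesaro_weightE; last by lia.
by rewrite !ffactnS ffactn0 muln1 !addnS addn0 /=; lia.
Qed.

Lemma cesaro_weight_le (u X : int) : 1 <= X -> u <= 12 * X ->
  0 <= cesaro_weight u <= (15 * X) ^+ 3.
Proof.
move=> X_ge1 u_le; rewrite /cesaro_weight; case: ifP => u_ge0; last first.
  by rewrite lexx exprn_ge0 //; lia.
apply/andP; split; first by rewrite !mulr_ge0 //; lia.
have -> : (15 * X) ^+ 3 = (15 * X) * (15 * X) * (15 * X) by ring.
by apply: ler_pM; rewrite ?mulr_ge0 //; try lia; apply: ler_pM; lia.
Qed.

(* The third difference of a cubic along a quadratic progression loses half of
   the degree: it is of size [X ^ 3] although the values may be of size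
   [X ^ 6]. *)
Lemma cesaro_weight_diff3 (u l a X : int) :
  1 <= X -> `|l| <= X -> 0 <= a <= X -> `|u * a| <= X ^+ 2 ->
  `|cesaro_weight u - 3 * cesaro_weight (u - l - a)
    + 3 * cesaro_weight (u - 2 * l - 4 * a) - cesaro_weight (u - 3 * l - 9 * a)|
  <= 8 * (15 * X) ^+ 3.
Proof.
move=> X_ge1 le_l /andP[a_ge0 le_a] le_ua.
case: (boolP [&& -3 <= u, -3 <= u - l - a, -3 <= u - 2 * l - 4 * a
                 & -3 <= u - 3 * l - 9 * a]) => [|cut].
  case/and4P.
  move=> /cesaro_weightE -> /cesaro_weightE -> /cesaro_weightE ->
    /cesaro_weightE ->.
  have norm_a : `|a| <= X by lia.
  have [le_ll le_la le_aa] : [/\ `|l * l| <= X * X, `|l * a| <= X * X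
      & `|a * a| <= X * X] by split; exact: norm_mul_le.
  have [le_ual le_uaa] :
      `|u * a * l| <= X ^+ 2 * X /\ `|u * a * a| <= X ^+ 2 * X.
    by split; exact: norm_mul_le.
  have [le_lll le_lla le_laa le_aaa] : [/\ `|l * l * l| <= X * X * X,
      `|l * l * a| <= X * X * X, `|l * a * a| <= X * X * X
      & `|a * a * a| <= X * X * X] by split; exact: norm_mul_le.
  have XX_le : X * X <= X * X * X by rewrite ler_peMr // mulr_ge0; lia.
  rewrite [leLHS](_ : _ = `|- 36 * (u * a * l) - 108 * (u * a * a)
    + 6 * (l * l * l) + 108 * (l * l * a) + 450 * (l * a * a)
    + 540 * (a * a * a) - 72 * (l * a) - 216 * (a * a)|); last first.
    by congr `|_|; ring.
  rewrite (_ : 8 * (15 * X) ^+ 3 = 8 * (15 * (225 * (X * X * X))));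
    last by ring.
  rewrite (_ : X ^+ 2 * X = X * X * X) in le_ual le_uaa; last by ring.
  move: le_ual le_uaa le_lll le_lla le_laa le_aaa le_la le_aa XX_le.
  move: (u * a * l) (u * a * a) (l * l * l) (l * l * a) (l * a * a) (a * a * a).
  by move: (l * a) (a * a) (X * X * X) (X * X) => *; lia.
have [u0_le u1_le u2_le u3_le] :
    [/\ u <= 12 * X, u - l - a <= 12 * X,
    u - 2 * l - 4 * a <= 12 * X & u - 3 * l - 9 * a <= 12 * X] by split; lia.
move: (cesaro_weight_le X_ge1 u0_le) (cesaro_weight_le X_ge1 u1_le).
move: (cesaro_weight_le X_ge1 u2_le) (cesaro_weight_le X_ge1 u3_le).
move: (cesaro_weight u) (cesaro_weight (u - l - a)) ((15 * X) ^+ 3).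
move: (cesaro_weight (u - 2 * l - 4 * a)) (cesaro_weight (u - 3 * l - 9 * a)).
by move=> *; lia.
Qed.

Section AlternatingForm.
Variables (Q : bqform) (sg : int -> int -> int).
Hypotheses (Q_pos : pos_def Q) (sg_alt : alternating sg).

Definition signed_count_upto M n : int :=
  zsum2 M (fun x y => if Q x y == n%:Z then sg x y else 0).

Definition signed_count n : int := signed_count_upto (form_size Q * n.+1) n.

Lemma signed_count_upto_widen M N n : (M <= N)%N ->
  (form_size Q * n < M ^ 2)%N -> signed_count_upto N n = signed_count_upto M n.
Proof.
move=> le_MN lt_M.
have outside (x y : int) : (M < `|x|)%N || (M < `|y|)%N ->
    (Q x y == n%:Z) = false.
  move=> out; apply/negP => /eqP val_n.
  have [|lt_x lt_y] := @form_small Q x y M n Q_pos _ lt_M;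
    first by rewrite val_n.
  by move: out; rewrite !ltnNge (ltnW lt_x) (ltnW lt_y).
rewrite /signed_count_upto /zsum2 (zsum_widen le_MN) => [|x lt_x]; last first.
  by apply: zsum0 => y; rewrite outside ?lt_x.
by apply: eq_zsum => x; apply: zsum_widen => // y lt_y;
  rewrite outside ?lt_y ?orbT.
Qed.

Lemma signed_countE M n : (form_size Q * n < M ^ 2)%N ->
  signed_count n = signed_count_upto M n.
Proof.
move=> lt_M; have size_gt0 := form_size_gt0 Q_pos.
rewrite -(signed_count_upto_widen (leq_maxl M (form_size Q * n.+1)) lt_M).
by rewrite (signed_count_upto_widen (leq_maxr _ (form_size Q * n.+1))) //; nia.
Qed.

Lemma sum_bin_signed_count M N : (form_size Q * N < M ^ 2)%N ->
  \sum_(n < N.+1) ('C(N - n + 3, 3) * 6)%N%:Z * signed_count n =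
  zsum2 M (fun x y => sg x y * cesaro_weight (N%:Z - Q x y)).
Proof.
move=> lt_M; transitivity (\sum_(n < N.+1) zsum2 M (fun x y =>
    if Q x y == n%:Z then sg x y * cesaro_weight (N%:Z - Q x y) else 0)).
  apply: eq_bigr => n _; have le_nN : (n <= N)%N by rewrite -ltnS.
  rewrite (@signed_countE M); last by nia.
  rewrite -cesaro_weight_bin -mul_zsum2r; apply: eq_zsum2 => x y.
  case: eqP => [->|_]; last by rewrite mulr0.
  by rewrite mulrC; congr (_ * cesaro_weight _); lia.
rewrite -zsum2_sum; apply: eq_zsum2 => x y; have val_ge0 := form_ge0 Q_pos x y.
case: (leP (Q x y) N%:Z) => [le_N|lt_N].
  have lt_N : (`|Q x y| < N.+1)%N by lia.
  rewrite (bigD1 (Ordinal lt_N)) //= big1 ?addr0 => [|n /eqP n_neq].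
    by rewrite ifT //; apply/eqP; lia.
  rewrite ifF //; apply/eqP => val_n; apply: n_neq; apply: val_inj.
  by move=> /=; lia.
have -> : cesaro_weight (N%:Z - Q x y) = 0.
  by rewrite /cesaro_weight ifF //; lia.
by rewrite mulr0 big1 // => n _; case: ifP.
Qed.

Definition cesaro_scale : nat := (form_size Q * (form_size Q + 4) ^ 2).+1.

Lemma norm_xdiff3_cesaro_weight_le N t (x y : int) :
  (0 < t)%N -> (N < t ^ 2)%N ->
  (`|x| <= form_size Q * t + 4)%N -> (`|y| <= form_size Q * t + 4)%N ->
  `|iter 3 xdiff (fun x y => cesaro_weight (N%:Z - Q x y)) x y| <=
  8 * (15 * (cesaro_scale * t)%N%:Z) ^+ 3.
Proof.
set s := form_size Q; set M := (_ + 4)%N; set X := (_ * t)%N%:Z.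
move=> t_gt0 lt_N le_x le_y.
pose l := 2 * (coef_xx Q)%:Z * x + (coef_xy Q)%:Z * y.
pose a := (coef_xx Q)%:Z; pose u := N%:Z - Q x y.
have -> : iter 3 xdiff (fun x y => cesaro_weight (N%:Z - Q x y)) x y =
    cesaro_weight u - 3 * cesaro_weight (u - l - a)
    + 3 * cesaro_weight (u - 2 * l - 4 * a) - cesaro_weight (u - 3 * l - 9 * a).
  have stepE (j : int) : N%:Z - Q (x + j) y = u - j * l - j * j * a.
    by rewrite /u /l /a /form_val; ring.
  by rewrite xdiff3E !stepE !mul1r.
have le_M : (M <= (s + 4) * t)%N by rewrite /M; nia.
have le_l : `|l| <= s%:Z * M%:Z by exact: norm_xslope_le_size.
have u_ge : N%:Z - s%:Z * M%:Z ^+ 2 <= u by rewrite lerD2l lerN2 form_le_size.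
have u_le : u <= N%:Z by rewrite gerBl form_ge0.
have le_sM2 : s%:Z * M%:Z ^+ 2 <= (s * (s + 4) ^ 2)%N%:Z * t%:Z ^+ 2.
  rewrite [leRHS](_ : _ = s%:Z * ((s + 4) * t)%N%:Z ^+ 2); last by lia.
  by apply: ler_wpM2l => //; apply: lerXn2r; rewrite ?nnegrE //; lia.
have le_u : `|u| <= cesaro_scale%:Z * t%:Z ^+ 2.
  have {}lt_N : N%:Z <= t%:Z ^+ 2 by lia.
  rewrite /cesaro_scale -/s -addn1 PoszD mulrDl mul1r.
  move: le_sM2 u_ge u_le lt_N.
  move: (s * _)%N (s%:Z * _) (t%:Z ^+ 2) => ? ? ? ? ? ? ?.
  by lia.
have le_a : (coef_xx Q <= cesaro_scale)%N.
  apply: leqW; apply: (@leq_trans s); first by rewrite /s /form_size; lia.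
  by rewrite leq_pmulr // expn_gt0 addnS.
apply: cesaro_weight_diff3.
- by rewrite /X lez_nat muln_gt0.
- apply: le_trans le_l _; rewrite -PoszM lez_nat.
  apply: leq_trans (leq_mul (leqnn s) le_M) _; rewrite mulnA leq_mul2r.
  by rewrite orbC leqW // leq_mul // -mulnn leq_pmulr // addnS.
- by rewrite /a /X !lez_nat (leq_trans le_a) // leq_pmulr.
rewrite (_ : X ^+ 2 = cesaro_scale%:Z * t%:Z ^+ 2 * cesaro_scale%:Z);
  last first.
  by rewrite /X PoszM; ring.
by apply: norm_mul_le => //; rewrite /a; lia.
Qed.

(* The alternating sign replaces the weight, of size [t ^ 6], by its third
   difference along [x], of size only [t ^ 3], over [O(t ^ 2)] points. *)
Lemma norm_alternating_cesaro_le N t : (0 < t)%N -> (N < t ^ 2)%N ->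
  `|8 * \sum_(n < N.+1) ('C(N - n + 3, 3) * 6)%N%:Z * signed_count n| <=
  ((form_size Q).*2 + 9)%N%:Z ^+ 2
  * (8 * (15 * cesaro_scale%:Z) ^+ 3) * t%:Z ^+ 5.
Proof.
move=> t_gt0 lt_N; have size_gt0 := form_size_gt0 Q_pos.
pose M := (form_size Q * t + 4)%N.
rewrite (@sum_bin_signed_count M); last by rewrite /M; nia.
rewrite (@alternating_sum_diff _ 3) // => [|x y le_M]; last first.
  rewrite /cesaro_weight ifF //; apply/negP => val_le.
  have [||lt_x _] := @form_small Q x y (form_size Q * t).+1 N Q_pos;
    rewrite /M in le_M; nia.
set X := (cesaro_scale * t)%N%:Z.
apply: le_trans (_ : M.*2.+1%:R ^+ 2 * (8 * (15 * X) ^+ 3) <= _).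
  apply: norm_zsum2_le => x y le_x le_y; have [sg_norm _] := sg_alt.
  by rewrite normrM sg_norm mul1r norm_xdiff3_cesaro_weight_le.
rewrite [leRHS](_ : _ = (((form_size Q).*2 + 9)%N%:Z * t%:Z) ^+ 2
   * (8 * (15 * X) ^+ 3)); last by rewrite /X PoszM; ring.
rewrite ler_wpM2r ?mulr_ge0 ?exprn_ge0 // natz lerXn2r ?nnegrE ?mulr_ge0 //.
by rewrite /M; nia.
Qed.

End AlternatingForm.

Lemma nat_sqrt_exists n : exists t, (t ^ 2 <= n < t.+1 ^ 2)%N.
Proof.
elim: n => [|n [t t_sqrt]]; first by exists 0%N.
by case: (ltnP n.+1 (t.+1 ^ 2)) => h; [exists t | exists t.+1]; lia.
Qed.

Section AlternatingAbel.
Local Open Scope classical_set_scope.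
Variable R : realType.

Lemma cvg_cesaro_mean3_0 (u : R^nat) (K : R) :
  (forall n t, (0 < t)%N -> (n < t ^ 2)%N -> `|u n| <= K * t%:R ^+ 5) ->
  u n / 'C(n + 3, 3)%:R @[n --> \oo] --> (0 : R).
Proof.
move=> le_u; have K_ge0 : 0 <= K.
  by have := le_u 0%N 1%N isT isT; rewrite expr1n mulr1; apply: le_trans.
apply/cvgr0Pnorm_le => e e_gt0.
have ratio_ge0 : 0 <= 192 * K / e by rewrite divr_ge0 ?mulr_ge0 // ltW.
pose T := (Num.bound (192 * K / e)).+1.
exists (T ^ 2)%N => // n /= T2_le.
have [t /andP[t2_le n_lt]] := nat_sqrt_exists n.
have bin_gt0 : 0 < 'C(n + 3, 3)%:R :> R by rewrite ltr0n bin_gt0 leq_addl.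
rewrite normrM normfV normr_nat ler_pdivrMr //.
have T_le : (T <= t)%N by rewrite -ltnS -ltn_sqr (leq_ltn_trans T2_le).
have KT_le : 192 * K <= e * t%:R.
  have := archi_boundP ratio_ge0.
  rewrite ltr_pdivrMr // [X in _ < X]mulrC => /ltW.
  move=> /le_trans; apply; rewrite ler_wpM2l ?(ltW e_gt0) // ler_nat.
  exact: leq_trans (leqnSn _) T_le.
have t_le : t.+1%:R ^+ 5 <= (2 * t%:R) ^+ 5 :> R.
  rewrite lerXn2r ?nnegrE ?mulr_ge0 // -natrM ler_nat.
  by move: T_le; clear; lia.
have t6_le : t%:R ^+ 6 <= 6 * 'C(n + 3, 3)%:R :> R.
  rewrite -natrX -natrM ler_nat mulnC.
  have : (n ^ 3 <= 'C(n + 3, 3) * 6)%N.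
    by have := cesaro_weight_bin n; rewrite cesaro_weightE; [nia | lia].
  by apply: leq_trans; rewrite (expnM t 2 3) leq_exp2r.
apply: le_trans (le_u n t.+1 isT n_lt) _.
apply: le_trans (ler_wpM2l K_ge0 t_le) _.
apply: le_trans (_ : e * (t%:R ^+ 6 / 6) <= _); last first.
  by rewrite ler_wpM2l ?(ltW e_gt0) // ler_pdivrMr // mulrC.
rewrite (_ : K * _ = 192 * K * (t%:R ^+ 5 / 6)); last by field.
rewrite (_ : e * _ = e * t%:R * (t%:R ^+ 5 / 6)); last by field.
by rewrite ler_wpM2r // divr_ge0 ?exprn_ge0.
Qed.

Theorem has_abel_sum_signed_count (Q : bqform) sg :
  pos_def Q -> alternating sg ->
  has_abel_sum (fun n => (signed_count Q sg n)%:~R : R) 0.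
Proof.
move=> Q_pos sg_alt; apply: (@cesaro_abel _ _ 3).
pose K := ((form_size Q).*2 + 9)%N%:Z ^+ 2
  * (8 * (15 * (cesaro_scale Q)%:Z) ^+ 3).
apply: (@cvg_cesaro_mean3_0 _ K%:~R) => N t t_gt0 lt_N.
have := norm_alternating_cesaro_le Q_pos sg_alt t_gt0 lt_N; rewrite -/K.
rewrite csum_iterE; set S := \sum_(n < _) _ * signed_count _ _ _ => le_S.
have -> : \sum_(n < N.+1) 'C(N - n + 3, 3)%:R * (signed_count Q sg n)%:~R =
    S%:~R / 6 :> R.
  rewrite rmorph_sum mulr_suml; apply: eq_bigr => n _ /=.
  by rewrite intrM -pmulrn natrM; field.
have {le_S} : (`|8 * S|)%:~R <= (K * t%:Z ^+ 5)%:~R :> R by rewrite ler_int.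
rewrite intr_norm intrM rmorphM rmorphXn /= -!pmulrn normrM normr_nat.
rewrite normrM normfV normr_nat; have := normr_ge0 (S%:~R : R).
by move: (K%:~R * _) `|_| => B A; lra.
Qed.

Section FormCount.
Variable Q : bqform.
Hypothesis Q_pos : pos_def Q.

Definition form_count : nat -> int := signed_count Q (fun _ _ => 1).

Lemma form_countE M n : (form_size Q * n < M ^ 2)%N ->
  form_count n = zsum2 M (fun x y => (Q x y == n%:Z : nat)%:Z).
Proof.
by move=> lt_M; rewrite [LHS](signed_countE _ Q_pos lt_M);
  apply: eq_zsum2 => x y; case: eqP.
Qed.

Lemma form_count0 : form_count 0 = 1.
Proof.
rewrite (@form_countE 1) ?muln0 //.
rewrite -[RHS](@zsum2_pred1 _ 1 0 0 (fun _ _ => 1)) //; apply: eq_zsum2 => x y.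
case: eqP => [val0|val_neq0]; last first.
  case: andP => // -[/eqP x0 /eqP y0]; case: val_neq0.
  by rewrite x0 y0 /form_val; ring.
have [||lt_x lt_y] := @form_small Q x y 1 0 Q_pos; rewrite ?val0 ?muln0 //.
by rewrite ifT //; apply/andP; split; lia.
Qed.

(* The three signs [(-1) ^ x], [(-1) ^ y] and [(-1) ^ (x + y)] add up to [3] if
   [x] and [y] are both even and to [-1] otherwise. *)
Lemma form_count_alternating n :
  signed_count Q (fun x _ => parity_sign x) n
  + signed_count (form_swap Q) (fun x _ => parity_sign x) n
  + signed_count Q (fun x y => parity_sign (x + y)) n =
  4 * dilate 4 form_count n - form_count n.
Proof.
have size_gt0 := form_size_gt0 Q_pos; pose M := (form_size Q * n.+1)%N.
have lt_2M : (form_size Q * n < M.*2 ^ 2)%N by rewrite /M; nia.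
have Qs_pos : pos_def (form_swap Q) by rewrite pos_def_swap.
have lt_2Ms : (form_size (form_swap Q) * n < M.*2 ^ 2)%N.
  by rewrite form_size_swap.
rewrite !(signed_countE _ Q_pos lt_2M) (signed_countE _ Qs_pos lt_2Ms).
have -> : signed_count_upto (form_swap Q) (fun x _ => parity_sign x) M.*2 n =
    zsum2 M.*2 (fun x y => if Q x y == n%:Z then parity_sign y else 0).
  by rewrite [LHS]zsum2_swap; apply: eq_zsum2 => x y; rewrite form_swapE.
apply/eqP; rewrite -subr_eq opprK (form_countE lt_2M) -!zsum2D; apply/eqP.
transitivity (zsum2 M.*2 (fun x y => if odd `|x| || odd `|y| then 0
    else 4 * (Q x y == n%:Z : nat)%:Z)).
  apply: eq_zsum2 => x y; case: (Q x y == n%:Z); last by case: ifP.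
  rewrite /parity_sign; have -> : odd `|x + y| = odd `|x| (+) odd `|y| by lia.
  by case: (odd `|x|); case: (odd `|y|).
rewrite /zsum2 zsum_even => [|x x_odd]; last first.
  by apply: zsum0 => y; rewrite x_odd.
transitivity (zsum2 M (fun x y => 4 * (4 * Q x y == n%:Z : nat)%:Z)).
  apply: eq_zsum => x.
  rewrite zsum_even => [|y y_odd]; last by rewrite y_odd orbT.
  apply: eq_zsum => y; have -> : odd `|2 * x| || odd `|2 * y| = false by lia.
  by congr (4 * (nat_of_bool (_ == _))%:Z); rewrite /form_val; ring.
rewrite mul_zsum2r; congr (4 * _); rewrite /dilate; case: ifP => n4.
  rewrite (@form_countE M); last by have := leq_div n 4; rewrite /M; nia.
  apply: eq_zsum2 => x y; congr (nat_of_bool _)%:Z.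
  by move: n4; move: (Q x y) => q; clear; lia.
apply: zsum20 => x y; move: n4; move: (Q x y) => q; clear.
by case: eqP => //; lia.
Qed.

Theorem has_abel_sum_form_count (r : R^nat := fun n => (form_count n)%:~R) :
  has_abel_sum (r - 4 *: dilate 4 r) 0.
Proof.
have Qs_pos : pos_def (form_swap Q) by rewrite pos_def_swap.
have := has_abel_sumZ (-1) (has_abel_sumD
  (has_abel_sumD (has_abel_sum_signed_count Q_pos alternating_x)
                 (has_abel_sum_signed_count Qs_pos alternating_x))
  (has_abel_sum_signed_count Q_pos alternating_xy)).
rewrite !addr0 mulr0; congr has_abel_sum; apply/funext => n.
rewrite -[LHS]/(-1 * (_%:~R + _%:~R + _%:~R)) -!rmorphD form_count_alternating.
rewrite -[RHS]/(r n - 4 * dilate 4 r n) rmorphB rmorphM /= /dilate.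
by case: ifP => _; rewrite /r ?mulr0; ring.
Qed.

End FormCount.
End AlternatingAbel.
(** * The Abel sum attached to a periodic character *)

Section EtaTwist.
Local Open Scope classical_set_scope.
Variables (R : realType) (d : nat) (chi : nat -> R).
Implicit Types (x s : R) (r m n : nat).

(* The Dirichlet coefficients of [eta(s) L(s, chi)], where [eta] is the
   alternating zeta function. *)
Definition eta_conv n : R :=
  \sum_(1 <= m < n.+1 | (m %| n)%N) (-1) ^+ (n %/ m).-1 * chi m.

(* The value at [0] of the Dirichlet L-function of [chi]. *)
Definition L_at0 : R := - (\sum_(r < d) r%:R * chi r) / d%:R.

Definition eta_kernel x : R := x / (1 + x).

Lemma eta_kernel_bound x : 0 <= x -> 0 <= eta_kernel x <= x.
Proof.
move=> x_ge0; rewrite /eta_kernel divr_ge0 //=; last by rewrite addr_ge0.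
by rewrite ler_pdivrMr ?ltr_wpDr // ler_peMr // lerDl.
Qed.

Lemma norm_alternating_geometric_sub_le x n : 0 <= x ->
  `|\sum_(j < n) (-1) ^+ j * x ^+ j.+1 - eta_kernel x| <= x ^+ n.+1.
Proof.
move=> x_ge0; have x1_gt0 : 0 < 1 + x by rewrite ltr_wpDr.
have -> : \sum_(j < n) (-1) ^+ j * x ^+ j.+1 - eta_kernel x =
    - ((-1) ^+ n * x ^+ n.+1 / (1 + x)).
  elim: n => [|n IHn]; first by rewrite big_ord0 sub0r mul1r.
  by rewrite big_ord_recr /= addrAC IHn !exprS; field; rewrite gt_eqF.
rewrite normrN normrM normfV normrM normrX normrN1 expr1n mul1r.
rewrite (gtr0_norm x1_gt0) ger0_norm ?exprn_ge0 // ler_pdivrMr //.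
by rewrite ler_peMr ?exprn_ge0 // lerDl.
Qed.

Lemma pseries_eta_conv x n :
  pseries eta_conv x n = \sum_(1 <= m < n)
    chi m * \sum_(j < n.-1 %/ m) (-1) ^+ j * (x ^+ m) ^+ j.+1.
Proof.
rewrite pseriesE; elim: n => [|n IHn]; first by rewrite big_ord0 big_geq.
rewrite big_ord_recr /= {}IHn.
case: n => [|n]; first by rewrite /eta_conv !big_geq // add0r mul0r.
rewrite [RHS]big_nat_recr //= divnn /= big_ord1 expr0 mul1r expr1.
rewrite /eta_conv mulr_suml [X in _ + X]big_mkcond [X in _ + X]big_nat_recr //=.
rewrite dvdnn divnn /= expr0 mul1r addrA; congr (_ + _).
rewrite -big_split /= big_nat [RHS]big_nat.
apply: eq_bigr => m /andP[m_gt0 m_le].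
have quot_pred := divn_pred n.+1 m; rewrite /= in quot_pred.
case: ifP => dvd_m; rewrite dvd_m in quot_pred; last first.
  by rewrite addr0 quot_pred subn0.
have quotE : (n.+1 %/ m = (n %/ m).+1)%N.
  by rewrite quot_pred subn1 prednK // divn_gt0 // ltnW.
rewrite quotE big_ord_recr /= mulrDr; congr (_ + _).
by rewrite -exprM -quotE mulnC divnK // mulrCA mulrA.
Qed.

Hypothesis chi_le1 : forall n, `|chi n| <= 1.

Lemma is_cvg_series_eta_kernel x : 0 < x < 1 ->
  cvgn (series (fun m => chi m * eta_kernel (x ^+ m))).
Proof.
move=> /andP[x_gt0 x_lt1]; apply: normed_cvg.
apply: (@series_le_cvg _ _ (geometric 1 x)) => [m|m|m|] //=.
- by rewrite mul1r exprn_ge0 ?ltW.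
- have /andP[ker_ge0 ker_le] := eta_kernel_bound (exprn_ge0 m (ltW x_gt0)).
  by rewrite normrM (ger0_norm ker_ge0); apply: ler_pM.
by apply: is_cvg_geometric_series; rewrite gtr0_norm.
Qed.

Hypothesis chi_0 : chi 0 = 0.

Lemma norm_pseries_eta_conv_sub_le x n : 0 < x < 1 ->
  `|pseries eta_conv x n - series (fun m => chi m * eta_kernel (x ^+ m)) n|
  <= n.+1%:R * x ^+ n.
Proof.
move=> /andP[x_gt0 x_lt1]; have x_ge0 := ltW x_gt0.
have -> : series (fun m => chi m * eta_kernel (x ^+ m)) n =
    \sum_(1 <= m < n) chi m * eta_kernel (x ^+ m).
  case: n => [|n]; first by rewrite /series /= !big_geq.
  by rewrite /series /= big_ltn // chi_0 mul0r add0r.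
rewrite pseries_eta_conv -sumrB; apply: le_trans (ler_norm_sum _ _ _) _.
apply: le_trans (_ : \sum_(1 <= m < n) x ^+ n <= _); last first.
  rewrite sumr_const_nat -[leLHS]mulr_natl ler_wpM2r ?exprn_ge0 // ler_nat.
  by rewrite (leq_trans (leq_subr _ _)).
rewrite big_nat [leRHS]big_nat; apply: ler_sum => m /andP[m_gt0 _].
rewrite -mulrBr normrM -[leRHS]mul1r; apply: ler_pM => //.
apply: le_trans (norm_alternating_geometric_sub_le _ (exprn_ge0 m x_ge0)) _.
rewrite -exprM; apply: ler_wiXn2l; rewrite ?ltW //.
by have := ltn_ceil n.-1 m_gt0; rewrite mulnC; lia.
Qed.

Lemma cvg_pseries_eta_conv x : 0 < x < 1 ->
  pseries eta_conv x @ \oo -->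
    limn (series (fun m => chi m * eta_kernel (x ^+ m))).
Proof.
move=> x01; set f := series _.
rewrite -[pseries _ x](subrK f) -[X in _ --> X]add0r.
apply: cvgD (is_cvg_series_eta_kernel x01).
have small : n.+1%:R * x ^+ n @[n --> \oo] --> (0 : R).
  have := cvg_series_cvg_0 (cvgP _ (@cvg_pseries_bin _ 1 _ x01)).
  by under [X in X @ _]funext do rewrite /= bin1 addn1.
apply: norm_cvg0; apply: squeeze_cvgr (cvg_cst 0) small.
by near=> n; rewrite normr_ge0 norm_pseries_eta_conv_sub_le.
Unshelve. all: by end_near. Qed.

Lemma one_subX_bound s r : 0 <= s <= 1 -> 0 <= 1 - s ^+ r <= r%:R * (1 - s).
Proof.
move=> /andP[s_ge0 s_le1]; rewrite subr_ge0 exprn_ile1 //=.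
rewrite -opprB subrX1 -mulNr opprB mulrC ler_wpM2r ?subr_ge0 //.
rewrite -[r in r%:R]card_ord -sumr_const; apply: ler_sum => i _.
by rewrite exprn_ile1.
Qed.

Lemma one_subX_linear_error s r : 0 <= s <= 1 ->
  r%:R * (1 - s) - (1 - s ^+ r) <= r%:R ^+ 2 * (1 - s) ^+ 2.
Proof.
move=> s01; have /andP[_ s_le1] := s01.
have -> : r%:R * (1 - s) - (1 - s ^+ r) = (1 - s) * \sum_(i < r) (1 - s ^+ i).
  rewrite -[1 - s ^+ r]opprB subrX1 sumrB sumr_const card_ord.
  by move: (\sum_(i < r) _) => geom; ring.
have -> : r%:R ^+ 2 * (1 - s) ^+ 2 = (1 - s) * \sum_(i < r) r%:R * (1 - s).
  by rewrite sumr_const card_ord -mulr_natl; ring.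
apply: ler_wpM2l; rewrite ?subr_ge0 //; apply: ler_sum => i _.
have /andP[_] := one_subX_bound i s01; move=> /le_trans; apply.
by rewrite ler_wpM2r ?subr_ge0 // ler_nat ltnW.
Qed.

Lemma eta_kernel_linear_error x s r : 0 <= x <= 1 -> 0 <= s <= 1 ->
  `|eta_kernel x - eta_kernel (x * s ^+ r)
     - r%:R * (1 - s) * (x / (1 + x) ^+ 2)|
  <= 3 * r%:R ^+ 2 * (1 - s) ^+ 2 * x.
Proof.
move=> /andP[x_ge0 x_le1] s01; have /andP[s_ge0 s_le1] := s01.
have /andP[t_le1 y_ge] := one_subX_bound r s01.
have linear_error := one_subX_linear_error r s01.
set t := s ^+ r in t_le1 y_ge linear_error *.
set y := r%:R * (1 - s) in y_ge linear_error *.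
have t_ge0 : 0 <= t by rewrite exprn_ge0.
have y_sqr : r%:R ^+ 2 * (1 - s) ^+ 2 = y ^+ 2 by rewrite /y exprMn.
rewrite y_sqr in linear_error.
have xt_ge0 : 0 <= x * t by rewrite mulr_ge0.
have x1_neq0 : 1 + x != 0 by rewrite gt_eqF // ltr_wpDr.
have xt1_neq0 : 1 + x * t != 0 by rewrite gt_eqF // ltr_wpDr.
have -> : eta_kernel x - eta_kernel (x * t) - y * (x / (1 + x) ^+ 2) =
   x * ((1 - t - y) + x * (1 - t - y + y * (1 - t)))
     / ((1 + x) ^+ 2 * (1 + x * t)).
  by rewrite /eta_kernel; field; rewrite x1_neq0 xt1_neq0.
have denom_ge1 : 1 <= (1 + x) ^+ 2 * (1 + x * t).
  by rewrite -[leLHS]mulr1; apply: ler_pM; rewrite ?exprn_ege1 // lerDl.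
have denom_gt0 := lt_le_trans ltr01 denom_ge1.
rewrite normrM normfV (gtr0_norm denom_gt0) ler_pdivrMr //.
apply: le_trans (_ : 3 * r%:R ^+ 2 * (1 - s) ^+ 2 * x <= _); last first.
  by apply: ler_peMr => //; rewrite !mulr_ge0 ?exprn_ge0 ?subr_ge0.
rewrite normrM (ger0_norm x_ge0) mulrC; apply: ler_wpM2r => //.
rewrite -mulrA y_sqr.
have : 0 <= y * (1 - t) <= y ^+ 2.
  have y_ge0 : 0 <= y by exact: le_trans y_ge.
  by rewrite expr2 mulr_ge0 //=; apply: ler_wpM2l.
move: linear_error; move: (y ^+ 2) (y * (1 - t)) => Y Z y_le /andP[Z_ge0 Z_le].
by rewrite ler_norml; apply/andP; split; nra.
Qed.

Hypothesis d_gt0 : (0 < d)%N.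
Hypothesis chi_sum : \sum_(r < d) chi r = 0.

Lemma eta_kernel_block_error x s : 0 <= x <= 1 -> 0 <= s <= 1 ->
  `|\sum_(r < d) chi r * eta_kernel (x * s ^+ r)
     - L_at0 * (eta_kernel x - eta_kernel (x * s ^+ d))|
  <= 6 * d%:R ^+ 3 * (1 - s) ^+ 2 * x.
Proof.
move=> x01 s01; have d_pos : 0 < d%:R :> R by rewrite ltr0n.
pose drop r := eta_kernel x - eta_kernel (x * s ^+ r).
pose slope := x / (1 + x) ^+ 2.
pose error r := drop r - r%:R * (1 - s) * slope.
have -> : \sum_(r < d) chi r * eta_kernel (x * s ^+ r) - L_at0 * drop d =
    - \sum_(r < d) chi r * (d%:R * error r - r%:R * error d) / d%:R.
  have -> : \sum_(r < d) chi r * eta_kernel (x * s ^+ r) =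
      - \sum_(r < d) chi r * drop r.
    apply/eqP; rewrite -addr_eq0 -big_split /=; apply/eqP.
    transitivity (\sum_(r < d) chi r * eta_kernel x).
      by apply: eq_bigr => r _; rewrite /drop; ring.
    by rewrite -mulr_suml chi_sum mul0r.
  rewrite /L_at0 -mulrA mulNr opprK mulr_suml -!sumrN -big_split /=.
  by apply: eq_bigr => r _; rewrite /error; field; rewrite gt_eqF.
rewrite normrN; apply: le_trans (ler_norm_sum _ _ _) _.
apply: le_trans (_ : \sum_(r < d) 6 * d%:R ^+ 2 * (1 - s) ^+ 2 * x <= _).
  apply: ler_sum => r _; rewrite normrM normfV (gtr0_norm d_pos).
  rewrite ler_pdivrMr // normrM -[leRHS]mul1r; apply: ler_pM => //.
  have r_le : r%:R <= d%:R :> R by rewrite ler_nat ltnW.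
  have error_le q : (q <= d)%N ->
      `|error q| <= 3 * d%:R ^+ 2 * (1 - s) ^+ 2 * x.
    have [/andP[_ s_le1] /andP[x_ge0 _]] := (s01, x01).
    move=> q_le; apply: le_trans (eta_kernel_linear_error q x01 s01) _.
    rewrite !ler_wpM2r // ?exprn_ge0 ?subr_ge0 // ler_wpM2l //.
    by rewrite lerXn2r ?nnegrE // ler_nat.
  apply: le_trans (ler_normB _ _) _; rewrite !normrM !normr_nat.
  rewrite (_ : 6 * _ * _ * x * d%:R = d%:R * (3 * d%:R ^+ 2 * (1 - s) ^+ 2 * x)
    + d%:R * (3 * d%:R ^+ 2 * (1 - s) ^+ 2 * x)); last by ring.
  apply: lerD; first by apply: ler_wpM2l (ltW d_pos) _ _ _; exact/error_le/ltnW.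
  by apply: ler_pM => //; exact: error_le.
rewrite sumr_const card_ord -[leLHS]mulr_natl.
by rewrite le_eqVlt; apply/orP; left; apply/eqP; ring.
Qed.

Hypothesis chi_periodic : forall n, chi (d + n)%N = chi n.

Lemma series_periodic_blocks (g : R^nat) n :
  series (fun m => chi m * g m) (d * n)%N =
  \sum_(b < n) \sum_(r < d) chi r * g (d * b + r)%N.
Proof.
have chi_block b r : chi (d * b + r)%N = chi r.
  by elim: b => [|b IHb]; rewrite ?muln0 // mulnS -addnA chi_periodic.
rewrite /series /= big_mkord.
elim: n => [|n IHn]; first by rewrite muln0 !big_ord0.
rewrite big_ord_recr /= -IHn mulnS addnC big_split_ord /=; congr (_ + _).
by apply: eq_bigr => r _; rewrite chi_block.
Qed.

Lemma series_eta_kernel_error x n : 0 < x < 1 ->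
  `|series (fun m => chi m * eta_kernel (x ^+ m)) (d * n)%N
     - L_at0 * (2^-1 - eta_kernel (x ^+ (d * n)))|
  <= 6 * d%:R ^+ 3 * (1 - x).
Proof.
move=> /andP[x_gt0 x_lt1]; have [x_ge0 x_le1] := (ltW x_gt0, ltW x_lt1).
rewrite (series_periodic_blocks (fun m => eta_kernel (x ^+ m))).
have -> : L_at0 * (2^-1 - eta_kernel (x ^+ (d * n))) = \sum_(b < n)
    L_at0 * (eta_kernel (x ^+ (d * b)) - eta_kernel (x ^+ (d * b) * x ^+ d)).
  rewrite -mulr_sumr; congr (_ * _); elim: n => [|n IHn].
    by rewrite big_ord0 muln0 expr0 /eta_kernel; field.
  by rewrite big_ord_recr /= -IHn -exprD -mulnSr; ring.
rewrite -sumrB; under eq_bigr do under eq_bigr do rewrite exprD.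
apply: le_trans (ler_norm_sum _ _ _) _.
apply: le_trans (_ : \sum_(b < n) 6 * d%:R ^+ 3 * (1 - x) ^+ 2 * x ^+ b <= _).
  apply: ler_sum => b _; apply: le_trans (eta_kernel_block_error _ _) _.
  - by rewrite exprn_ge0 ?exprn_ile1.
  - by rewrite x_ge0.
  rewrite ler_wpM2l ?mulr_ge0 ?exprn_ge0 ?subr_ge0 //.
  by rewrite ler_wiXn2l // leq_pmull.
have geom : (1 - x) * (\sum_(b < n) x ^+ b) = 1 - x ^+ n.
  by rewrite -[1 - x]opprB mulNr -subrX1 opprB.
rewrite -mulr_sumr expr2 mulrA -mulrA geom ler_piMr ?gerBl ?exprn_ge0 //.
by rewrite !mulr_ge0 ?exprn_ge0 ?subr_ge0.
Qed.

Lemma lim_eta_kernel_error x : 0 < x < 1 ->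
  `|limn (series (fun m => chi m * eta_kernel (x ^+ m))) - L_at0 / 2|
  <= 6 * d%:R ^+ 3 * (1 - x).
Proof.
move=> x01; have /andP[x_gt0 x_lt1] := x01.
have cvg_dn : (d * n)%N @[n --> \oo] --> \oo.
  apply/cvgnyPge => N; exists N => // n /= /leq_trans; apply.
  exact: leq_pmull.
set f := series _; have cvg_f : f (d * n)%N @[n --> \oo] --> limn f.
  by apply: cvg_comp cvg_dn _; exact: is_cvg_series_eta_kernel.
have cvg_ker : eta_kernel (x ^+ (d * n)) @[n --> \oo] --> (0 : R).
  have cvg_x : x ^+ (d * n) @[n --> \oo] --> (0 : R).
    by apply: cvg_comp cvg_dn _; apply: cvg_expr; rewrite gtr0_norm.
  apply: squeeze_cvgr (cvg_cst 0) cvg_x; near=> n.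
  by apply: eta_kernel_bound; rewrite exprn_ge0 ?ltW.
have cvg_diff :
    `|f (d * n)%N - L_at0 * (2^-1 - eta_kernel (x ^+ (d * n)))| @[n --> \oo]
    --> `|limn f - L_at0 / 2|.
  apply: cvg_norm; apply: cvgB; first exact: cvg_f.
  apply: cvgM; first exact: cvg_cst.
  by have := cvgB (cvg_cst (2^-1 : R)) cvg_ker; rewrite subr0; apply.
rewrite -(cvg_lim _ cvg_diff) //.
apply: limr_le; first exact: cvgP cvg_diff.
by near=> n; exact: series_eta_kernel_error.
Unshelve. all: by end_near. Qed.

Theorem has_abel_sum_eta_conv : has_abel_sum eta_conv (L_at0 / 2).
Proof.
apply: has_abel_sum_near cvg_pseries_eta_conv _.
have C_gt0 : 0 < 6 * d%:R ^+ 3 :> R by rewrite mulr_gt0 // exprn_gt0 // ltr0n.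
apply/cvgrPdist_le => e e_gt0; near=> x.
have x01 : 0 < x < 1 by near: x; exact: near_at_left1.
rewrite distrC; apply: le_trans (lim_eta_kernel_error x01) _.
rewrite -ler_pdivlMl // lerBlDr -lerBlDl ltW //; near: x.
by apply: nbhs_left_gt; rewrite gtrBl mulr_gt0 // invr_gt0.
Unshelve. all: by end_near. Qed.

End EtaTwist.
(** * Ideals of given norm and divisor sums *)

Lemma perm_divisorsM m n : (0 < m)%N -> (0 < n)%N -> coprime m n ->
  perm_eq (divisors (m * n)) [seq (x * y)%N | x <- divisors m, y <- divisors n].
Proof.
move=> m_gt0 n_gt0 co_mn.
have co_div x y : x \in divisors m -> y \in divisors n -> coprime x y.
  rewrite -!dvdn_divisors // => x_m y_n.
  exact: coprime_dvdl x_m (coprime_dvdr y_n co_mn).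
apply: uniq_perm; first exact: divisors_uniq.
  apply: allpairs_uniq; rewrite ?divisors_uniq // => -[x y] [x' y'].
  move=> /allpairsP[[a b] /= [a_m b_n [-> ->]]].
  move=> /allpairsP[[a' b'] /= [a'_m b'_n [-> ->]]] eq_prod.
  have a_a' : (a %| a')%N.
    by rewrite -(Gauss_dvdl _ (co_div _ _ a_m b'_n)) -eq_prod dvdn_mulr.
  have a'_a : (a' %| a)%N.
    by rewrite -(Gauss_dvdl _ (co_div _ _ a'_m b_n)) eq_prod dvdn_mulr.
  have eq_a : a = a' by apply/eqP; rewrite eqn_dvd a_a' a'_a.
  rewrite eq_a in eq_prod *; congr (_, _); apply/eqP.
  rewrite -(@eqn_pmul2l a') ?eq_prod //.
  by move: a'_m; rewrite -dvdn_divisors // => /dvdn_gt0; apply.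
move=> z; rewrite -dvdn_divisors ?muln_gt0 ?m_gt0 //; apply/idP/allpairsP.
  move=> z_mn; have gcd_gt0 : (0 < gcdn z m)%N by rewrite gcdn_gt0 m_gt0 orbT.
  have zE : z = (gcdn z m * (z %/ gcdn z m))%N.
    by rewrite mulnC divnK // dvdn_gcdl.
  exists (gcdn z m, z %/ gcdn z m)%N.
  split => //=; rewrite -dvdn_divisors ?dvdn_gcdr //.
  by rewrite -(dvdn_pmul2l gcd_gt0) -zE muln_gcdl dvdn_gcd z_mn dvdn_mulr.
by move=> [[x y] /= [x_m y_n ->]]; apply: dvdn_mul; rewrite dvdn_divisors.
Qed.

Lemma perm_divisorsX q j : prime q ->
  perm_eq (divisors (q ^ j)) [seq (q ^ i)%N | i <- iota 0 j.+1].
Proof.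
move=> q_prime; have q_gt1 := prime_gt1 q_prime.
apply: uniq_perm; first exact: divisors_uniq.
  rewrite map_inj_uniq ?iota_uniq // => x y /eqP.
  by rewrite eqn_exp2l // => /eqP.
move=> z; rewrite -dvdn_divisors ?expn_gt0 ?(ltnW q_gt1) //.
apply/(dvdn_pfactor _ _ q_prime)/mapP => [[i le_ij ->]|[i]].
  by exists i => //; rewrite mem_iota add0n ltnS.
by rewrite mem_iota add0n ltnS => /andP[_ le_ij] ->; exists i.
Qed.

Definition square_free (n : nat) : Prop :=
  forall q, prime q -> ~~ (q ^ 2 %| n)%N.

(* With [omega] the root [(1 + sqrt (1 - 4 k)) / 2] of [X ^ 2 - X + k], this is
   the norm of [b + omega]. *)
Definition omega_norm (k b : nat) : nat := (b ^ 2 + b + k)%N.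

Definition root_mod (k a b : nat) : bool := (a %| omega_norm k b)%N.

Definition roots_mod (k a : nat) : seq nat :=
  [seq b <- iota 0 a | root_mod k a b].

Definition root_count (k a : nat) : nat := size (roots_mod k a).

(* An ideal of norm [n] is [c (Z a + Z (b + omega))] with [c ^ 2 a = n] and [b]
   a root of [X ^ 2 + X + k] modulo [a]. *)
Definition ideal_count (k n : nat) : nat :=
  \sum_(c <- divisors n | (c ^ 2 %| n)%N) root_count k (n %/ c ^ 2).

Section RootCounting.
Variable k : nat.
Local Notation disc := (4 * k - 1)%N.

Lemma mem_roots_mod a b : (b \in roots_mod k a) = (b < a)%N && root_mod k a b.
Proof. by rewrite mem_filter mem_iota andbC. Qed.

Lemma roots_mod_uniq a : uniq (roots_mod k a).
Proof. by rewrite filter_uniq // iota_uniq. Qed.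

Lemma root_count1 : root_count k 1 = 1%N.
Proof. by rewrite /root_count /roots_mod /= /root_mod dvd1n. Qed.

Lemma root_mod_modn a b : root_mod k a (b %% a) = root_mod k a b.
Proof.
rewrite /root_mod /omega_norm.
have -> : (b ^ 2 + b + k = a * ((b %/ a) * b + (b %/ a) * (b %% a) + b %/ a)
   + ((b %% a) ^ 2 + b %% a + k))%N.
  by have := divn_eq b a; move: (b %/ a)%N (b %% a)%N => u v ->; lia.
by rewrite [RHS]dvdn_addr // dvdn_mulr.
Qed.

Lemma root_countM a b : (0 < a)%N -> (0 < b)%N -> coprime a b ->
  root_count k (a * b) = (root_count k a * root_count k b)%N.
Proof.
move=> a_gt0 b_gt0 co_ab; rewrite /root_count -(size_allpairs pair).
rewrite -(size_map (fun r => (r %% a, r %% b)%N)); apply: perm_size.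
have root_modM r : root_mod k (a * b) r = root_mod k a r && root_mod k b r.
  exact: Gauss_dvd.
apply: uniq_perm.
- rewrite map_inj_in_uniq ?roots_mod_uniq // => x y.
  rewrite !mem_roots_mod => /andP[x_lt _] /andP[y_lt _] [eq_a eq_b].
  have /eqP := chinese_remainder co_ab x y; rewrite eq_a eq_b !eqxx /= => /eqP.
  by move/eqP; rewrite !modn_small // => /eqP.
- by apply: allpairs_uniq; rewrite ?roots_mod_uniq // => -[? ?] [? ?].
move=> [x y]; apply/mapP/allpairsP.
  move=> [r].
  rewrite mem_roots_mod root_modM => /andP[_ /andP[r_a r_b]] [-> ->].
  exists (r %% a, r %% b)%N => /=.
  by split=> //; rewrite mem_roots_mod ltn_mod ?a_gt0 ?b_gt0 root_mod_modn.
move=> [[u v] /=]; rewrite !mem_roots_mod.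
move=> [/andP[u_lt u_a] /andP[v_lt v_b] [-> ->]].
pose r := (chinese a b u v %% (a * b))%N.
have r_a : (r %% a = u)%N.
  by rewrite /r modn_dvdm ?dvdn_mulr // chinese_modl // modn_small.
have r_b : (r %% b = v)%N.
  by rewrite /r modn_dvdm ?dvdn_mull // chinese_modr // modn_small.
exists r; last by rewrite r_a r_b.
rewrite mem_roots_mod root_modM -(root_mod_modn a) -(root_mod_modn b) r_a r_b.
by rewrite u_a v_b ltn_mod muln_gt0 a_gt0 b_gt0.
Qed.

Hypothesis k_gt0 : (0 < k)%N.

Lemma omega_norm_disc b : (4 * omega_norm k b = b.*2.+1 ^ 2 + disc)%N.
Proof. by rewrite /omega_norm; move: k_gt0; lia. Qed.

Section PrimePower.
Variable q : nat.
Hypothesis q_prime : prime q.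

Lemma root_count_ramified j : (q %| disc)%N -> ~~ (q ^ 2 %| disc)%N ->
  root_count k (q ^ j.+2) = 0%N.
Proof.
move=> q_disc /negP q2_disc; apply/eqP.
rewrite /root_count size_filter -leqn0 leqNgt -has_count.
apply/hasPn => b _; apply/negP => root_b; apply: q2_disc.
have q2_norm : (q ^ 2 %| 4 * omega_norm k b)%N.
  by rewrite dvdn_mull //; apply: dvdn_trans root_b; rewrite dvdn_exp2l.
have q_sqr : (q %| b.*2.+1 ^ 2)%N.
  rewrite -(dvdn_addl _ q_disc) -omega_norm_disc.
  by apply: dvdn_trans q2_norm; rewrite expnS dvdn_mulr.
rewrite Euclid_dvdX // andbT in q_sqr.
by rewrite -(dvdn_addr _ (dvdn_exp2r 2 q_sqr)) -omega_norm_disc.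
Qed.

Hypothesis q_disc : ~~ (q %| disc)%N.

Lemma coprime_root_deriv b : root_mod k q b -> coprime q b.*2.+1.
Proof.
move=> root_b; rewrite prime_coprime //; apply: contra q_disc => q_deriv.
have : (q %| b.*2.+1 ^ 2 + disc)%N by rewrite -omega_norm_disc dvdn_mull.
by rewrite dvdn_addr // expnS dvdn_mulr.
Qed.

Lemma root_mod_lift_inj j x y : (0 < j)%N ->
  x \in roots_mod k (q ^ j.+1) -> y \in roots_mod k (q ^ j.+1) ->
  (x = y %[mod q ^ j])%N -> x = y.
Proof.
wlog le_xy : x y / (x <= y)%N => [IH j_gt0 x_root y_root eq_xy|].
  by case: (leqP x y) => [|/ltnW] le_yx; [exact: IH | apply/esym; exact: IH].
move=> j_gt0.
rewrite !mem_roots_mod => /andP[_ x_root] /andP[y_lt y_root] eq_xy.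
have qj_diff : (q ^ j %| y - x)%N by rewrite -eqn_mod_dvd //; apply/eqP.
have qSj_prod : (q ^ j.+1 %| (y - x) * (x + y).+1)%N.
  have -> : ((y - x) * (x + y).+1 = omega_norm k y - omega_norm k x)%N.
    by move: le_xy; rewrite /omega_norm; clear; nia.
  exact: dvdn_sub.
have co_sum : coprime (q ^ j.+1) (x + y).+1.
  rewrite coprime_pexpl //.
  have -> : ((x + y).+1 = x.*2.+1 + (y - x))%N by move: le_xy; clear; lia.
  have /coprime_root_deriv : root_mod k q x.
    by apply: dvdn_trans x_root; rewrite expnS dvdn_mulr.
  have /dvdnP[z ->] : (q %| y - x)%N.
    by apply: dvdn_trans qj_diff; exact: dvdn_exp.
  by rewrite addnC /coprime gcdnMDl.
move: qSj_prod; rewrite Gauss_dvdl // => qSj_diff.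
case: (posnP (y - x)) => [|diff_gt0]; first by move: le_xy; clear; lia.
by have := dvdn_leq diff_gt0 qSj_diff; move: y_lt le_xy diff_gt0; clear; lia.
Qed.

Lemma root_mod_lift_exists j b : (0 < j)%N -> b \in roots_mod k (q ^ j) ->
  exists2 x, x \in roots_mod k (q ^ j.+1) & (x %% q ^ j)%N = b.
Proof.
move=> j_gt0; rewrite mem_roots_mod => /andP[b_lt root_b].
have q_gt0 := prime_gt0 q_prime.
have qj_gt0 : (0 < q ^ j)%N by rewrite expn_gt0 q_gt0.
have /dvdnP[u norm_b] := root_b.
have co_deriv : coprime b.*2.+1 q.
  rewrite coprime_sym; apply: coprime_root_deriv.
  by apply: dvdn_trans root_b; exact: dvdn_exp.
(* Newton's step: [t] solves [u + t (2 b + 1) = 0] modulo [q]. *)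
have [t newton] : exists t, (q %| u + t * b.*2.+1)%N.
  pose z := chinese b.*2.+1 q 0 (q.-1 * u).
  have /dvdnP[t zE] : (b.*2.+1 %| z)%N.
    by rewrite /dvdn /z chinese_modl // mod0n.
  exists t; rewrite -zE /dvdn -modnDmr /z chinese_modr // modnDmr.
  by rewrite -mulSn prednK // modnMr.
exists (b + (t %% q) * q ^ j)%N; last by rewrite addnC modnMDl modn_small.
rewrite mem_roots_mod; apply/andP; split.
  rewrite expnS; apply: (@leq_trans ((t %% q).+1 * q ^ j)).
    by rewrite mulSn ltn_add2r.
  by rewrite leq_mul2r ltn_pmod ?orbT.
rewrite /root_mod.
have -> : (omega_norm k (b + t %% q * q ^ j) =
   q ^ j * (u + (t %% q) * b.*2.+1 + (t %% q) ^ 2 * q ^ j))%N.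
  by move: norm_b; rewrite /omega_norm; move: (q ^ j)%N (t %% q)%N => Q T; lia.
rewrite expnSr dvdn_pmul2l // dvdn_addl; last by rewrite dvdn_mull // dvdn_exp.
by rewrite /dvdn -modnDmr modnMml modnDmr; exact: newton.
Qed.

Lemma root_count_lift j : (0 < j)%N ->
  root_count k (q ^ j.+1) = root_count k (q ^ j).
Proof.
move=> j_gt0; rewrite /root_count -(size_map (modn^~ (q ^ j)%N)).
apply: perm_size.
apply: uniq_perm; last move=> b; first 1 last.
- exact: roots_mod_uniq.
- apply/mapP/idP => [[x x_root ->]|/(root_mod_lift_exists j_gt0)[x x_root <-]].
    move: x_root.
    rewrite !mem_roots_mod ltn_mod expn_gt0 prime_gt0 //= root_mod_modn.
    by move=> /andP[_]; apply: dvdn_trans; rewrite expnS dvdn_mull.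
  by exists x.
rewrite map_inj_in_uniq ?roots_mod_uniq // => x y; exact: root_mod_lift_inj.
Qed.

End PrimePower.

Lemma ideal_countM a b : (0 < a)%N -> (0 < b)%N -> coprime a b ->
  ideal_count k (a * b) = (ideal_count k a * ideal_count k b)%N.
Proof.
move=> a_gt0 b_gt0 co_ab.
rewrite /ideal_count big_mkcond
  (perm_big _ (perm_divisorsM a_gt0 b_gt0 co_ab)) /=.
rewrite big_allpairs_dep /= big_distrl /= [RHS]big_mkcond /=.
rewrite big_seq_cond [RHS]big_seq_cond; apply: eq_bigr => x; rewrite andbT.
rewrite -dvdn_divisors // => x_a; case: ifP => x2_a; last first.
  rewrite big1_seq // => y _; case: ifP => // xy2; move: x2_a.
  have : (x ^ 2 %| a * b)%N by apply: dvdn_trans xy2; rewrite expnMn dvdn_mulr.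
  by rewrite Gauss_dvdl ?coprimeXl ?(coprime_dvdl x_a) // => ->.
rewrite big_distrr /= -big_mkcond big_seq_cond [RHS]big_seq_cond.
have sqr_dvd y : (y %| b)%N -> ((x * y) ^ 2 %| a * b)%N = (y ^ 2 %| b)%N.
  move=> y_b; apply/idP/idP => [xy2|y2]; last by rewrite expnMn dvdn_mul.
  have : (y ^ 2 %| a * b)%N by apply: dvdn_trans xy2; rewrite expnMn dvdn_mull.
  by rewrite Gauss_dvdr // coprimeXl // coprime_sym (coprime_dvdr y_b).
apply: eq_big => y; rewrite -dvdn_divisors //.
  by case: (boolP (y %| b)%N) => //= /sqr_dvd ->.
move=> /andP[y_b]; rewrite sqr_dvd // => y2_b.
have sqr_gt0 z c : (0 < c)%N -> (z %| c)%N -> (0 < z ^ 2)%N.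
  by move=> c_gt0 z_c; rewrite expn_gt0 (dvdn_gt0 c_gt0 z_c).
have [x2_gt0 y2_gt0] := (sqr_gt0 _ _ a_gt0 x_a, sqr_gt0 _ _ b_gt0 y_b).
have -> : (a * b %/ (x * y) ^ 2 = (a %/ x ^ 2) * (b %/ y ^ 2))%N.
  rewrite -{1}(divnK x2_a) -{1}(divnK y2_b) mulnACA -expnMn mulnK //.
  by rewrite expnMn muln_gt0 x2_gt0.
apply: root_countM.
- by rewrite (divn_gt0 _ x2_gt0); exact: dvdn_leq a_gt0 x2_a.
- by rewrite (divn_gt0 _ y2_gt0); exact: dvdn_leq b_gt0 y2_b.
by apply: coprime_dvdl (dvdn_div x2_a) _;
  apply: coprime_dvdr (dvdn_div y2_b) co_ab.
Qed.

Lemma ideal_countX q j : prime q -> ideal_count k (q ^ j) =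
  (\sum_(i < j.+1 | (i.*2 <= j)%N) root_count k (q ^ (j - i.*2)))%N.
Proof.
move=> q_prime; have q_gt1 := prime_gt1 q_prime.
rewrite /ideal_count (perm_big _ (perm_divisorsX j q_prime)) big_map.
rewrite -[iota 0 _]/(index_iota 0 j.+1) big_mkord.
apply: eq_big => i; first by rewrite -expnM dvdn_Pexp2l // muln2.
by rewrite -expnM dvdn_Pexp2l // muln2 => le_i; rewrite -expnB // (ltnW q_gt1).
Qed.

Lemma ideal_countXSS q j : prime q ->
  ideal_count k (q ^ j.+2) =
    (root_count k (q ^ j.+2) + ideal_count k (q ^ j))%N.
Proof.
move=> q_prime; rewrite !ideal_countX // big_mkcond big_ord_recl /= subn0.
congr (_ + _)%N; rewrite big_ord_recr /= ifF ?addn0; last by rewrite /bump; lia.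
rewrite [RHS]big_mkcond; apply: eq_bigr => i _.
by rewrite /bump /= add1n doubleS !ltnS !subSS.
Qed.

(* [chi] records how the primes split in the quadratic order of discriminant
   [1 - 4 k]: a prime [q] has [1 + chi q] prime ideals of norm [q] above it. *)
Record splitting_character (chi : nat -> int) : Prop := SplittingCharacter {
  chi_1 : chi 1 = 1;
  chi_M : forall m n, chi (m * n) = chi m * chi n;
  chi_sign : forall n, [|| chi n == 0, chi n == 1 | chi n == -1];
  chi_split : forall q, prime q -> (root_count k q)%:Z = 1 + chi q;
  chi_ramified : forall q, prime q -> (chi q == 0) = (q %| disc)%N
}.

End RootCounting.

Definition divisor_sum (chi : nat -> int) (n : nat) : int :=
  \sum_(e <- divisors n) chi e.

Section DivisorSums.
Variables (k : nat) (chi : nat -> int).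
Hypotheses (k_gt0 : (0 < k)%N) (disc_sqfree : square_free (4 * k - 1)).
Hypothesis chi_splitting : splitting_character k chi.

Lemma divisor_sumM m n : (0 < m)%N -> (0 < n)%N -> coprime m n ->
  divisor_sum chi (m * n) = divisor_sum chi m * divisor_sum chi n.
Proof.
move=> m_gt0 n_gt0 co_mn; rewrite /divisor_sum.
rewrite (perm_big _ (perm_divisorsM m_gt0 n_gt0 co_mn)) big_allpairs_dep /=.
rewrite mulr_suml; apply: eq_bigr => x _.
by rewrite mulr_sumr; apply: eq_bigr => y _; exact: (chi_M chi_splitting).
Qed.

Lemma divisor_sumX q j : prime q ->
  divisor_sum chi (q ^ j) = \sum_(i < j.+1) chi q ^+ i.
Proof.
move=> q_prime.
rewrite /divisor_sum (perm_big _ (perm_divisorsX j q_prime)) big_map.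
rewrite -[iota 0 _]/(index_iota 0 j.+1) big_mkord; apply: eq_bigr => i _.
elim: (i : nat) => [|n IHn]; first exact: (chi_1 chi_splitting).
by rewrite expnS (chi_M chi_splitting) IHn exprS.
Qed.

Lemma root_countX q j : prime q -> (root_count k (q ^ j.+1))%:Z =
  if chi q == 0 then (j == 0)%N%:Z else 1 + chi q.
Proof.
move=> q_prime; have q_split := chi_split chi_splitting q_prime.
rewrite (chi_ramified chi_splitting) //; case: ifP => q_disc.
  case: j => [|j]; last by rewrite root_count_ramified // disc_sqfree.
  rewrite expn1 q_split.
  by move: q_disc; rewrite -(chi_ramified chi_splitting) // => /eqP ->.
elim: j => [|j IHj]; first by rewrite expn1 q_split.
by rewrite root_count_lift // q_disc.
Qed.

Lemma ideal_countX_divisor_sum q j : prime q ->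
  (ideal_count k (q ^ j))%:Z = divisor_sum chi (q ^ j).
Proof.
move=> q_prime; have [n] := ubnP j; elim: n j => // n IHn [|[|j]] le_jn.
- rewrite ideal_countX // divisor_sumX // big_mkcond !big_ord1 /= expn0.
  by rewrite root_count1 expr0.
- rewrite ideal_countX // big_mkcond !big_ord_recr big_ord0 /= add0n addn0
    subn0.
  rewrite (chi_split chi_splitting) // divisor_sumX // !big_ord_recr big_ord0.
  by rewrite /= add0r expr0 expr1.
rewrite ideal_countXSS // PoszD IHn; last by lia.
rewrite root_countX // !divisor_sumX // [RHS]big_ord_recr
  [X in _ = X + _]big_ord_recr /=.
case/or3P: (chi_sign chi_splitting q) => /eqP ->;
  rewrite ?eqxx /= ?expr0n ?expr1n /=;
  move: (\sum_(i < _) _) => S; rewrite ?exprS ?mulN1r; lia.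
Qed.

Lemma ideal_count_divisor_sum n : (0 < n)%N ->
  (ideal_count k n)%:Z = divisor_sum chi n.
Proof.
have [m] := ubnP n; elim: m n => // m IHm n le_nm n_gt0.
case: (leqP n 1) => n_gt1.
  have -> : n = 1%N by lia.
  by have := @ideal_countX_divisor_sum 2 0 isT; rewrite expn0.
have q_prime := pdiv_prime n_gt1; set q := pdiv n in q_prime.
have [j j_gt0 [r co_qr nE]] :
    exists2 j, (0 < j)%N & exists2 r, coprime q r & n = (r * q ^ j)%N.
  exists (logn q n).
    by rewrite logn_gt0 mem_primes q_prime n_gt0 pdiv_dvd.
  by have [r co_qr nE] := pfactor_coprime q_prime n_gt0; exists r.
have r_gt0 : (0 < r)%N by case: r nE {co_qr} => // nE; move: n_gt0; rewrite nE.
have qj_gt0 : (0 < q ^ j)%N by rewrite expn_gt0 prime_gt0.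
have co_rqj : coprime r (q ^ j) by rewrite coprime_sym coprimeXl.
rewrite nE ideal_countM // divisor_sumM // PoszM ideal_countX_divisor_sum //
  IHm //.
have : (1 < q ^ j)%N by rewrite -(expn0 q) ltn_exp2l // prime_gt1.
by move: le_nm; rewrite nE; nia.
Qed.

End DivisorSums.
(** * Splitting of primes via Gauss periods *)

Definition qres (p : nat) (u : 'F_p) : bool := u ^+ (p.-1)./2 == 1.
Definition qnonres (p : nat) (u : 'F_p) : bool := u ^+ (p.-1)./2 == -1.

Definition legendre (p n : nat) : int :=
  if (n%:R : 'F_p) == 0 then 0 else if qres (n%:R : 'F_p) then 1 else -1.

Section Legendre.
Variable p : nat.
Hypothesis p_prime : prime p.
Implicit Types u v c : 'F_p.

Lemma Fp_nat_eq0 n : ((n%:R : 'F_p) == 0) = (p %| n)%N.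
Proof. by rewrite -(dvdn_pcharf (pchar_Fp p_prime)). Qed.

Lemma legendre_eq0 n : (legendre p n == 0) = (p %| n)%N.
Proof. by rewrite /legendre -Fp_nat_eq0; case: ifP => // _; case: ifP. Qed.

Lemma legendre0 : legendre p 0 = 0.
Proof. by apply/eqP; rewrite legendre_eq0. Qed.

Lemma legendre_sign n :
  [|| legendre p n == 0, legendre p n == 1 | legendre p n == -1].
Proof. by rewrite /legendre; case: ifP => // _; case: ifP. Qed.

Lemma legendre_modn n : legendre p (n %% p) = legendre p n.
Proof.
rewrite /legendre; suff -> : ((n %% p)%:R : 'F_p) = n%:R by [].
by rewrite -[RHS]natr_Zp val_Fp_nat.
Qed.

Lemma legendreD n : legendre p (p + n) = legendre p n.
Proof. by rewrite -legendre_modn modnDl legendre_modn. Qed.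

Lemma legendre_sqr n : ~~ (p %| n)%N -> legendre p n * legendre p n = 1.
Proof. by rewrite -legendre_eq0; case/or3P: (legendre_sign n) => /eqP ->. Qed.

Lemma qres1 : qres (1 : 'F_p). Proof. by rewrite /qres expr1n. Qed.

Lemma qresM c u : qres c -> qres (c * u) = qres u.
Proof. by rewrite /qres exprMn => /eqP ->; rewrite mul1r. Qed.

Lemma qresMN c u : qnonres c -> qres (c * u) = qnonres u.
Proof.
by rewrite /qres /qnonres exprMn => /eqP ->; rewrite mulN1r eqr_oppLR.
Qed.

Lemma qnonresMN c u : qnonres c -> qnonres (c * u) = qres u.
Proof.
by rewrite /qres /qnonres exprMn => /eqP ->; rewrite mulN1r eqr_opp.
Qed.

Lemma qresV u : qres u^-1 = qres u.
Proof. by rewrite /qres exprVn invr_eq1. Qed.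

Hypothesis p_odd : odd p.

Lemma half_pred_gt0 : (0 < (p.-1)./2)%N.
Proof. by have := prime_gt1 p_prime; move: p_odd; clear; lia. Qed.

Lemma qres_neq0 u : qres u -> u != 0.
Proof.
apply: contraTneq => ->.
by rewrite /qres expr0n gtn_eqF ?half_pred_gt0 //= eq_sym oner_eq0.
Qed.

Lemma qnonres_neq0 u : qnonres u -> u != 0.
Proof.
apply: contraTneq => ->.
by rewrite /qnonres expr0n gtn_eqF ?half_pred_gt0 //= eq_sym oppr_eq0 oner_eq0.
Qed.

Lemma qnonresE u : u != 0 -> qnonres u = ~~ qres u.
Proof.
move=> u_neq0; have : (u ^+ (p.-1)./2) ^+ 2 = 1.
  rewrite -exprM muln2 (_ : ((p.-1)./2).*2 = p.-1); last first.
    by move: p_odd; clear; lia.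
  apply: (mulfI u_neq0); rewrite mulr1 -exprS prednK ?prime_gt0 //.
  by rewrite -{2}(expf_card u) card_Fp.
have m1_neq1 : (-1 : 'F_p) != 1.
  rewrite eq_sym -subr_eq0 opprK -[1 + 1]/(2%:R) Fp_nat_eq0 gtnNdvd //.
  by have := prime_gt1 p_prime; move: p_odd; clear; lia.
move/eqP; rewrite sqrf_eq1 /qres /qnonres => /orP[] /eqP ->; rewrite eqxx //=.
  by rewrite eq_sym (negbTE m1_neq1).
Qed.

Lemma qres0 : qres (0 : 'F_p) = false.
Proof. by apply/negP => /qres_neq0; rewrite eqxx. Qed.

Lemma qnonres0 : qnonres (0 : 'F_p) = false.
Proof. by apply/negP => /qnonres_neq0; rewrite eqxx. Qed.

Lemma legendre_prime_neq0 q : prime q -> q != p -> legendre p q != 0.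
Proof. by move=> q_prime; rewrite legendre_eq0 dvdn_prime2 // eq_sym. Qed.

Lemma legendre1 : legendre p 1 = 1.
Proof. by rewrite /legendre qres1 oner_eq0. Qed.

Lemma legendreM m n : legendre p (m * n) = legendre p m * legendre p n.
Proof.
rewrite /legendre natrM mulf_eq0.
case: eqVneq => [|m_neq0]; first by rewrite mul0r.
case: eqVneq => [|n_neq0] /=; first by rewrite mulr0.
case: (boolP (qres m%:R)) => [m_res|]; first by rewrite qresM // mul1r.
rewrite -qnonresE // => m_nonres; rewrite qresMN // qnonresE //.
by case: (qres n%:R); rewrite mulN1r ?opprK.
Qed.

End Legendre.

Lemma root_count_ramified_prime q k :
  prime q -> (0 < k)%N -> (q %| 4 * k - 1)%N ->
  root_count k q = 1%N.
Proof.
move=> q_prime k_gt0 q_disc; have q_gt0 := prime_gt0 q_prime.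
have q_odd : odd q.
  case/dvdnP: q_disc => z disc_eq; have : odd (z * q) by rewrite -disc_eq; lia.
  by rewrite oddM => /andP[].
rewrite /root_count size_filter.
transitivity (count_mem (q.-1./2) (iota 0 q)); last first.
  rewrite count_uniq_mem ?iota_uniq // mem_iota.
  by move: q_odd; clear; case: q => // n; lia.
apply: eq_in_count => b; rewrite mem_iota add0n => /andP[_ b_lt].
have co_q4 : coprime q 4 by rewrite (@coprime_pexpr 2 q 2) // coprimen2.
rewrite /root_mod -(Gauss_dvdr _ co_q4) omega_norm_disc // dvdn_addl //.
rewrite Euclid_dvdX //= andbT; apply/idP/eqP => [|->]; last first.
  by have -> : (q.-1./2.*2.+1 = q)%N by move: q_odd q_gt0; clear; lia.
by case/dvdnP => -[|[|z]]; move: q_odd b_lt; clear; nia.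
Qed.

Section RootsInExtension.
Variables (q k : nat) (L : finFieldType) (theta : L).
Hypotheses (q_prime : prime q) (charL : q \in [pchar L]).
Hypotheses (k_gt0 : (0 < k)%N) (q_disc : ~~ (q %| 4 * k - 1)%N).
Hypothesis theta_root : theta ^+ 2 + theta + k%:R = 0.

Lemma pchar_natr_inj i j : (i < q)%N -> (j < q)%N -> i%:R = j%:R :> L -> i = j.
Proof.
wlog le_ij : i j / (i <= j)%N => [IH i_lt j_lt eq_ij|].
  by case: (leqP i j) => [|/ltnW] le_ji; [exact: IH | apply/esym; exact: IH].
move=> i_lt j_lt eq_ij; have : (q %| j - i)%N.
  by rewrite (dvdn_pcharf charL) natrB // eq_ij subrr.
by case: (posnP (j - i)) => [|h /(dvdn_leq h)]; move: le_ij j_lt; clear; lia.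
Qed.

Lemma frobenius_natr b : (b%:R : L) ^+ q = b%:R.
Proof. by rewrite -(pFrobenius_autE charL) pFrobenius_aut_nat. Qed.

Lemma frobenius_fixed_natr (x : L) : x ^+ q = x ->
  exists2 b, (b < q)%N & x = b%:R.
Proof.
move=> x_fixed; case: (boolP [exists b : 'I_q, x == b%:R]) => [|x_not_nat].
  by case/existsP => b /eqP ->; exists b.
pose s := x :: [seq (b%:R : L) | b <- iota 0 q].
have P_size : size ('X^q - 'X : {poly L}) = q.+1.
  by rewrite size_polyDl size_polyXn // size_polyN size_polyX ltnS prime_gt1.
have P_neq0 : ('X^q - 'X : {poly L}) != 0 by rewrite -size_poly_gt0 P_size.
have roots_s : all (root ('X^q - 'X)) s.
  have fixed_root (y : L) : y ^+ q = y -> root ('X^q - 'X) y.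
    by move=> y_fixed; rewrite /root !hornerE y_fixed subrr.
  rewrite /= fixed_root //=; apply/allP => y /mapP[b _ ->].
  exact: fixed_root (frobenius_natr b).
have uniq_s : uniq s.
  rewrite /=; apply/andP; split.
    apply/mapP => -[b]; rewrite mem_iota add0n => /andP[_ b_lt] x_b.
    by move/existsP: x_not_nat => []; exists (Ordinal b_lt); rewrite x_b.
  rewrite map_inj_in_uniq ?iota_uniq // => i j; rewrite !mem_iota !add0n.
  by move=> /andP[_ i_lt] /andP[_ j_lt]; exact: pchar_natr_inj.
have := max_poly_roots P_neq0 roots_s uniq_s.
by rewrite P_size /= size_map size_iota ltnn.
Qed.

Lemma theta_neq_conj : theta != -1 - theta.
Proof.
apply: contra q_disc => /eqP theta_conj.
rewrite (dvdn_pcharf charL) natrB; last by lia.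
have double_theta : 2 * theta = -1.
  by rewrite mulr2n mulrDl mul1r {1}theta_conj subrK.
have -> : (4 * k)%:R - 1%:R =
    4 * (theta ^+ 2 + theta + k%:R) - (2 * theta + 1) ^+ 2.
  by rewrite natrM; ring.
by rewrite theta_root double_theta addNr expr0n mulr0 subr0.
Qed.

Lemma root_modE b :
  root_mod k q b = (b%:R == theta) || (b%:R == -1 - theta).
Proof.
rewrite /root_mod (dvdn_pcharf charL) -[X in X || _]subr_eq0
  -[X in _ || X]subr_eq0.
rewrite -mulf_eq0; congr (_ == 0); rewrite /omega_norm !natrD natrX.
have -> : k%:R = - (theta ^+ 2 + theta).
  by apply/eqP; rewrite -addr_eq0 addrC theta_root.
by ring.
Qed.

Lemma root_count_inert : theta ^+ q = -1 - theta -> root_count k q = 0%N.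
Proof.
move=> theta_frob; apply/eqP; rewrite /root_count size_filter.
rewrite -leqn0 leqNgt -has_count; apply/hasPn => b _.
have b_frob := frobenius_natr b.
rewrite root_modE; apply/negP => /orP[] /eqP b_theta.
  by have := theta_neq_conj; rewrite -theta_frob -b_theta b_frob eqxx.
have thetaE : theta = -1 - b%:R by rewrite b_theta; ring.
have := theta_neq_conj; rewrite -theta_frob {2}thetaE -(pFrobenius_autE charL).
by rewrite rmorphB rmorphN1 /= pFrobenius_aut_nat -thetaE eqxx.
Qed.

Lemma root_count_split : theta ^+ q = theta -> root_count k q = 2.
Proof.
move=> theta_frob; have [b b_lt theta_b] := frobenius_fixed_natr theta_frob.
have [|c c_lt theta_c] := @frobenius_fixed_natr (-1 - theta).
  by rewrite -(pFrobenius_autE charL) rmorphB rmorphN1 /= pFrobenius_autE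
    theta_frob.
have b_neq_c : b != c.
  by apply: contra theta_neq_conj => /eqP bc; rewrite {1}theta_b theta_c bc.
rewrite /root_count size_filter.
transitivity (count (predU (pred1 b) (pred1 c)) (iota 0 q)).
  apply: eq_in_count => i; rewrite mem_iota add0n => /andP[_ i_lt].
  rewrite root_modE theta_c theta_b /=.
  by congr (_ || _); apply/eqP/eqP => [/pchar_natr_inj|->] //; apply.
have := count_predUI (pred1 b) (pred1 c) (iota 0 q).
rewrite (@eq_count _ (predI _ _) pred0) => [|i]; last first.
  by rewrite /=; case: eqP => // ->; exact: negbTE.
by rewrite count_pred0 addn0 !count_uniq_mem ?iota_uniq // !mem_iota b_lt c_lt.
Qed.

Lemma root_count_frobenius (s : int) : (s == 1) || (s == -1) ->
  theta ^+ q = (if s == 1 then theta else -1 - theta) ->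
  (root_count k q)%:Z = 1 + s.
Proof.
case/orP => /eqP -> theta_frob; first by rewrite root_count_split.
by rewrite root_count_inert.
Qed.

End RootsInExtension.

Lemma exists_unity_root p (L : finFieldType) : prime p -> (p %| #|L|.-1)%N ->
  exists2 z : L, z ^+ p = 1 & z != 1.
Proof.
move=> p_prime p_card.
have [|x _ x_order] := @Cauchy _ p [set: {unit L}]%G p_prime.
  by rewrite card_finField_unit.
exists (val x); first by rewrite -FinRing.val_unitX -x_order expg_order.
apply: contraTneq p_prime => x1; have xE : x = 1%g by exact: val_inj.
by rewrite -x_order xE order1.
Qed.

Lemma exists_field_unity_roots q n : prime q -> coprime q n -> (1 < n)%N ->
  exists2 L : finFieldType, q \in [pchar L] &
    forall p, prime p -> (p %| n)%N -> exists2 z : L, z ^+ p = 1 & z != 1.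
Proof.
move=> q_prime co_qn n_gt1.
have tot_gt0 : (0 < totient n)%N by rewrite totient_gt0 ltnW.
have [L charL cardL] := pPrimePowerField q_prime tot_gt0.
exists L => // p p_prime p_n.
apply: exists_unity_root => //; apply: dvdn_trans p_n _.
rewrite cardL -subn1 -eqn_mod_dvd ?expn_gt0 ?prime_gt0 //.
exact/eqP/Euler_exp_totient.
Qed.

Section GaussPeriod.
Variables (p : nat) (L : finFieldType) (z : L).
Hypotheses (p_prime : prime p) (p_mod4 : (p %% 4 = 3)%N).
Hypotheses (zp : z ^+ p = 1) (z_neq1 : z != 1).
Implicit Types u v s t c : 'F_p.

Let p_odd : odd p. Proof. by move: p_mod4; clear; lia. Qed.

Definition unity_power u : L := z ^+ (u : nat).

Lemma unity_power_nat n : unity_power n%:R = z ^+ n.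
Proof. by rewrite /unity_power val_Fp_nat // -[RHS](expr_mod _ zp). Qed.

Lemma unity_powerD u v : unity_power (u + v) = unity_power u * unity_power v.
Proof. by rewrite -[u]natr_Zp -[v]natr_Zp -natrD !unity_power_nat exprD. Qed.

Lemma unity_power0 : unity_power 0 = 1.
Proof. exact: (unity_power_nat 0). Qed.

Lemma sum_unity_power : \sum_u unity_power u = 0.
Proof.
have z_sum : z * (\sum_u unity_power u) = \sum_u unity_power u.
  rewrite mulr_sumr [RHS](reindex_inj (addrI 1)) /=; apply: eq_bigr => u _.
  by rewrite unity_powerD; congr (_ * _); exact: esym (unity_power_nat 1).
apply/eqP; have : (z - 1) * (\sum_u unity_power u) == 0.
  by rewrite mulrBl mul1r z_sum subrr.
by rewrite mulf_eq0 subr_eq0 (negbTE z_neq1).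
Qed.

Lemma qnonresN1 : qnonres (-1 : 'F_p).
Proof.
rewrite /qnonres -signr_odd; suff -> : odd (p.-1)./2 by [].
by move: p_mod4; clear; lia.
Qed.

Lemma qresN u : qres (- u) = qnonres u.
Proof. by rewrite -mulN1r qresMN ?qnonresN1. Qed.

Lemma big_qres_qnonres (V : nmodType) (F : 'F_p -> V) :
  \sum_u F u = F 0 + (\sum_(u | qres u) F u + \sum_(u | qnonres u) F u).
Proof.
rewrite (bigD1 0) //= (bigID (@qres p)) /=; congr (_ + (_ + _)).
  apply: eq_bigl => u.
  by case: (boolP (qres u)) => [/(qres_neq0 p_prime p_odd) ->|]; rewrite ?andbF.
apply: eq_bigl => u; case: (eqVneq u 0) => [->|u_neq0] /=.
  by rewrite qnonres0.
by rewrite qnonresE.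
Qed.

Lemma card_qres : #|[pred u : 'F_p | qres u]| = (p.-1)./2.
Proof.
have card_nonres : #|[pred u : 'F_p | qnonres u]| = #|[pred u : 'F_p | qres u]|.
  rewrite -!sum1_card [RHS](reindex_inj oppr_inj) /=.
  by apply: eq_bigl => u; rewrite !inE qresN.
have := big_qres_qnonres (fun=> 1%N); rewrite !sum1_card card_nonres card_Fp //.
rewrite -[X in _ + (X + _)]/(#|[pred u : 'F_p | qres u]|).
by move: #|_| => n pE; have {pE} : p = (1 + (n + n))%N := pE; clear; lia.
Qed.

Definition gauss_period : L := \sum_(u | qres u) unity_power u.
Definition conj_gauss_period : L := \sum_(u | qnonres u) unity_power u.

Lemma conj_gauss_periodE : conj_gauss_period = -1 - gauss_period.
Proof.
have := sum_unity_power; rewrite big_qres_qnonres unity_power0.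
rewrite -/gauss_period -/conj_gauss_period addrA => /eqP.
by rewrite addr_eq0 -opprD => /eqP ->; rewrite opprK.
Qed.

Definition consecutive_residues : nat :=
  #|[pred s : 'F_p | qres s && qres (s - 1)]|.

Lemma consecutive_residues_nonres :
  #|[pred s : 'F_p | qres s && qnonres (s - 1)]| = consecutive_residues.
Proof.
rewrite /consecutive_residues -!sum1_card [RHS](reindex_inj invr_inj) /=.
apply: eq_bigl => s; rewrite !inE qresV; case: (boolP (qres s)) => //= s_res.
have s_neq0 := qres_neq0 p_prime p_odd s_res.
have -> : s^-1 - 1 = s^-1 * - (s - 1) by rewrite opprB mulrBr mulr1 mulVf.
by rewrite qresM ?qresV // qresN.
Qed.

Lemma big_qres_shift (V : nmodType) (F : 'F_p -> V) :
  \sum_(s | qres s) F s = F 1 + (\sum_(s | qres s && qres (s - 1)) F s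
                               + \sum_(s | qres s && qnonres (s - 1)) F s).
Proof.
rewrite (bigD1 1) ?qres1 //= (bigID (fun s => qres (s - 1))) /=.
congr (_ + (_ + _)); apply: eq_bigl => s.
  by case: eqVneq => [->|_]; rewrite ?subrr ?qres0 ?andbF ?andbT.
case: eqVneq => [->|s_neq1]; first by rewrite subrr qnonres0 // !andbF.
by rewrite andbT qnonresE // subr_eq0.
Qed.

Lemma half_pred_consecutive : (p.-1)./2 = consecutive_residues.*2.+1.
Proof.
have := big_qres_shift (fun=> 1%N); rewrite !sum1_card card_qres.
by rewrite consecutive_residues_nonres -addnn => ->.
Qed.

Lemma gauss_period_dilate t : qres t ->
  \sum_(c | qres c) unity_power (c * t) = gauss_period.
Proof.
move=> t_res; have t_neq0 := qres_neq0 p_prime p_odd t_res.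
rewrite /gauss_period [RHS](reindex_inj (mulIf t_neq0)) /=.
by apply: eq_bigl => u; rewrite mulrC qresM.
Qed.

Lemma gauss_period_dilate_nonres t : qnonres t ->
  \sum_(c | qres c) unity_power (c * t) = conj_gauss_period.
Proof.
move=> t_nonres; have t_neq0 := qnonres_neq0 p_prime p_odd t_nonres.
rewrite /conj_gauss_period [RHS](reindex_inj (mulIf t_neq0)) /=.
by apply: eq_bigl => u; rewrite mulrC qnonresMN.
Qed.

Lemma gauss_period_mul_conj :
  gauss_period * conj_gauss_period = consecutive_residues.+1%:R.
Proof.
have -> : gauss_period * conj_gauss_period =
    \sum_(s | qres s) \sum_(c | qres c) unity_power (c * (s - 1)).
  rewrite -(gauss_period_dilate_nonres qnonresN1) mulr_sumr exchange_big /=.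
  apply: eq_bigr => c c_res.
  rewrite mulr_suml (reindex_inj (mulfI (qres_neq0 p_prime p_odd c_res))) /=.
  apply: eq_big => s; first by rewrite qresM.
  by rewrite mulrN1 mulrBr mulr1 unity_powerD.
rewrite big_qres_shift subrr.
under eq_bigr do rewrite mulr0 unity_power0.
under [X in _ + (X + _)]eq_bigr => s /andP[_ s1_res] do
  rewrite gauss_period_dilate //.
under [X in _ + (_ + X)]eq_bigr => s /andP[_ s1_nonres] do
  rewrite gauss_period_dilate_nonres //.
rewrite !sumr_const card_qres consecutive_residues_nonres.
rewrite -[X in gauss_period *+ X]/consecutive_residues half_pred_consecutive.
rewrite conj_gauss_periodE -addnn.
move: consecutive_residues gauss_period => n g.
rewrite -mulrnDl (_ : g + (-1 - g) = -1) ?mulNrn; last by ring.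
by rewrite -[RHS]natr1 -[X in X + _]natr1 natrD; ring.
Qed.

Lemma gauss_period_root :
  gauss_period ^+ 2 + gauss_period + ((p + 1) %/ 4)%:R = 0.
Proof.
have -> : ((p + 1) %/ 4 = consecutive_residues.+1)%N.
  by have := half_pred_consecutive; move: p_mod4; clear; lia.
by rewrite -gauss_period_mul_conj conj_gauss_periodE; ring.
Qed.

Lemma gauss_period_frobenius q : prime q -> q \in [pchar L] -> q != p ->
  gauss_period ^+ q =
  if legendre p q == 1 then gauss_period else -1 - gauss_period.
Proof.
move=> q_prime charL q_neq_p; have q_neq0 : (q%:R : 'F_p) != 0.
  by rewrite Fp_nat_eq0 // dvdn_prime2 // eq_sym.
have -> : gauss_period ^+ q = \sum_(c | qres c) unity_power (c * q%:R).
  rewrite -(pFrobenius_autE charL) rmorph_sum /=; apply: eq_bigr => u _.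
  by rewrite pFrobenius_autE -[u]natr_Zp -natrM !unity_power_nat -exprM.
rewrite /legendre (negbTE q_neq0).
case: (boolP (qres q%:R)) => q_res /=; first exact: gauss_period_dilate.
by rewrite -conj_gauss_periodE gauss_period_dilate_nonres // qnonresE.
Qed.

End GaussPeriod.

Lemma root_count_legendre p q : prime p -> (p %% 4 = 3)%N -> prime q ->
  (root_count ((p + 1) %/ 4) q)%:Z = 1 + legendre p q.
Proof.
move=> p_prime p_mod4 q_prime; set k := ((p + 1) %/ 4)%N.
have k_gt0 : (0 < k)%N by rewrite /k; move: p_mod4; clear; lia.
have disc : (4 * k - 1 = p)%N by rewrite /k; move: p_mod4; clear; lia.
have [->|q_neq_p] := eqVneq q p.
  rewrite root_count_ramified_prime ?disc //.
  by have /eqP -> : legendre p p == 0 by rewrite legendre_eq0.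
have co_qp : coprime q p by rewrite prime_coprime // dvdn_prime2.
have [L charL roots] :=
  exists_field_unity_roots q_prime co_qp (prime_gt1 p_prime).
have [z zp z_neq1] := roots p p_prime (dvdnn p).
apply: (@root_count_frobenius _ _ L (gauss_period p z)) => //.
- by rewrite disc dvdn_prime2.
- exact: gauss_period_root.
- by have := legendre_sign p q; rewrite (negbTE (legendre_prime_neq0 _ _ _)).
exact: gauss_period_frobenius.
Qed.

Lemma legendre5E n : legendre 5 n = nth 0 [:: 0; 1; -1; -1; 1] (n %% 5).
Proof.
rewrite -legendre_modn //; have := ltn_pmod n (isT : (0 < 5)%N).
by case: (n %% 5)%N => [|[|[|[|[|i]]]]].
Qed.

Section GoldenPeriod.
Variables (L : finFieldType) (w : L).
Hypotheses (w5 : w ^+ 5 = 1) (w_neq1 : w != 1).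

Definition golden_period : L := w + w ^+ 4.

Lemma golden_period_sum : 1 + w + w ^+ 2 + w ^+ 3 + w ^+ 4 = 0.
Proof.
apply/eqP; have : (w - 1) * (1 + w + w ^+ 2 + w ^+ 3 + w ^+ 4) == 0.
  rewrite (_ : _ * _ = w ^+ 5 - 1); last by ring.
  by rewrite w5 subrr.
by rewrite mulf_eq0 subr_eq0 (negbTE w_neq1).
Qed.

Lemma golden_period_root : golden_period ^+ 2 + golden_period = 1.
Proof.
transitivity (w ^+ 2 + 2 * w ^+ 5 + w ^+ 5 * w ^+ 3 + w + w ^+ 4).
  by rewrite /golden_period; ring.
by rewrite w5 -[RHS]addr0 -[in RHS]golden_period_sum; ring.
Qed.

Lemma conj_golden_period : w ^+ 2 + w ^+ 3 = -1 - golden_period.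
Proof.
apply/eqP; rewrite -subr_eq0; apply/eqP.
by rewrite -[RHS]golden_period_sum /golden_period; ring.
Qed.

Lemma golden_period_frobenius q : prime q -> q \in [pchar L] -> q != 5 ->
  golden_period ^+ q =
  if legendre 5 q == 1 then golden_period else -1 - golden_period.
Proof.
move=> q_prime charL q_neq5.
have -> : golden_period ^+ q = w ^+ q + w ^+ (4 * q).
  by rewrite -(pFrobenius_autE charL) rmorphD /= !pFrobenius_autE -exprM.
rewrite -(expr_mod _ w5) -[w ^+ (4 * q)](expr_mod _ w5) legendre5E -modnMmr.
have : (q %% 5 != 0)%N by rewrite -/(5 %| q)%N dvdn_prime2 // eq_sym.
have := ltn_pmod q (isT : (0 < 5)%N).
case: (q %% 5)%N => [|[|[|[|[|i]]]]] //= _ _.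
- by rewrite conj_golden_period.
- by rewrite addrC conj_golden_period.
- by rewrite expr1 addrC.
Qed.

End GoldenPeriod.

(* If [g] and [h] are half sums of [-1] and a square root of [D], resp. of [5],
   this is the half sum of [-1] and a square root of [5 D]. *)
Definition period_product (L : pzRingType) (g h : L) : L := 2 * g * h + g + h.

Lemma period_product_root (L : comPzRingType) (g h m : L) :
  g ^+ 2 + g + m = 0 -> h ^+ 2 + h = 1 ->
  period_product g h ^+ 2 + period_product g h + (5 * m - 1) = 0.
Proof.
move=> g_root h_root; transitivity ((4 * (h ^+ 2 + h) + 1) * (g ^+ 2 + g + m)
    + (h ^+ 2 + h - 1) * (1 - 4 * m)); first by rewrite /period_product; ring.
by rewrite g_root h_root subrr mulr0 mul0r addr0.
Qed.

Lemma period_product_frobenius (L : finFieldType) (q : nat) (g h : L)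
    (s t : int) :
  q \in [pchar L] -> (s == 1) || (s == -1) -> (t == 1) || (t == -1) ->
  g ^+ q = (if s == 1 then g else -1 - g) ->
  h ^+ q = (if t == 1 then h else -1 - h) ->
  period_product g h ^+ q =
  if t * s == 1 then period_product g h else -1 - period_product g h.
Proof.
move=> charL s_sign t_sign g_frob h_frob.
have -> : period_product g h ^+ q = period_product (g ^+ q) (h ^+ q).
  rewrite /period_product -!(pFrobenius_autE charL) !rmorphD !rmorphM.
  by rewrite rmorph_nat.
rewrite {}g_frob {}h_frob /period_product.
by case/orP: s_sign => /eqP ->; case/orP: t_sign => /eqP -> /=; ring.
Qed.

Definition chi5p (p n : nat) : int := legendre 5 n * legendre p n.

Lemma root_count_chi5p p q : prime p -> (p %% 4 = 3)%N -> prime q ->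
  (root_count ((5 * p + 1) %/ 4) q)%:Z = 1 + chi5p p q.
Proof.
move=> p_prime p_mod4 q_prime; set k := ((5 * p + 1) %/ 4)%N.
have k_gt0 : (0 < k)%N by rewrite /k; move: p_mod4; clear; lia.
have disc : (4 * k - 1 = 5 * p)%N by rewrite /k; move: p_mod4; clear; lia.
case: (boolP (q %| 5 * p)%N) => [q_disc|q_disc].
  rewrite root_count_ramified_prime ?disc //; have /eqP -> : chi5p p q == 0.
    rewrite mulf_eq0 !legendre_eq0 // !dvdn_prime2 // ![_ == q]eq_sym.
    by move: q_disc; rewrite Euclid_dvdM // !dvdn_prime2.
  by [].
have [q_neq5 q_neq_p] : q != 5%N /\ q != p.
  by apply/andP; move: q_disc; rewrite Euclid_dvdM // !dvdn_prime2 // negb_or.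
have co_q : coprime q (5 * p) by rewrite prime_coprime.
have [|L charL roots] := exists_field_unity_roots q_prime co_q.
  by have := prime_gt1 p_prime; lia.
have [z zp z_neq1] := roots p p_prime (dvdn_mull 5%N (dvdnn p)).
have [w w5 w_neq1] := roots 5%N isT (dvdn_mulr p (dvdnn 5)).
have [p_sign five_sign] : ((legendre p q == 1) || (legendre p q == -1))
    /\ ((legendre 5 q == 1) || (legendre 5 q == -1)).
  have := legendre_sign p q; have := legendre_sign 5 q.
  by rewrite !(negbTE (legendre_prime_neq0 _ _ _)).
apply: (@root_count_frobenius _ _ L (period_product (gauss_period p z)
                                                    (golden_period w))) => //.
- by rewrite disc.
- have -> : k%:R = 5 * ((p + 1) %/ 4)%:R - 1 :> L.
    have -> : k = (5 * ((p + 1) %/ 4) - 1)%N.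
      by rewrite /k; move: p_mod4; clear; lia.
    by rewrite natrB ?natrM //; move: p_mod4; clear; lia.
  by apply: period_product_root;
    [exact: gauss_period_root | exact: golden_period_root].
- by rewrite /chi5p; case/orP: p_sign => /eqP ->;
    case/orP: five_sign => /eqP ->.
apply: period_product_frobenius => //; first exact: gauss_period_frobenius.
exact: golden_period_frobenius.
Qed.
(** * The ring of integers of an imaginary quadratic field *)

Lemma int_subgroup_gen (P : int -> Prop) : (exists2 x, P x & x != 0) ->
  (forall x y u v, P x -> P y -> P (u * x + v * y)) ->
  exists2 g : nat, (0 < g)%N & forall x, P x <-> exists t, x = t * g%:Z.
Proof.
move=> [x0 Px0 x0_neq0] P_comb.
have ex_pos : exists n, `[< (0 < n)%N /\ P n%:Z >].
  exists `|x0|%N; apply/asboolP; split; first by lia.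
  have := P_comb x0 x0 (Num.sg x0) 0 Px0 Px0; rewrite mul0r addr0.
  by rewrite abszE normrEsg.
case: (ex_minnP ex_pos) => g /asboolP[g_gt0 Pg] g_min; exists g => // x.
split=> [Px|[t ->]]; last first.
  by have := P_comb g%:Z g%:Z t 0 Pg Pg; rewrite mul0r addr0.
exists (x %/ g)%Z; rewrite {1}(divz_eq x g).
case: (eqVneq (x %% g)%Z 0) => [->|mod_neq0]; first by rewrite addr0.
have mod_ge0 : 0 <= (x %% g)%Z by rewrite modz_ge0 //; lia.
have Pmod : P (x %% g)%Z.
  have := P_comb x g%:Z 1 (- (x %/ g)%Z) Px Pg; rewrite mul1r mulNr.
  by rewrite {1}(divz_eq x g) addrAC subrr add0r.
have := g_min `|(x %% g)%Z|%N; rewrite leqNgt => /(_ _)/negP; case; last by lia.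
by apply/asboolP; split; [lia | rewrite gez0_abs].
Qed.

Lemma undup_map_preimage (T U : eqType) (f : T -> U) (s : seq T) :
  exists r : seq T, [/\ {subset r <= s}, map f r = undup (map f s) &
    {in r &, injective f}].
Proof.
elim: s => [|x s [r [sub_r mapE inj_f]]]; first by exists [::].
rewrite /=; case: ifP => fx_in.
  by exists r; split=> // y /sub_r y_in; rewrite inE y_in orbT.
have f_neq y : y \in r -> f y != f x.
  move=> y_in; apply: contraFneq fx_in => <-; rewrite -mem_undup -mapE.
  exact: map_f.
exists (x :: r); split.
- by move=> y; rewrite !inE => /orP[->//|/sub_r ->]; rewrite orbT.
- by rewrite /= mapE.
move=> y z; rewrite !inE => /orP[/eqP ->|y_in] /orP[/eqP ->|z_in] // eq_f.
- by have := f_neq _ z_in; rewrite eq_f eqxx.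
- by have := f_neq _ y_in; rewrite eq_f eqxx.
- exact: inj_f.
Qed.

Definition scale_set (g : algC) (I : set algC) : set algC :=
  [set g * x | x in I].

Definition conj_set (I : set algC) : set algC := [set x^* | x in I].

Lemma conj_setK : involutive conj_set.
Proof.
move=> I; apply/seteqP.
split=> [_ [_ [x Ix <-] <-]|z Iz]; first by rewrite conjCK.
by exists z^*; rewrite ?conjCK //; exists z.
Qed.

Lemma scale_setA g h I : scale_set g (scale_set h I) = scale_set (g * h) I.
Proof.
apply/seteqP; split=> [_ [_ [x Ix <-] <-]|_ [x Ix <-]].
  by exists x; rewrite ?mulrA.
by exists (h * x); rewrite ?mulrA //; exists x.
Qed.

Lemma scale_set1 I : scale_set 1 I = I.
Proof.
apply/seteqP; split=> [_ [x Ix <-]|z Iz]; first by rewrite mul1r.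
by exists z; rewrite ?mul1r.
Qed.

Lemma conj_scale_set g I :
  conj_set (scale_set g I) = scale_set g^* (conj_set I).
Proof.
apply/seteqP; split=> [_ [_ [x Ix <-] <-]|_ [_ [x Ix <-] <-]].
  by exists x^*; rewrite ?rmorphM //; exists x.
by exists (g * x); rewrite ?rmorphM //; exists x.
Qed.

Definition additive_subgroup (P : set algC) : Prop :=
  forall z w, P z -> P w -> P (z - w).

Lemma subgroupD P z w : additive_subgroup P -> P z -> P w -> P (z + w).
Proof.
move=> PB Pz Pw; rewrite -[w]opprK; apply: (PB) => //.
by rewrite -sub0r; apply: (PB) => //; rewrite -(subrr w); exact: PB.
Qed.

Lemma subgroupN P z : additive_subgroup P -> P z -> P (- z).
Proof.
by move=> PB Pz; rewrite -sub0r; apply: (PB) => //; rewrite -(subrr z);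
  exact: PB.
Qed.

Lemma subgroupMz P z (u : int) : additive_subgroup P -> P z -> P (u%:~R * z).
Proof.
move=> PB Pz; have PM (n : nat) : P (n%:R * z).
  elim: n => [|n Pn]; first by rewrite mul0r -(subrr z); exact: PB.
  by rewrite -natr1 mulrDl mul1r; exact: subgroupD.
case: u => n; first by rewrite -pmulrn.
by rewrite NegzE mulrNz mulNr; apply: subgroupN => //; rewrite -pmulrn.
Qed.

Section QuadraticOrder.
Local Open Scope classical_set_scope.
Local Open Scope ring_scope.
Variable k : nat.

Local Notation disc := (4 * k - 1)%N.

Definition sqrt_disc : algC := sqrtC ((- disc%:Z)%:~R).
Definition omega : algC := (1 + sqrt_disc) / 2.
Definition qint (x y : int) : algC := x%:~R + y%:~R * omega.
Definition quad_order : set algC :=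
  ring_of_integers (quadratic_field (- disc%:Z)).

Local Notation OK := quad_order.

Hypothesis k_gt1 : (1 < k)%N.

Let k_gt0 : (0 < k)%N. Proof. exact: ltnW. Qed.

Lemma natr_disc (F : pzRingType) : disc%:R = 4 * k%:R - 1 :> F.
Proof. by rewrite natrB ?natrM // muln_gt0. Qed.

Lemma sqr_sqrt_disc : sqrt_disc ^+ 2 = 1 - 4 * k%:R.
Proof. by rewrite /sqrt_disc sqrtCK rmorphN /= -pmulrn natr_disc opprB. Qed.

Lemma omega_sqr : omega ^+ 2 = omega - k%:R.
Proof.
have -> : omega ^+ 2 = (1 + 2 * sqrt_disc + sqrt_disc ^+ 2) / 4.
  by rewrite /omega; field.
by rewrite sqr_sqrt_disc /omega; field.
Qed.

Lemma conj_sqrt_disc : sqrt_disc^* = - sqrt_disc.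
Proof.
have : sqrt_disc^* ^+ 2 == sqrt_disc ^+ 2.
  by rewrite -rmorphXn /= sqr_sqrt_disc rmorphB rmorphM rmorph1 !rmorph_nat.
rewrite eqf_sqr => /orP[] /eqP // sqrt_conj.
have sqrt_real : sqrt_disc \is Num.real by apply/CrealP.
have : 0 <= sqrt_disc ^+ 2 by rewrite -realEsqr.
by rewrite sqr_sqrt_disc subr_ge0 -natrM -[1]/(1%:R) ler_nat; lia.
Qed.

Lemma conj_omega : omega^* = 1 - omega.
Proof.
rewrite /omega rmorphM rmorphD rmorph1 fmorphV rmorph_nat /= conj_sqrt_disc.
by field.
Qed.

Lemma qint_int x : qint x 0 = x%:~R.
Proof. by rewrite /qint mul0r addr0. Qed.

Lemma qint_omega : qint 0 1 = omega.
Proof. by rewrite /qint add0r mul1r. Qed.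

Lemma qintD x y u v : qint x y + qint u v = qint (x + u) (y + v).
Proof. by rewrite /qint !intrD; ring. Qed.

Lemma qintN x y : - qint x y = qint (- x) (- y).
Proof. by rewrite /qint !mulrNz; ring. Qed.

Lemma qintZ u x y : u%:~R * qint x y = qint (u * x) (u * y).
Proof. by rewrite /qint !intrM; ring. Qed.

Lemma qintM x y u v :
  qint x y * qint u v = qint (x * u - k%:Z * y * v) (x * v + y * u + y * v).
Proof.
rewrite /qint
  [LHS](_ : _ = x%:~R * u%:~R + (x%:~R * v%:~R + y%:~R * u%:~R) * omega
  + y%:~R * v%:~R * omega ^+ 2); last by ring.
by rewrite omega_sqr !(intrD, mulrNz, intrM) -pmulrn; ring.
Qed.

Lemma conj_qint x y : (qint x y)^* = qint (x + y) (- y).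
Proof.
rewrite /qint rmorphD rmorphM /= !rmorph_int conj_omega intrD mulrNz.
by ring.
Qed.

Lemma qint_norm x y :
  qint x y * (qint x y)^* = (x ^+ 2 + x * y + k%:Z * y ^+ 2)%:~R.
Proof. by rewrite conj_qint qintM -qint_int; congr qint; ring. Qed.

Lemma omega_nonreal : omega \isn't Num.real.
Proof.
apply/negP => /CrealP; rewrite conj_omega => omega_conj.
have double_omega : 2 * omega = 1.
  by rewrite mulr2n mulrDl mul1r -{1}omega_conj; ring.
have : (2 * omega) ^+ 2 = 2 * (2 * omega) - 4 * k%:R.
  by rewrite exprMn omega_sqr; ring.
rewrite double_omega => /eqP; rewrite -subr_eq0.
rewrite (_ : _ - _ = disc%:R); last by rewrite natr_disc; ring.
by rewrite pnatr_eq0; move: k_gt1; lia.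
Qed.

Lemma qint_inj x y u v : qint x y = qint u v -> x = u /\ y = v.
Proof.
move=> eq_qint; have omega_mul : (y - v)%:~R * omega = (u - x)%:~R.
  rewrite !rmorphB /= [LHS](_ : _ = qint x y - x%:~R - v%:~R * omega).
    by rewrite eq_qint /qint; ring.
  by rewrite /qint; ring.
have yv : y = v.
  apply/eqP; rewrite -subr_eq0; apply/negPn/negP => yv_neq0.
  case/negP: omega_nonreal.
  have -> : omega = (u - x)%:~R / (y - v)%:~R.
    by rewrite -omega_mul mulrC mulKf // intr_eq0.
  by rewrite rpred_div // Rreal_int // intr_int.
split=> //; move: omega_mul; rewrite yv subrr mul0r => /esym/eqP.
by rewrite intr_eq0 subr_eq0 => /eqP.
Qed.

Lemma Aint_omega : omega \in Aint.
Proof.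
pose P : {poly algC} := 'X^2 - 'X + (k%:R)%:P.
have size_tail : leq (size (- 'X + (k%:R)%:P : {poly algC})).+1
    (size ('X^2 : {poly algC})).
  rewrite size_polyXn ltnS; apply: leq_trans (size_polyD _ _) _.
  by rewrite geq_max size_polyN size_polyX (leq_trans (size_polyC_leq1 _)).
apply: (@root_monic_Aint P).
- by rewrite /root /P !hornerE omega_sqr; apply/eqP; ring.
- by rewrite monicE /P -addrA lead_coefDl // lead_coefXn.
- apply/polyOverP => i; rewrite /P !coefE; apply: rpredD; last first.
    by case: ifP; rewrite ?rpred_nat ?rpred0.
  by apply: rpredB; exact: rpred_nat.
Qed.

Hypothesis disc_sqfree : square_free disc.

Lemma square_free_disc_dvd n : (n ^ 2 %| disc)%N -> n = 1%N.
Proof.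
move=> n2_disc; case: (leqP n 1) => [|n_gt1].
  by case: n n2_disc => [|[]] //; move: k_gt1; case: k => // -[|j] _ //;
    rewrite dvd0n mulnS.
have := disc_sqfree (pdiv_prime n_gt1); rewrite (dvdn_trans _ n2_disc) //.
by rewrite dvdn_exp2r // pdiv_dvd.
Qed.

Lemma rat_square_free_int (r : rat) (n : int) :
  disc%:R * r ^+ 2 = n%:~R -> exists y : int, r = y%:~R.
Proof.
move=> rE; have num_den : disc%:Z * numq r ^+ 2 = n * denq r ^+ 2.
  apply/eqP; rewrite -(eqr_int rat) !intrM -rE -pmulrn.
  by rewrite !numqE; apply/eqP; ring.
have : (`|denq r| ^ 2 %| disc * `|numq r| ^ 2)%N.
  apply/dvdnP; exists `|n|%N.
  by rewrite -!mulnn; have := congr1 absz num_den; rewrite !abszM.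
rewrite Gauss_dvdl;
  last by rewrite coprimeXl // coprimeXr // coprime_sym coprime_num_den.
move/square_free_disc_dvd => den1; exists (numq r).
rewrite -[LHS]divq_num_den; have -> : denq r = 1 by have := denq_gt0 r; lia.
by rewrite divr1.
Qed.

(* [m] and [n] are the trace and the norm of [a + b sqrt (- disc)]. *)
Lemma trace_norm_int (a b : rat) (m n : int) :
  2 * a = m%:~R -> a ^+ 2 + disc%:R * b ^+ 2 = n%:~R ->
  exists x y : int, a = x%:~R + y%:~R / 2 /\ b = y%:~R / 2.
Proof.
move=> trace norm; have norm4 : disc%:R * (2 * b) ^+ 2 = (4 * n - m ^+ 2)%:~R.
  by rewrite rmorphB rmorphM rmorphXn /= -norm -trace; ring.
have [y double_b] := rat_square_free_int norm4.
have disc_y : disc%:Z * y ^+ 2 = 4 * n - m ^+ 2.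
  apply/eqP; rewrite -(eqr_int rat) -norm4 double_b rmorphM rmorphXn /= -pmulrn.
  exact/eqP.
have [x mE] : exists x, m = 2 * x + y.
  exists ((m - y) %/ 2)%Z.
  have [t [tE|tE]] : exists t, m - y = 2 * t \/ m - y = 2 * t + 1.
    by exists ((m - y) %/ 2)%Z; move: (m - y); clear; lia.
    by rewrite tE mulKz //; move: tE; lia.
  have mE : m = y + 2 * t + 1 by move: tE; clear; lia.
  have : 2 * (2 * n - 2 * k%:Z * y ^+ 2 - 2 * t ^+ 2 - 2 * t
    - 2 * y * t - y) = 1.
    have discZ : disc%:Z = 4 * k%:Z - 1 by move: k_gt1; lia.
    by rewrite discZ mE in disc_y; move: disc_y; clear; lia.
  by move: (_ - y); clear; lia.
exists x, y; split; last by rewrite -double_b; field.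
have -> : a = (2 * a) / 2 by field.
by rewrite trace mE rmorphD rmorphM /=; field.
Qed.

Lemma quad_orderP z : OK z <-> exists x y, z = qint x y.
Proof.
split=> [[[a [b zE]] z_Aint]|[x [y ->]]]; last first.
  split; last first.
    apply: rpredD; first exact: Aint_int.
    by apply: rpredM; [exact: Aint_int | exact: Aint_omega].
  exists (x%:~R + y%:~R / 2), (y%:~R / 2).
  rewrite rmorphD fmorph_div /= !ratr_int rmorph_nat /qint /omega -/sqrt_disc.
  by field.
rewrite -/sqrt_disc in zE.
have conj_z : z^* = ratr a - ratr b * sqrt_disc.
  rewrite zE rmorphD /= [(ratr b * _)^*]rmorphM /= conj_sqrt_disc.
  by rewrite !conj_Crat ?Crat_rat // mulrN.
have conj_Aint : z^* \in Aint by rewrite Aint_aut.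
have traceE : z + z^* = ratr (2 * a).
  by rewrite conj_z zE rmorphM /= rmorph_nat; ring.
have normE : z * z^* = ratr (a ^+ 2 + disc%:R * b ^+ 2).
  rewrite conj_z zE rmorphD rmorphM !rmorphXn /= rmorph_nat natr_disc.
  rewrite [LHS](_ : _ = ratr a ^+ 2 - ratr b ^+ 2 * sqrt_disc ^+ 2);
    last by ring.
  by rewrite sqr_sqrt_disc; ring.
have /intrP[m] : z + z^* \is a Num.int.
  by apply: Cint_rat_Aint; [rewrite traceE Crat_rat | exact: rpredD].
rewrite traceE -(ratr_int _ m) => /fmorph_inj trace.
have /intrP[n] : z * z^* \is a Num.int.
  by apply: Cint_rat_Aint; [rewrite normE Crat_rat | exact: rpredM].
rewrite normE -(ratr_int _ n) => /fmorph_inj norm.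
have [x [y [aE bE]]] := trace_norm_int trace norm; exists x, y.
by rewrite zE aE bE rmorphD fmorph_div /= !ratr_int rmorph_nat /qint /omega;
  field.
Qed.

Lemma quad_order_qint x y : OK (qint x y).
Proof. by apply/quad_orderP; exists x, y. Qed.

Lemma quad_order_int x : OK x%:~R.
Proof. by rewrite -qint_int; exact: quad_order_qint. Qed.

Lemma quad_order_nat n : OK n%:R.
Proof. by rewrite pmulrn; exact: quad_order_int. Qed.

Lemma quad_order_omega : OK omega.
Proof. by rewrite -qint_omega; exact: quad_order_qint. Qed.

Lemma quad_orderD z w : OK z -> OK w -> OK (z + w).
Proof.
move=> /quad_orderP[x [y ->]] /quad_orderP[u [v ->]].
by rewrite qintD; exact: quad_order_qint.
Qed.

Lemma quad_orderN z : OK z -> OK (- z).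
Proof.
by move=> /quad_orderP[x [y ->]]; rewrite qintN; exact: quad_order_qint.
Qed.

Lemma quad_orderM z w : OK z -> OK w -> OK (z * w).
Proof.
move=> /quad_orderP[x [y ->]] /quad_orderP[u [v ->]].
by rewrite qintM; exact: quad_order_qint.
Qed.

Lemma quad_order_conj z : OK z -> OK z^*.
Proof.
by move=> /quad_orderP[x [y ->]]; rewrite conj_qint; exact: quad_order_qint.
Qed.

Lemma quad_order_natr_dvd n m r : OK r -> m%:R = n%:R * r -> (n %| m)%N.
Proof.
move=> /quad_orderP[x [y ->]]; rewrite !pmulrn qintZ -qint_int.
move=> /qint_inj[mE _]; apply/dvdnP; exists `|x|%N.
by have := congr1 absz mE; rewrite abszM !absz_nat mulnC.
Qed.

(* This is where [k > 1] is needed: [Q(sqrt (-3))] has six units. *)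
Lemma quad_order_unit z w : OK z -> OK w -> z * w = 1 -> z = 1 \/ z = -1.
Proof.
move=> /quad_orderP[x [y ->]] /quad_orderP[u [v ->]] unit_zw.
pose N (x y : int) := x ^+ 2 + x * y + k%:Z * y ^+ 2.
have N4E x' y' :
    4 * N x' y' = (2 * x' + y') ^+ 2 + (4 * k%:Z - 1) * y' ^+ 2.
  by rewrite /N; ring.
have N_ge0 x' y' : 0 <= N x' y'.
  have : 0 <= 4 * N x' y'.
    rewrite N4E addr_ge0 ?sqr_ge0 // mulr_ge0 ?sqr_ge0 //.
    by move: k_gt1; lia.
  by rewrite pmulr_rge0.
have N_unit : N x y * N u v = 1.
  apply/eqP; rewrite -(eqr_int algC) intrM -!qint_norm mulrACA unit_zw.
  by rewrite -rmorphM unit_zw rmorph1 mulr1.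
have N1 : N x y = 1.
  have : (N x y %| 1)%Z by apply/dvdzP; exists (N u v); rewrite mulrC.
  by rewrite dvdz1; have := N_ge0 x y; lia.
have N4 : 4 = (2 * x + y) ^+ 2 + (4 * k%:Z - 1) * y ^+ 2.
  by rewrite -N4E N1 mulr1.
have y0 : y = 0.
  apply/eqP/negPn/negP => y_neq0.
  have y2_ge1 : 1 <= y ^+ 2 by rewrite -gtz0_ge1 exprn_even_gt0.
  have : 7 * 1 <= (4 * k%:Z - 1) * y ^+ 2.
    by apply: ler_pM => //; move: k_gt1; clear; lia.
  have := sqr_ge0 (2 * x + y); move: N4; clear.
  by move: ((2 * x + y) ^+ 2) (_ * y ^+ 2) => A B; lia.
have : x ^+ 2 == 1 by rewrite -N1 /N y0; apply/eqP; ring.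
rewrite y0 !qint_int sqrf_eq1 => /orP[] /eqP ->; [by left | by right].
Qed.

Definition lattice_point (ab : nat * nat) (x y : int) : algC :=
  x%:~R * ab.1%:R + y%:~R * (ab.2%:R + omega).

Definition lattice (ab : nat * nat) : set algC :=
  [set z | exists x y, z = lattice_point ab x y].

Definition hnf_pair (ab : nat * nat) : bool :=
  (ab.2 < ab.1)%N && root_mod k ab.1 ab.2.

Definition conj_pair (ab : nat * nat) : nat * nat := (ab.1, ab.1 - 1 - ab.2)%N.

Definition norm_form (ab : nat * nat) : bqform :=
  BQForm ab.1 ab.2.*2.+1 (omega_norm k ab.2 %/ ab.1).

Lemma hnf_pair_gt0 ab : hnf_pair ab -> (0 < ab.1)%N.
Proof. by move=> /andP[]; case: ab.1. Qed.

Lemma hnf_pair_neq0 ab : hnf_pair ab -> ab.1%:R != 0 :> algC.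
Proof. by move=> /hnf_pair_gt0; rewrite pnatr_eq0 -lt0n. Qed.

Lemma conj_pairK ab : hnf_pair ab -> conj_pair (conj_pair ab) = ab.
Proof.
by case: ab => a b /andP[/= lt_ba _]; rewrite /conj_pair /=; congr pair; lia.
Qed.

Lemma hnf_conj_pair ab : hnf_pair ab -> hnf_pair (conj_pair ab).
Proof.
case: ab => a b /andP[/= lt_ba root_b]; apply/andP; split=> /=; first by lia.
have reflect_norm : (omega_norm k (a - 1 - b) + a * (2 * b + 1) =
    omega_norm k b + a * a)%N.
  have [t ->] : exists t, a = (b + t).+1 by exists (a - b.+1)%N; lia.
  by rewrite (_ : (b + t).+1 - 1 - b = t)%N /omega_norm; lia.
rewrite /root_mod -(dvdn_addl _ (dvdn_mulr (2 * b + 1) (dvdnn a))).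
by rewrite reflect_norm dvdn_addl // dvdn_mulr.
Qed.

Lemma lattice_pointE ab x y :
  lattice_point ab x y = qint (x * ab.1%:Z + y * ab.2%:Z) y.
Proof. by rewrite /lattice_point /qint !(intrM, intrD) -!pmulrn; ring. Qed.

Lemma lattice_point_inj ab x y u v : (0 < ab.1)%N ->
  lattice_point ab x y = lattice_point ab u v -> x = u /\ y = v.
Proof.
move=> a_gt0; rewrite !lattice_pointE => /qint_inj[eq_re eq_y].
by split=> //; move: eq_re; rewrite eq_y => /addIr; apply: mulIf; lia.
Qed.

Lemma lattice_pointN ab x y :
  lattice_point ab (- x) (- y) = - lattice_point ab x y.
Proof. by rewrite /lattice_point !mulrNz; ring. Qed.

Lemma lattice_point_conj ab x y : (ab.2 < ab.1)%N ->
  (lattice_point ab x y)^* = lattice_point (conj_pair ab) (x + y) (- y).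
Proof.
case: ab => a b /= lt_ba; rewrite !lattice_pointE conj_qint /=.
by rewrite -!subzn; try lia; congr qint; ring.
Qed.

Lemma pos_def_norm_form ab : hnf_pair ab -> pos_def (norm_form ab).
Proof.
case: ab => a b /andP[_ root_b]; have := divnK root_b; rewrite /pos_def /=.
by rewrite /omega_norm; move: (_ %/ a)%N k_gt1; clear; nia.
Qed.

Lemma lattice_point_norm ab x y : hnf_pair ab ->
  lattice_point ab x y * (lattice_point ab x y)^* =
  ab.1%:R * (norm_form ab x y)%:~R.
Proof.
case: ab => a b /andP[_ root_b]; rewrite lattice_pointE qint_norm pmulrn -intrM.
congr (_%:~R); have := divnK root_b; rewrite /form_val /omega_norm /=.
move: (_ %/ a)%N => e normE.
have -> : k%:Z = e%:Z * a%:Z - b%:Z ^+ 2 - b%:Z by move: normE; clear; lia.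
by rewrite (_ : b.*2.+1%:Z = 2 * b%:Z + 1); [ring | clear; lia].
Qed.

Lemma lattice_point_lattice ab x y : lattice ab (lattice_point ab x y).
Proof. by exists x, y. Qed.

Lemma lattice_nat ab : lattice ab ab.1%:R.
Proof. by exists 1, 0; rewrite /lattice_point mul1r mul0r addr0. Qed.

Lemma lattice_omega ab : lattice ab (ab.2%:R + omega).
Proof. by exists 0, 1; rewrite /lattice_point mul1r mul0r add0r. Qed.

Lemma lattice_ideal ab : hnf_pair ab -> nonzero_ideal OK (lattice ab).
Proof.
move=> hnf; split.
- by move=> _ [x [y ->]]; rewrite lattice_pointE; exact: quad_order_qint.
- by exists ab.1%:R; [exact: lattice_nat | exact: hnf_pair_neq0].
- move=> _ _ [x [y ->]] [u [v ->]]; exists (x + u), (y + v).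
  by rewrite /lattice_point !intrD; ring.
move=> _ _ /quad_orderP[r [s ->]] [x [y ->]].
have /andP[_ /dvdnP[e normE]] := hnf; case: ab {hnf} normE => a b /= normE.
have kE : k%:Z = e%:Z * a%:Z - b%:Z ^+ 2 - b%:Z.
  by move: normE; rewrite /omega_norm; clear; lia.
exists (r * x - s * b%:Z * x - s * y * e%:Z).
exists (r * y + s * x * a%:Z + s * y * (b%:Z + 1)).
by rewrite !lattice_pointE /= qintM kE; congr qint; ring.
Qed.

Lemma conj_lattice ab : (ab.2 < ab.1)%N ->
  conj_set (lattice ab) = lattice (conj_pair ab).
Proof.
move=> lt_ba; apply/seteqP; split=> [_ [_ [x [y ->]] <-]|_ [x [y ->]]].
  by exists (x + y), (- y); exact: lattice_point_conj.
exists (lattice_point ab (x + y) (- y)); first by exists (x + y), (- y).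
by rewrite lattice_point_conj //; congr lattice_point; ring.
Qed.

Lemma scale_ideal g I : g != 0 -> (forall z, I z -> OK (g * z)) ->
  nonzero_ideal OK I -> nonzero_ideal OK (scale_set g I).
Proof.
move=> g_neq0 gI [_ [z Iz z_neq0] ID IM]; split.
- by move=> _ [w Iw <-]; exact: gI.
- by exists (g * z); [exists z | rewrite mulf_neq0].
- move=> _ _ [x Ix <-] [y Iy <-]; exists (x + y); first exact: ID.
  by rewrite mulrDr.
- move=> r _ OKr [x Ix <-]; exists (r * x); first exact: IM.
  by rewrite mulrCA.
Qed.

Lemma conj_ideal I : nonzero_ideal OK I -> nonzero_ideal OK (conj_set I).
Proof.
move=> [IO [z Iz z_neq0] ID IM]; split.
- by move=> _ [w Iw <-]; apply: quad_order_conj; exact: IO.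
- by exists z^*; [exists z | rewrite fmorph_eq0].
- move=> _ _ [x Ix <-] [y Iy <-]; exists (x + y); first exact: ID.
  by rewrite rmorphD.
- move=> r _ OKr [x Ix <-]; exists (r^* * x); last by rewrite rmorphM /= conjCK.
  by apply: IM => //; exact: quad_order_conj.
Qed.

Section IdealBasis.
Variable I : set algC.
Hypothesis I_ideal : nonzero_ideal OK I.

Lemma ideal_comb z w (u v : int) : I z -> I w -> I (u%:~R * z + v%:~R * w).
Proof.
by case: I_ideal => _ _ ID IM Iz Iw; apply: ID; apply: IM => //;
  exact: quad_order_int.
Qed.

Lemma ideal_comb_qint u v x y x' y' : I (qint x y) -> I (qint x' y') ->
  I (qint (u * x + v * x') (u * y + v * y')).
Proof. by rewrite -qintD -!qintZ; exact: ideal_comb. Qed.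

Lemma ideal_norm_mem z : I z -> I (z * z^*).
Proof.
case: I_ideal => IO _ _ IM Iz; rewrite mulrC; apply: IM => //.
by apply: quad_order_conj; exact: IO.
Qed.

Lemma ideal_int_mul_omega x : I (qint x 0) -> I (qint 0 x).
Proof.
case: I_ideal => _ _ _ IM /(IM _ _ quad_order_omega).
by rewrite -qint_omega qintM; congr (I (qint _ _)); ring.
Qed.

Lemma ideal_int_gen : exists2 m : nat, (0 < m)%N &
  forall x, I (qint x 0) <-> exists t, x = t * m%:Z.
Proof.
apply: int_subgroup_gen => [|x x' u v Ix Ix']; last first.
  by have := ideal_comb_qint u v Ix Ix'; rewrite !mulr0 addr0.
case: I_ideal => IO [z Iz z_neq0] _ _.
have /quad_orderP[x [y zE]] := IO _ Iz.
exists (x ^+ 2 + x * y + k%:Z * y ^+ 2).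
  by rewrite qint_int -qint_norm -zE; exact: ideal_norm_mem.
rewrite -(intr_eq0 algC) -qint_norm -zE.
by rewrite mulf_neq0 // fmorph_eq0.
Qed.

Lemma ideal_omega_gen : exists2 c : nat, (0 < c)%N &
  forall y, (exists x, I (qint x y)) <-> exists t, y = t * c%:Z.
Proof.
apply: int_subgroup_gen => [|y y' u v [x Ix] [x' Ix']]; last first.
  by exists (u * x + v * x'); exact: ideal_comb_qint.
have [m m_gt0 m_gen] := ideal_int_gen; exists m%:Z; last by lia.
by exists 0; apply: ideal_int_mul_omega; apply/m_gen; exists 1; rewrite mul1r.
Qed.

Lemma ideal_basis : exists c a b : nat, [/\ (0 < c)%N, (b < a)%N,
  I (qint (c%:Z * b%:Z) c%:Z),
  forall x, I (qint x 0) <-> exists t, x = t * (c%:Z * a%:Z) &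
  forall x y, I (qint x y) -> exists t, y = t * c%:Z].
Proof.
have [m m_gt0 m_gen] := ideal_int_gen; have [c c_gt0 c_gen] := ideal_omega_gen.
have Im : I (qint m%:Z 0) by apply/m_gen; exists 1; rewrite mul1r.
have [e Ie] : exists e, I (qint e c%:Z) by apply/c_gen; exists 1; rewrite mul1r.
have [a mE] : exists a : int, m%:Z = a * c%:Z.
  by apply/c_gen; exists 0; exact: ideal_int_mul_omega.
have [b0 eE] : exists b0 : int, e = b0 * c%:Z.
  have [t tE] : exists t, e + c%:Z = t * c%:Z.
    apply/c_gen; exists (- (k%:Z * c%:Z)); case: I_ideal => _ _ _ IM.
    have := IM _ _ quad_order_omega Ie; rewrite -qint_omega qintM.
    by congr (I (qint _ _)); ring.
  by exists (t - 1); rewrite mulrBl -tE; ring.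
have a_gt0 : 0 < a by move: m_gt0 c_gt0 mE; clear; nia.
have modE := divz_eq b0 a.
have mod_ge0 : 0 <= (b0 %% a)%Z by rewrite modz_ge0 // gt_eqF.
have mod_lt : (b0 %% a)%Z < a by rewrite ltz_pmod.
have absE (x : int) : 0 <= x -> `|x|%N%:Z = x by move=> ?; rewrite gez0_abs.
exists c, `|a|%N, `|(b0 %% a)%Z|%N; split=> //.
- by rewrite -ltz_nat !absE // ltW.
- rewrite absE //; have := ideal_comb_qint 1 (- (b0 %/ a)%Z) Ie Im.
  congr (I (qint _ _)); last by ring.
  by rewrite eE mE {1}modE; ring.
- by move=> x; rewrite absE ?ltW // [c%:Z * a]mulrC -mE; exact: m_gen.
- by move=> x y Ixy; apply/c_gen; exists x.
Qed.

Lemma ideal_hnf : exists c ab, [/\ (0 < c)%N, hnf_pair ab &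
  I = scale_set c%:R (lattice ab)].
Proof.
have [c [a [b [c_gt0 lt_ba Ib int_gen omega_gen]]]] := ideal_basis.
have pointE x y : c%:R * lattice_point (a, b) x y =
    qint (x * (c%:Z * a%:Z) + y * (c%:Z * b%:Z)) (y * c%:Z).
  by rewrite lattice_pointE pmulrn qintZ /=; congr qint; ring.
exists c, (a, b); split=> //.
  rewrite /hnf_pair /= lt_ba; apply/dvdnP.
  case: I_ideal => _ _ _ IM.
  have := IM _ _ (quad_order_conj (quad_order_qint b%:Z 1)) Ib.
  rewrite (_ : qint (c%:Z * b%:Z) c%:Z = c%:Z%:~R * qint b%:Z 1); last first.
    by rewrite qintZ mulr1.
  rewrite mulrCA [_^* * _]mulrC qint_norm -intrM -qint_int => /int_gen[t].
  rewrite [t * _]mulrCA => /mulfI normE; exists `|t|%N.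
  have /(congr1 absz) : b%:Z ^+ 2 + b%:Z * 1 + k%:Z * 1 ^+ 2 = t * a%:Z.
    by apply: normE; lia.
  by rewrite abszM absz_nat => <-; rewrite /omega_norm; clear; lia.
apply/seteqP; split=> [z Iz|_ [_ [x [y ->]] <-]].
  case: I_ideal => IO _ _ _; have /quad_orderP[x [y zE]] := IO _ Iz.
  rewrite zE in Iz *; have [y' yE] := omega_gen _ _ Iz.
  have [t tE] : exists t, x - y' * (c%:Z * b%:Z) = t * (c%:Z * a%:Z).
    apply/int_gen; have := ideal_comb_qint 1 (- y') Iz Ib; rewrite yE.
    by congr (I (qint _ _)); ring.
  exists (lattice_point (a, b) t y'); first by exists t, y'.
  by rewrite pointE -tE -yE subrK.
have Ia : I (qint (c%:Z * a%:Z) 0) by apply/int_gen; exists 1; rewrite mul1r.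
have := ideal_comb_qint x y Ia Ib; rewrite pointE.
by congr (I (qint _ _)); ring.
Qed.

End IdealBasis.

Lemma ideal_subgroup I : nonzero_ideal OK I -> additive_subgroup I.
Proof.
by move=> I_ideal z w Iz Iw; have := ideal_comb I_ideal 1 (-1) Iz Iw;
  rewrite mul1r mulN1r.
Qed.

(* The product of [I] and its conjugate is the principal ideal [(n)]. *)
Definition ideal_norm (I : set algC) (n : nat) : Prop :=
  (forall z w, I z -> I w -> exists2 r, OK r & z * w^* = n%:R * r) /\
  (forall P, additive_subgroup P -> (forall z w, I z -> I w -> P (z * w^*)) ->
     P n%:R).

Lemma ideal_norm_mul_mem I n P g : ideal_norm I n -> additive_subgroup P ->
  (forall z w, I z -> I w -> P (g * (z * w^*))) -> P (g * n%:R).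
Proof.
move=> [_ norm_gen] PB gP.
apply: (norm_gen [set z | P (g * z)]) => // z w Pz Pw.
by rewrite /= mulrBr; exact: PB.
Qed.

Lemma subgroup_mul_quad_order n :
  additive_subgroup [set z | exists2 r, OK r & z = n%:R * r].
Proof.
move=> _ _ [r OKr ->] [s OKs ->]; exists (r - s); last by rewrite mulrBr.
by apply: quad_orderD => //; exact: quad_orderN.
Qed.

Lemma ideal_norm_uniq I n m : ideal_norm I n -> ideal_norm I m -> n = m.
Proof.
have norm_dvd n' m' : ideal_norm I n' -> ideal_norm I m' -> (n' %| m')%N.
  move=> [norm_mul _] [_ norm_gen].
  have [r OKr] := norm_gen _ (subgroup_mul_quad_order (n := n')) norm_mul.
  exact: quad_order_natr_dvd.
by move=> *; apply/eqP; rewrite eqn_dvd !norm_dvd.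
Qed.

Lemma ideal_norm_scale I n m g : ideal_norm I n -> g * g^* * n%:R = m%:R ->
  ideal_norm (scale_set g I) m.
Proof.
move=> norm_I mE; split=> [_ _ [z Iz <-] [w Iw <-]|P PB PI].
  have [r OKr zwE] := norm_I.1 _ _ Iz Iw; exists r => //.
  by rewrite rmorphM /= mulrACA zwE mulrA mE.
rewrite -mE; apply: ideal_norm_mul_mem norm_I PB _ => z w Iz Iw.
by rewrite -mulrACA -rmorphM; apply: PI; [exists z | exists w].
Qed.

Lemma ideal_norm_conj I n : ideal_norm I n -> ideal_norm (conj_set I) n.
Proof.
move=> [norm_mul norm_gen]; split=> [_ _ [z Iz <-] [w Iw <-]|P PB PI].
  by rewrite conjCK mulrC; exact: norm_mul.
apply: norm_gen => // z w Iz Iw; rewrite -{1}[z]conjCK mulrC.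
by apply: PI; [exists w | exists z].
Qed.

(* The discriminant of the norm form is [- disc], so a common prime factor of
   the coefficients would be a square factor of [disc]. *)
Lemma norm_form_bezout ab : hnf_pair ab -> exists u v w : int,
  u * (coef_xx (norm_form ab))%:Z + v * (coef_xy (norm_form ab))%:Z
  + w * (coef_yy (norm_form ab))%:Z = 1.
Proof.
case: ab => a b /andP[_ root_b] /=; have := divnK root_b.
move: (_ %/ a)%N => e normE; set B := b.*2.+1.
have discE : (disc = 4 * (e * a) - B ^ 2)%N.
  by rewrite normE omega_norm_disc // -/B addKn.
have gcd1 : gcdn a (gcdn B e) = 1%N.
  apply/eqP/negPn/negP => gcd_neq1; have gcd_gt1 : (1 < gcdn a (gcdn B e))%N.
    by rewrite ltn_neqAle eq_sym gcd_neq1 !gcdn_gt0 orbT.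
  have := pdiv_dvd (gcdn a (gcdn B e)).
  rewrite !dvdn_gcd => /and3P[q_a q_B q_e].
  case/negP: (disc_sqfree (pdiv_prime gcd_gt1)); rewrite discE.
  by apply: dvdn_sub;
    [rewrite dvdn_mull // -mulnn dvdn_mul | rewrite dvdn_exp2r].
have [u [v uvE]] := Bezoutz a (gcdn B e).
have [u' [v' gcdE]] := Bezoutz B e.
exists u, (v * u'), (v * v'); rewrite -!mulrA -addrA -mulrDr gcdE.
by rewrite uvE /gcdz !absz_nat gcd1.
Qed.

Lemma lattice_omega_norm ab : hnf_pair ab ->
  (ab.2%:R + omega) * (ab.2%:R + omega)^* =
  ab.1%:R * (coef_yy (norm_form ab))%:R.
Proof.
move=> hnf; have := lattice_point_norm 0 1 hnf.
rewrite /lattice_point mul0r add0r mul1r => ->; congr (_ * _).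
by rewrite [RHS]pmulrn; congr (_%:~R); rewrite /form_val /=; ring.
Qed.

Lemma lattice_ideal_norm ab : hnf_pair ab -> ideal_norm (lattice ab) ab.1.
Proof.
move=> hnf; set e := (coef_yy (norm_form ab))%:R : algC.
have nat_real (n : nat) : (n%:R : algC)^* = n%:R by rewrite rmorph_nat.
have mul_conj := lattice_omega_norm hnf; rewrite -/e in mul_conj.
split=> [_ _ [x [y ->]] [u [v ->]]|P PB PI].
  set w := ab.2%:R + omega in mul_conj *.
  have OKw : OK w.
    by apply: quad_orderD; [exact: quad_order_nat | exact: quad_order_omega].
  exists (x%:~R * u%:~R * ab.1%:R + x%:~R * v%:~R * w^*
    + y%:~R * u%:~R * w + y%:~R * v%:~R * e).
    by do ?apply: quad_orderD; do ?apply: quad_orderM;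
      do ?[exact: quad_order_int | exact: quad_order_nat |
        exact: quad_order_conj].
  rewrite /lattice_point -/w rmorphD !rmorphM /= !rmorph_int nat_real.
  transitivity (x%:~R * u%:~R * ab.1%:R ^+ 2 + x%:~R * v%:~R * ab.1%:R * w^*
    + y%:~R * u%:~R * ab.1%:R * w + y%:~R * v%:~R * (w * w^*)); first by ring.
  by rewrite mul_conj; ring.
have [u [v [w /(congr1 (fun t => t%:~R : algC))]]] := norm_form_bezout hnf.
rewrite !intrD !intrM -!pmulrn -/e /= -[_.*2.+1%:R]natr1 -mul2n natrM => bezout.
have La := lattice_nat ab; have Lw := lattice_omega ab.
have Pxx := subgroupMz u PB (PI _ _ La La).
have Pxy := subgroupMz v PB (subgroupD PB (PI _ _ La Lw) (PI _ _ Lw La)).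
have Pyy := subgroupMz w PB (PI _ _ Lw Lw).
have := subgroupD PB (subgroupD PB Pxx Pxy) Pyy; congr P.
rewrite mul_conj rmorphD /= !nat_real conj_omega.
transitivity (ab.1%:R *
  (u%:~R * ab.1%:R + v%:~R * (2 * ab.2%:R + 1) + w%:~R * e)); first by ring.
by rewrite bezout mulr1.
Qed.

Lemma scale_lattice_norm c ab : hnf_pair ab ->
  ideal_norm (scale_set c%:R (lattice ab)) (c ^ 2 * ab.1).
Proof.
move=> hnf; apply: ideal_norm_scale (lattice_ideal_norm hnf) _.
by rewrite rmorph_nat -expr2 natrM natrX.
Qed.

Lemma ideal_equivP I J : ideal_equiv OK I J <->
  exists u v, [/\ OK u, u != 0, OK v, v != 0 & I = scale_set (u / v) J].
Proof.
have scale_neq0 u v (L M : set algC) : v != 0 ->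
    scale_set v L = scale_set u M <-> L = scale_set (u / v) M.
  move=> v_neq0; split=> [eqLM|->]; last by rewrite scale_setA mulrC divfK.
  by rewrite mulrC -scale_setA -eqLM scale_setA mulVf // scale_set1.
split=> [[v [u [[OKv v_neq0] [OKu u_neq0] eqIJ]]]|].
  by exists u, v; split=> //; apply/scale_neq0.
move=> [u [v [OKu u_neq0 OKv v_neq0 eqIJ]]].
by exists v, u; split=> //; apply/scale_neq0.
Qed.

Lemma ideal_equiv_refl I : ideal_equiv OK I I.
Proof.
apply/ideal_equivP; exists 1, 1; have := quad_order_nat 1.
by split; rewrite ?oner_eq0 // divr1 scale_set1.
Qed.

Lemma ideal_equiv_sym I J : ideal_equiv OK I J -> ideal_equiv OK J I.
Proof. by move=> [u [v [Hu Hv eqIJ]]]; exists v, u. Qed.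

Lemma ideal_equiv_trans I J L :
  ideal_equiv OK I J -> ideal_equiv OK J L -> ideal_equiv OK I L.
Proof.
move=> /ideal_equivP[u [v [OKu u_neq0 OKv v_neq0 ->]]].
move=> /ideal_equivP[u' [v' [OKu' u'_neq0 OKv' v'_neq0 ->]]].
apply/ideal_equivP; exists (u * u'), (v * v').
split; rewrite ?mulf_neq0 //; try exact: quad_orderM.
by rewrite scale_setA invfM mulrACA.
Qed.

Lemma ideal_equiv_conj I J :
  ideal_equiv OK I J -> ideal_equiv OK (conj_set I) (conj_set J).
Proof.
move=> /ideal_equivP[u [v [OKu u_neq0 OKv v_neq0 ->]]].
apply/ideal_equivP; exists u^*, v^*; rewrite conj_scale_set rmorphM fmorphV.
by split; rewrite ?fmorph_eq0 //; exact: quad_order_conj.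
Qed.

Lemma scale_nat_equiv c I : (0 < c)%N -> ideal_equiv OK (scale_set c%:R I) I.
Proof.
move=> c_gt0; apply/ideal_equivP; exists c%:R, 1; rewrite divr1.
by split; rewrite ?oner_eq0 ?pnatr_eq0 -?lt0n //;
  [exact: quad_order_nat | exact: (quad_order_nat 1)].
Qed.

Lemma ideal_class_eq I J : nonzero_ideal OK J ->
  ideal_class OK I = ideal_class OK J <-> ideal_equiv OK I J.
Proof.
move=> J_ideal; split=> [eqIJ|eqIJ].
  have : ideal_class OK J J by split=> //; exact: ideal_equiv_refl.
  by rewrite -eqIJ => -[].
apply/seteqP; split=> L [L_ideal equivL]; split=> //.
  exact: ideal_equiv_trans (ideal_equiv_sym eqIJ) equivL.
exact: ideal_equiv_trans eqIJ equivL.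
Qed.

(* As [z] ranges over the ideal [lattice ab], its twists range over the ideals
   in the class of the conjugate of [lattice ab], each being hit by [z] and
   [- z] only. *)
Definition twist (ab : nat * nat) (z : algC) : set algC :=
  scale_set (z / ab.1%:R) (conj_set (lattice ab)).

Section Twists.
Variable ab : nat * nat.
Hypothesis hnf : hnf_pair ab.

Let a_neq0 : ab.1%:R != 0 :> algC. Proof. exact: hnf_pair_neq0. Qed.

Lemma twist_norm z m : z * z^* = ab.1%:R * m%:R -> ideal_norm (twist ab z) m.
Proof.
move=> zzE.
apply: ideal_norm_scale (ideal_norm_conj (lattice_ideal_norm hnf)) _.
rewrite rmorphM fmorphV rmorph_nat /= mulrACA zzE; field.
exact: a_neq0.
Qed.

Lemma twist_ideal z : z != 0 -> lattice ab z -> nonzero_ideal OK (twist ab z).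
Proof.
move=> z_neq0 Lz; apply: scale_ideal (conj_ideal (lattice_ideal hnf)).
  by rewrite mulf_neq0 ?invr_eq0.
move=> _ [w Lw <-]; have [r OKr zwE] := (lattice_ideal_norm hnf).1 _ _ Lz Lw.
by rewrite mulrAC zwE mulrAC mulfV // mul1r.
Qed.

Lemma twist_equiv z : z != 0 -> lattice ab z ->
  ideal_equiv OK (twist ab z) (conj_set (lattice ab)).
Proof.
move=> z_neq0 [x [y zE]]; apply/ideal_equivP; exists z, ab.1%:R; split=> //.
  by rewrite zE lattice_pointE; exact: quad_order_qint.
exact: quad_order_nat.
Qed.

Lemma twistN (z : algC) : twist ab (- z) = twist ab z.
Proof.
have opp_conj : scale_set (-1) (conj_set (lattice ab)) = conj_set (lattice ab).
  have LN w : lattice ab w -> lattice ab (- w).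
    by apply: subgroupN; exact: ideal_subgroup (lattice_ideal hnf).
  apply/seteqP; split=> [_ [_ [w Lw <-] <-]|_ [w Lw <-]].
    by exists (- w); rewrite ?rmorphN ?mulN1r //; exact: LN.
  exists (- w)^*; first by exists (- w) => //; exact: LN.
  by rewrite rmorphN mulN1r opprK.
by rewrite /twist -[in RHS]opp_conj scale_setA mulrN1 mulNr.
Qed.

Lemma scale_conj_lattice_twist g :
  nonzero_ideal OK (scale_set g (conj_set (lattice ab))) ->
  exists2 z, lattice ab z & scale_set g (conj_set (lattice ab)) = twist ab z.
Proof.
move=> [gO _ _ _]; exists (g * ab.1%:R); last by rewrite /twist mulfK.
have L_ideal := lattice_ideal hnf.
apply: ideal_norm_mul_mem (lattice_ideal_norm hnf) (ideal_subgroup L_ideal) _.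
move=> z w Lz Lw; have [_ _ _ LM] := L_ideal; rewrite mulrCA mulrC.
apply: LM => //.
by apply: gO; exists w^* => //; exists w.
Qed.

Lemma scale_conj_lattice_quotient g h : h != 0 ->
  scale_set g (conj_set (lattice ab)) = scale_set h (conj_set (lattice ab)) ->
    OK (g / h).
Proof.
move=> h_neq0 eq_gh; have norm_ab := lattice_ideal_norm hnf.
suff [r OKr /(mulIf a_neq0)] : exists2 r, OK r & g / h * ab.1%:R = r * ab.1%:R.
  by move=> ->.
have PB : additive_subgroup [set z | exists2 r, OK r & z = r * ab.1%:R].
  move=> _ _ [r OKr ->] [s OKs ->]; exists (r - s); last by rewrite mulrBl.
  by apply: quad_orderD => //; exact: quad_orderN.
apply: (ideal_norm_mul_mem norm_ab PB) => z w Lz Lw.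
have : scale_set g (conj_set (lattice ab)) (g * w^*).
  by exists w^* => //; exists w.
rewrite eq_gh => -[_ [w' Lw' <-] gwE].
have [r OKr zwE] := norm_ab.1 _ _ Lz Lw'; exists r => //=.
by rewrite [r * _]mulrC -zwE mulrCA [g / h]mulrC -mulrA -gwE mulKf.
Qed.

Lemma twist_eq_pm (z w : algC) : z != 0 -> w != 0 -> twist ab z = twist ab w ->
  z = w \/ z = - w.
Proof.
have div_neq0 (t : algC) : t != 0 -> t / ab.1%:R != 0.
  by move=> t_neq0; rewrite mulf_neq0 ?invr_eq0.
have quotientE (t u : algC) : t / ab.1%:R / (u / ab.1%:R) = t / u.
  by rewrite invfM invrK mulrACA mulVf ?mulr1.
move=> z_neq0 w_neq0 eq_zw.
have := scale_conj_lattice_quotient (div_neq0 _ w_neq0) eq_zw.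
have := scale_conj_lattice_quotient (div_neq0 _ z_neq0) (esym eq_zw).
rewrite !quotientE => OKwz OKzw.
have [|zwE|zwE] := quad_order_unit OKzw OKwz;
  first by rewrite mulrA divfK // mulfV.
- by left; rewrite -[z](divfK w_neq0) zwE mul1r.
- by right; rewrite -[z](divfK w_neq0) zwE mulN1r.
Qed.

End Twists.

Lemma lattice_norm_nat ab z : hnf_pair ab -> lattice ab z ->
  exists m : nat, z * z^* = ab.1%:R * m%:R.
Proof.
move=> hnf [x [y ->]]; exists `|norm_form ab x y|%N.
have form_ge0 := form_ge0 (pos_def_norm_form hnf) x y.
by rewrite lattice_point_norm // -{1}(gez0_abs form_ge0) -pmulrn.
Qed.

(* One of [b + omega] and [b - a + omega] has a real part of absolute value at
   most [a / 2]. *)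
Lemma lattice_short_vector ab : hnf_pair ab -> (4 * k <= ab.1)%N ->
  exists z (m : nat), [/\ lattice ab z, z != 0, (m < ab.1)%N &
    z * z^* = ab.1%:R * m%:R].
Proof.
move=> hnf le_a; have [x [e [le_e root_e normE]]] : exists x e,
    [/\ (2 * e + 1 <= ab.1)%N, root_mod k ab.1 e &
     (x * ab.1%:Z + ab.2%:Z) ^+ 2 + (x * ab.1%:Z + ab.2%:Z) + k%:Z =
      (omega_norm k e)%:Z].
  have /andP[_ /=] := hnf_conj_pair hnf; have /andP[] := hnf.
  case: ab {hnf le_a} => a b /= lt_ba root_b root_conj.
  case: (leqP (2 * b + 1) a) => le_2b;
    [exists 0, b | exists (-1), (a - 1 - b)%N].
    by split=> //; rewrite /omega_norm; clear; lia.
  split=> //; first by move: lt_ba le_2b; clear; lia.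
  have [t aE] : exists t, a = (b + t).+1 by exists (a - b.+1)%N; lia.
  by rewrite aE (_ : (b + t).+1 - 1 - b = t)%N /omega_norm; clear; lia.
have := divnK root_e; set m := (_ %/ _)%N => mE.
exists (lattice_point ab x 1), m; split=> //.
- exact: lattice_point_lattice.
- rewrite lattice_pointE; apply/eqP; rewrite -[RHS]/(0%:~R) -qint_int.
  by case/qint_inj.
- by move: mE; rewrite /omega_norm; move: le_e le_a; clear; nia.
rewrite lattice_pointE qint_norm -natrM mulnC mE pmulrn -normE; congr (_%:~R).
by ring.
Qed.

Lemma lattice_reduction_step ab : hnf_pair ab -> (4 * k <= ab.1)%N ->
  exists ab', [/\ hnf_pair ab', (ab'.1 < ab.1)%N &
    ideal_equiv OK (lattice ab) (lattice ab')].
Proof.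
move=> hnf le_a; have hnf' := hnf_conj_pair hnf.
have [z [m [Lz z_neq0 lt_m normE]]] := lattice_short_vector hnf' le_a.
have [c [ab' [c_gt0 hnf_ab' twistE]]] := ideal_hnf (twist_ideal hnf' z_neq0 Lz).
have norm_twist := twist_norm hnf' normE; rewrite twistE in norm_twist.
have normE' : (c ^ 2 * ab'.1 = m)%N.
  exact: ideal_norm_uniq (scale_lattice_norm c hnf_ab') norm_twist.
exists ab'; split=> //.
  by move: lt_m; rewrite -normE' /=; apply: leq_ltn_trans;
    rewrite leq_pmull ?expn_gt0 ?c_gt0.
have conjE : conj_set (lattice (conj_pair ab)) = lattice ab.
  by rewrite conj_lattice ?conj_pairK //; case/andP: hnf'.
rewrite -conjE.
apply: ideal_equiv_trans (ideal_equiv_sym (twist_equiv hnf' z_neq0 Lz)) _.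
by rewrite twistE; exact: scale_nat_equiv.
Qed.

Definition reduced_pairs : seq (nat * nat) :=
  [seq (a, b) | a <- iota 1 disc, b <- roots_mod k a].

Lemma mem_reduced_pairs ab :
  (ab \in reduced_pairs) = hnf_pair ab && (ab.1 < 4 * k)%N.
Proof.
case: ab => a b; apply/allpairsPdep/andP => [[x [y [x_in y_in [-> ->]]]]|].
  by move: x_in y_in; rewrite mem_iota mem_roots_mod /hnf_pair /= => *;
    split=> //; lia.
move=> [/andP[/= lt_ba root_b] lt_a]; exists a, b.
by rewrite mem_roots_mod lt_ba root_b mem_iota; split=> //; lia.
Qed.

Lemma reduced_hnf_pair ab : ab \in reduced_pairs -> hnf_pair ab.
Proof. by rewrite mem_reduced_pairs => /andP[]. Qed.

Lemma lattice_reduction ab : hnf_pair ab ->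
  exists2 ab', ab' \in reduced_pairs &
    ideal_equiv OK (lattice ab) (lattice ab').
Proof.
have [n] := ubnP ab.1; elim: n ab => // n IHn ab lt_n hnf.
case: (ltnP ab.1 (4 * k)) => le_a.
  by exists ab; [rewrite mem_reduced_pairs hnf | exact: ideal_equiv_refl].
have [ab' [hnf' lt_a' equiv_ab']] := lattice_reduction_step hnf le_a.
have [|ab'' red_ab'' equiv_ab''] := IHn ab' _ hnf'.
  by apply: leq_trans lt_a' _; rewrite -ltnS.
by exists ab'' => //; exact: ideal_equiv_trans equiv_ab' equiv_ab''.
Qed.

Lemma ideal_reduction I : nonzero_ideal OK I ->
  exists2 ab, ab \in reduced_pairs & ideal_equiv OK I (lattice ab).
Proof.
move=> /ideal_hnf[c [ab [c_gt0 hnf ->]]].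
have [ab' red_ab' equiv_ab'] := lattice_reduction hnf; exists ab' => //.
exact: ideal_equiv_trans (scale_nat_equiv _ c_gt0) equiv_ab'.
Qed.

Definition lattice_class (ab : nat * nat) : set (set algC) :=
  ideal_class OK (lattice ab).

Lemma ideal_classesE :
  ideal_classes OK = [set` [seq lattice_class ab | ab <- reduced_pairs]].
Proof.
apply/seteqP; split=> C /= [].
  move=> I I_ideal <-; have [ab red_ab equiv_ab] := ideal_reduction I_ideal.
  apply/mapP; exists ab => //; apply/ideal_class_eq => //.
  exact: lattice_ideal (reduced_hnf_pair red_ab).
move=> /mapP[ab red_ab ->]; exists (lattice ab) => //.
exact: lattice_ideal (reduced_hnf_pair red_ab).
Qed.

Record class_representatives (reps : seq (nat * nat)) : Prop :=
  ClassRepresentatives {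
    reps_hnf : forall ab, ab \in reps -> hnf_pair ab;
    reps_uniq : uniq reps;
    reps_inequiv : {in reps &, forall ab ab',
      ideal_equiv OK (lattice ab) (lattice ab') -> ab = ab'};
    reps_cover : forall I, nonzero_ideal OK I ->
      exists2 ab, ab \in reps & ideal_equiv OK I (lattice ab)
  }.

Lemma class_representatives_exist : exists2 reps, class_representatives reps &
  size reps = class_number (quadratic_field (- disc%:Z)).
Proof.
have [reps [sub_reps mapE inj_reps]] :=
  undup_map_preimage lattice_class reduced_pairs.
have hnf_reps ab : ab \in reps -> hnf_pair ab by move/sub_reps/reduced_hnf_pair.
exists reps; first split=> //.
- by apply: (map_uniq (f := lattice_class)); rewrite mapE undup_uniq.
- move=> ab ab' ab_in ab'_in equiv_ab; apply: inj_reps => //.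
  by apply/ideal_class_eq => //; exact: lattice_ideal (hnf_reps _ ab'_in).
- move=> I /ideal_reduction[ab red_ab equiv_ab].
  have : lattice_class ab \in undup (map lattice_class reduced_pairs).
    by rewrite mem_undup map_f.
  rewrite -mapE => /mapP[ab' ab'_in classE]; exists ab' => //.
  apply: ideal_equiv_trans equiv_ab _; apply/ideal_class_eq => //.
  exact: lattice_ideal (hnf_reps _ ab'_in).
rewrite /class_number -/OK ideal_classesE.
have -> : [set` [seq lattice_class ab | ab <- reduced_pairs]] =
    [set` [fset C in [seq lattice_class ab | ab <- reduced_pairs]]%fset].
  by apply/seteqP; split=> C /=; rewrite in_fset.
by rewrite set_fsetK card_fseq -mapE size_map.
Qed.

Definition ideal_triples (n : nat) : seq (nat * (nat * nat)) :=
  [seq (c, (n %/ c ^ 2, b))%N | c <- [seq c <- divisors n | (c ^ 2 %| n)%N],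
                                b <- roots_mod k (n %/ c ^ 2)].

Definition triple_ideal (t : nat * (nat * nat)) : set algC :=
  scale_set t.1%:R (lattice t.2).

Lemma size_ideal_triples n : size (ideal_triples n) = ideal_count k n.
Proof. by rewrite size_allpairs_dep sumnE big_map big_filter. Qed.

Lemma mem_ideal_triples n t : (0 < n)%N -> (t \in ideal_triples n) =
  [&& (0 < t.1)%N, hnf_pair t.2 & (t.1 ^ 2 * t.2.1 == n)%N].
Proof.
case: t => c [a b] n_gt0; apply/allpairsPdep/and3P => /=.
  move=> [c' [b' [c'_in b'_in [-> -> ->]]]]; move: c'_in b'_in.
  rewrite mem_filter mem_roots_mod -dvdn_divisors // => /andP[c2_n c_n] hnf.
  by split=> //; [exact: dvdn_gt0 c_n | rewrite mulnC divnK].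
move=> [c_gt0 hnf /eqP <-]; exists c, b.
rewrite mulKn ?expn_gt0 ?c_gt0 // mem_roots_mod; split=> //.
rewrite mem_filter -dvdn_divisors; last first.
  by rewrite muln_gt0 expn_gt0 c_gt0 (hnf_pair_gt0 hnf).
by rewrite dvdn_mulr //= dvdn_mulr // dvdn_exp.
Qed.

Lemma ideal_triples_uniq n : uniq (ideal_triples n).
Proof.
apply: allpairs_uniq_dep.
- by rewrite filter_uniq // divisors_uniq.
- by move=> c _; exact: roots_mod_uniq.
- by move=> [c b] [c' b'] _ _ [-> _ ->].
Qed.

Lemma triple_ideal_norm n t : (0 < n)%N -> t \in ideal_triples n ->
  ideal_norm (triple_ideal t) n.
Proof.
move=> n_gt0; rewrite mem_ideal_triples // => /and3P[_ hnf /eqP <-].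
exact: scale_lattice_norm.
Qed.

Lemma triple_ideal_ideal n t : (0 < n)%N -> t \in ideal_triples n ->
  nonzero_ideal OK (triple_ideal t).
Proof.
move=> n_gt0; rewrite mem_ideal_triples // => /and3P[c_gt0 hnf _].
have [LO _ _ _] := lattice_ideal hnf; apply: scale_ideal (lattice_ideal hnf).
  by rewrite pnatr_eq0 -lt0n.
by move=> z /LO OKz; apply: quad_orderM => //; exact: quad_order_nat.
Qed.

Lemma triple_ideal_sub t t' : triple_ideal t `<=` triple_ideal t' ->
  exists2 y, t.1%:Z = t'.1%:Z * y &
  exists x, t.1%:Z * t.2.2%:Z = t'.1%:Z * (x * t'.2.1%:Z + y * t'.2.2%:Z).
Proof.
move=> sub.
have /sub[_ [x [y ->]]] : triple_ideal t (t.1%:R * (t.2.2%:R + omega)).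
  by exists (t.2.2%:R + omega) => //; exact: lattice_omega.
rewrite lattice_pointE !pmulrn qintZ -[_ + omega](_ : qint t.2.2%:Z 1 = _).
  by rewrite qintZ mulr1 => /qint_inj[xE yE]; exists y => //; exists x.
by rewrite /qint mul1r.
Qed.

Lemma triple_ideal_inj n : (0 < n)%N ->
  {in ideal_triples n &, injective triple_ideal}.
Proof.
move=> n_gt0 [c [a b]] [c' [a' b']]; rewrite !mem_ideal_triples //=.
move=> /and3P[c_gt0 /andP[/= lt_ba _] /eqP nE]
  /and3P[c'_gt0 /andP[/= lt_ba' _] /eqP nE'] eqI.
have [|/= y cE [x bE]] := @triple_ideal_sub (c, (a, b)) (c', (a', b')).
  by rewrite eqI.
have [|/= y' cE' _] := @triple_ideal_sub (c', (a', b')) (c, (a, b)).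
  by rewrite eqI.
have dvd_abs (u v : nat) (w : int) : u%:Z = v%:Z * w -> (v %| u)%N.
  by move=> /(congr1 absz); rewrite abszM !absz_nat => ->; exact: dvdn_mulr.
have eq_c : c = c'.
  by apply/eqP; rewrite eqn_dvd (dvd_abs _ _ _ cE) (dvd_abs _ _ _ cE').
subst c'; have eq_a : a = a'.
  by move: nE'; rewrite -nE => /eqP;
    rewrite eqn_pmul2l ?expn_gt0 ?c_gt0 // => /eqP.
subst a'; have y1 : y = 1 by move: cE c_gt0; clear; nia.
have c_neq0 : c%:Z != 0 by lia.
move: bE; rewrite y1 mul1r => /(mulfI c_neq0) bE; congr (_, (_, _)).
by move: bE lt_ba lt_ba'; case: (ltgtP x 0) => x0; clear -x0; nia.
Qed.

Definition is_twist (ab : nat * nat) (x y : int) (t : nat * (nat * nat)) :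
    Prop :=
  triple_ideal t = twist ab (lattice_point ab x y).

Section CountTwists.
Variable n : nat.
Hypothesis n_gt0 : (0 < n)%N.

Lemma is_twist_neq0 ab x y t : t \in ideal_triples n -> is_twist ab x y t ->
  lattice_point ab x y != 0.
Proof.
move=> t_in tw; apply/eqP => point0.
have [_ [z]] := triple_ideal_ideal n_gt0 t_in; rewrite tw /twist point0 mul0r.
by move=> [w _ <-]; rewrite mul0r eqxx.
Qed.

Lemma is_twist_form ab x y t : hnf_pair ab -> t \in ideal_triples n ->
  is_twist ab x y t -> norm_form ab x y = n%:Z.
Proof.
move=> hnf t_in tw; have Lz := lattice_point_lattice ab x y.
have [m normE] := lattice_norm_nat hnf Lz.
have norm_n := triple_ideal_norm n_gt0 t_in; rewrite tw in norm_n.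
rewrite -(ideal_norm_uniq (twist_norm hnf normE) norm_n).
apply/eqP; rewrite -(eqr_int algC) -pmulrn; apply/eqP.
by apply: (mulfI (hnf_pair_neq0 hnf)); rewrite -lattice_point_norm.
Qed.

Lemma form_value_twists ab x y : hnf_pair ab ->
  (norm_form ab x y == n%:Z : nat)%:Z =
  \sum_(t <- ideal_triples n) (`[< is_twist ab x y t >] : nat)%:Z.
Proof.
move=> hnf; case: eqP => [form_n|form_neq]; last first.
  rewrite big1_seq // => t /andP[_ t_in]; case: asboolP => // tw.
  by case: form_neq; exact: is_twist_form tw.
have normE := lattice_point_norm x y hnf; rewrite form_n -pmulrn in normE.
have z_neq0 : lattice_point ab x y != 0.
  apply/eqP => z0; move/eqP: normE; rewrite z0 mul0r eq_sym mulf_eq0.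
  by rewrite (negPf (hnf_pair_neq0 hnf)) pnatr_eq0 (gtn_eqF n_gt0).
have Lz := lattice_point_lattice ab x y.
have [c [ab' [c_gt0 hnf' twistE]]] := ideal_hnf (twist_ideal hnf z_neq0 Lz).
have t_in : (c, ab') \in ideal_triples n.
  rewrite mem_ideal_triples // c_gt0 hnf'; apply/eqP.
  have := twist_norm hnf normE; rewrite twistE.
  exact: ideal_norm_uniq (scale_lattice_norm c hnf').
rewrite (bigD1_seq _ t_in) ?ideal_triples_uniq //= asboolT ?big1_seq // => t.
move=> /andP[t_neq t'_in]; case: asboolP => // tw; case/eqP: t_neq.
by apply: (triple_ideal_inj n_gt0) => //; rewrite tw twistE.
Qed.

Lemma is_twist_equiv ab x y t : hnf_pair ab -> t \in ideal_triples n ->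
  is_twist ab x y t -> ideal_equiv OK (conj_set (triple_ideal t)) (lattice ab).
Proof.
move=> hnf t_in tw; rewrite -[lattice ab]conj_setK tw; apply: ideal_equiv_conj.
by apply: twist_equiv => //;
  [exact: is_twist_neq0 tw | exact: lattice_point_lattice].
Qed.

Lemma is_twist_pm ab x y u v t : hnf_pair ab -> t \in ideal_triples n ->
  is_twist ab u v t ->
  is_twist ab x y t <-> (x == u) && (y == v) || (x == - u) && (y == - v).
Proof.
move=> hnf t_in tw_uv; have a_gt0 := hnf_pair_gt0 hnf.
split=> [tw_xy|]; last first.
  by case/orP => /andP[/eqP-> /eqP->] //;
    rewrite /is_twist lattice_pointN twistN.
have := twist_eq_pm hnf (is_twist_neq0 t_in tw_xy) (is_twist_neq0 t_in tw_uv).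
rewrite -tw_uv -tw_xy -lattice_pointN.
case=> // /(lattice_point_inj a_gt0)[-> ->].
  by rewrite !eqxx.
by rewrite !eqxx orbT.
Qed.

Section Representatives.
Variable reps : seq (nat * nat).
Hypothesis reps_classes : class_representatives reps.

Lemma is_twist_exists t : t \in ideal_triples n ->
  exists2 ab, ab \in reps & exists x y, is_twist ab x y t.
Proof.
move=> t_in; have t_ideal := triple_ideal_ideal n_gt0 t_in.
have [ab ab_in /ideal_equiv_conj] :=
  reps_cover reps_classes (conj_ideal t_ideal).
rewrite conj_setK => /ideal_equivP[u [v [_ _ _ _ tE]]].
rewrite tE in t_ideal; have hnf := reps_hnf reps_classes ab_in.
have [z [x [y zE]] twE] := scale_conj_lattice_twist hnf t_ideal.
by exists ab => //; exists x, y; rewrite /is_twist tE twE zE.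
Qed.

Lemma is_twist_uniq ab ab' x y u v t : t \in ideal_triples n ->
  ab \in reps -> ab' \in reps -> is_twist ab x y t -> is_twist ab' u v t ->
  ab = ab'.
Proof.
move=> t_in ab_in ab'_in tw tw'; apply: (reps_inequiv reps_classes) => //.
apply: ideal_equiv_trans (ideal_equiv_sym (is_twist_equiv _ t_in tw)) _.
  exact: (reps_hnf reps_classes).
by apply: is_twist_equiv tw' => //; exact: (reps_hnf reps_classes).
Qed.

Lemma count_twists M t : t \in ideal_triples n ->
  (forall ab, ab \in reps -> form_size (norm_form ab) * n < M ^ 2)%N ->
  \sum_(ab <- reps)
    zsum2 M (fun x y => (`[< is_twist ab x y t >] : nat)%:Z) = 2.
Proof.
move=> t_in lt_M; have [ab ab_in [x [y tw]]] := is_twist_exists t_in.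
have hnf := reps_hnf reps_classes ab_in.
rewrite (bigD1_seq _ ab_in) ?reps_uniq //= big1_seq ?addr0 => [|ab'];
  last first.
  move=> /andP[ab'_neq ab'_in]; apply: zsum20 => u v; case: asboolP => // tw'.
  by case/eqP: ab'_neq; exact: is_twist_uniq tw' tw.
have [||/ltnW le_x /ltnW le_y] :=
    @form_small (norm_form ab) x y M n (pos_def_norm_form hnf).
- by rewrite (is_twist_form hnf t_in tw).
- exact: lt_M.
rewrite -[RHS](zsum2_pm_pair le_x le_y).
  apply: eq_zsum2 => u v; congr (nat_of_bool _)%:Z.
  by apply/asboolP/idP => /(is_twist_pm u v hnf t_in tw).
rewrite -negb_and.
apply: contra (is_twist_neq0 t_in tw) => /andP[/eqP-> /eqP->].
by rewrite /lattice_point !mul0r addr0.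
Qed.

Lemma sum_form_count :
  \sum_(ab <- reps) form_count (norm_form ab) n = 2 * (ideal_count k n)%:Z.
Proof.
pose bound ab := (form_size (norm_form ab) * n)%N.
pose M := (\sum_(ab <- reps) bound ab).+1.
have lt_M ab : ab \in reps -> (bound ab < M ^ 2)%N.
  move=> ab_in; have : (bound ab < M)%N.
    by rewrite ltnS (bigD1_seq _ ab_in) ?reps_uniq //= leq_addr.
  by move/leq_trans; apply; rewrite -mulnn leq_pmulr.
transitivity (\sum_(ab <- reps) \sum_(t <- ideal_triples n)
    zsum2 M (fun x y => (`[< is_twist ab x y t >] : nat)%:Z)).
  rewrite big_seq [RHS]big_seq; apply: eq_bigr => ab ab_in.
  have hnf := reps_hnf reps_classes ab_in.
  rewrite (form_countE (pos_def_norm_form hnf) (lt_M _ ab_in)) -zsum2_sum.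
  by apply: eq_zsum2 => x y; exact: form_value_twists.
rewrite exchange_big /= big_seq (eq_bigr (fun=> 2)) => [|t t_in].
  rewrite -big_seq big_const_seq count_predT iter_addr addr0.
  by rewrite size_ideal_triples; lia.
exact: count_twists.
Qed.

End Representatives.
End CountTwists.
End QuadraticOrder.

(** * The class number formula *)

Lemma big_divisors (V : nmodType) (F : nat -> V) n : (0 < n)%N ->
  \sum_(m <- divisors n) F m = \sum_(1 <= m < n.+1 | (m %| n)%N) F m.
Proof.
move=> n_gt0; rewrite -[RHS]big_filter; apply: perm_big; apply: uniq_perm.
- exact: divisors_uniq.
- by rewrite filter_uniq // iota_uniq.
move=> m; rewrite mem_filter mem_index_iota -dvdn_divisors //.
case: (boolP (m %| n)%N) => //= m_n.
by rewrite (dvdn_gt0 n_gt0 m_n) ltnS dvdn_leq.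
Qed.

Lemma perm_even_quotient_divisors n : (0 < n)%N ->
  perm_eq [seq m <- divisors n.*2 | ~~ odd (n.*2 %/ m)] (divisors n).
Proof.
move=> n_gt0; apply: uniq_perm; rewrite ?filter_uniq ?divisors_uniq // => m.
rewrite mem_filter -!dvdn_divisors ?double_gt0 // -dvdn2 -muln2 andbC.
apply/andP/idP => [[m_n]|m_n].
  by rewrite dvdn_divRL // mulnC dvdn_pmul2r.
by split; [exact: dvdn_mulr | rewrite mulnC -muln_divA // dvdn_mulr].
Qed.

(* Alternating the signs subtracts twice the terms with an even cofactor. *)
Lemma eta_conv_divisor_sum (R : realType) (chi : nat -> int) n : (0 < n)%N ->
  eta_conv (fun m => (chi m)%:~R : R) n =
  (divisor_sum chi n - 2 * dilate 2 (divisor_sum chi) n)%:~R.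
Proof.
move=> n_gt0; rewrite /eta_conv -big_divisors // /divisor_sum.
have signE m : m \in divisors n -> (-1) ^+ (n %/ m).-1 * (chi m)%:~R =
    (chi m - 2 * (if odd (n %/ m) then 0 else chi m))%:~R :> R.
  rewrite -dvdn_divisors // => m_n; have quot_gt0 : (0 < n %/ m)%N.
    by rewrite divn_gt0 ?(dvdn_leq _ m_n) // (dvdn_gt0 _ m_n).
  rewrite -signr_odd; case: (_ %/ _)%N quot_gt0 => //= j _.
  by case: odd; rewrite /= ?expr0 ?expr1 !(intrB, intrM); ring.
rewrite big_seq (eq_bigr _ signE) -big_seq -rmorph_sum /= sumrB -mulr_sumr.
rewrite /dilate dvdn2; congr (_ - 2 * _)%:~R.
case: (boolP (odd n)) => [n_odd|/even_halfK nE].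
  rewrite big_seq big1 // => m; rewrite -dvdn_divisors // => m_n.
  rewrite ifT //.
  apply: contraTT n_odd => quot_even.
  by rewrite -(divnK m_n) oddM negb_and quot_even.
have half_gt0 : (0 < n./2)%N by move: n_gt0; rewrite -{1}nE double_gt0.
rewrite divn2 -(perm_big _ (perm_even_quotient_divisors half_gt0)) nE
  big_filter.
by rewrite [RHS]big_mkcond; apply: eq_bigr => m _; case: odd.
Qed.

Record odd_character (d : nat) (chi : nat -> int) : Prop := OddCharacter {
  chi_periodic : forall n, chi (d + n)%N = chi n;
  chi_reflect : forall r, (r <= d)%N -> chi (d - r)%N = - chi r
}.

Lemma odd_character0 d chi : odd_character d chi -> chi 0%N = 0.
Proof.
move=> [periodic reflect]; have := reflect 0%N isT.
by rewrite subn0 -[d]addn0 periodic; lia.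
Qed.

Lemma sum_reflect (V : zmodType) d (F : nat -> V) : F 0%N = F d ->
  \sum_(r < d) F (d - r)%N = \sum_(r < d) F r.
Proof.
move=> F0d; apply: (addIr (F d)); rewrite -[RHS](big_ord_recr d F).
by rewrite [RHS](reindex_inj rev_ord_inj) [RHS]big_ord_recr /= subSS subnn F0d.
Qed.

Lemma odd_character_sum d chi : odd_character d chi -> \sum_(r < d) chi r = 0.
Proof.
move=> odd_chi; have chi_0 := odd_character0 odd_chi.
have chi_d : chi d = 0 by rewrite -[d]addn0 (chi_periodic odd_chi).
have := @sum_reflect _ d chi; rewrite chi_0 chi_d => /(_ erefl).
under eq_bigr => r _ do rewrite (chi_reflect odd_chi) ?(ltnW (ltn_ord r)) //.
by rewrite sumrN; move: (\sum_(_ < _) _) => S; lia.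
Qed.

Section ClassNumberFormula.
Variables (R : realType) (k : nat) (chi : nat -> int).
Hypotheses (k_gt1 : (1 < k)%N) (disc_sqfree : square_free (4 * k - 1)).
Hypotheses (chi_splitting : splitting_character k chi)
  (chi_odd : odd_character (4 * k - 1) chi).

Local Notation disc := (4 * k - 1)%N.
Local Notation h := (class_number (quadratic_field (- disc%:Z))).

Let chiR n : R := (chi n)%:~R.
Let D n : R := if n is 0 then 0 else (divisor_sum chi n)%:~R.

Lemma has_abel_sum_eta_conv_character :
  has_abel_sum (eta_conv chiR) (L_at0 disc chiR / 2).
Proof.
apply: has_abel_sum_eta_conv => [n||||n].
- by rewrite /chiR; case/or3P: (chi_sign chi_splitting n) => /eqP ->;
    rewrite ?mulr0z ?normr0 // ?mulrNz ?normrN normr1.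
- by rewrite /chiR (odd_character0 chi_odd).
- by move: k_gt1; lia.
- by rewrite -rmorph_sum (odd_character_sum chi_odd).
- by rewrite /chiR (chi_periodic chi_odd).
Qed.

Lemma eta_conv_character : eta_conv chiR = D - 2 *: dilate 2 D.
Proof.
apply/funext => n; rewrite -[RHS]/(D n - 2 * dilate 2 D n) /dilate.
case: (posnP n) => [->|n_gt0];
  first by rewrite /eta_conv big_geq // mulr0 subr0.
rewrite eta_conv_divisor_sum // /dilate /D; case: n n_gt0 => // n _.
case: ifP => n_even; last by rewrite !mulr0 !subr0.
have : (0 < n.+1 %/ 2)%N by move: n_even; clear; lia.
by case: (_ %/ 2)%N => // m _; rewrite intrB intrM.
Qed.

Lemma sum_form_count_divisor_sum reps : class_representatives k reps ->
  \sum_(ab <- reps) (fun n => (form_count (norm_form k ab) n)%:~R) =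
  constant_term (size reps)%:R + 2 *: D.
Proof.
move=> reps_classes; apply/funext => n.
rewrite fct_sumE -rmorph_sum -[RHS]/(constant_term _ n + 2 * D n) /=.
case: n => [|n].
  rewrite /D mulr0 addr0 /= [RHS]pmulrn; congr (_%:~R).
  rewrite big_seq (eq_bigr (fun=> 1)) => [|ab ab_in]; last first.
    by rewrite form_count0 // pos_def_norm_form // (reps_hnf reps_classes).
  by rewrite -big_seq big_const_seq count_predT iter_addr addr0 natz.
rewrite sum_form_count // (ideal_count_divisor_sum _ _ chi_splitting) //.
  by rewrite intrM add0r.
exact: ltnW.
Qed.

Lemma class_number_L_at0 : h%:R = L_at0 disc chiR.
Proof.
have [reps reps_classes <-] := class_representatives_exist k_gt1 disc_sqfree.
set hR := (size reps)%:R; set L := L_at0 _ _.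
pose r ab : R^nat := fun n => (form_count (norm_form k ab) n)%:~R.
have sum_r0 : has_abel_sum (\sum_(ab <- reps) (r ab - 4 *: dilate 4 (r ab)))
    (\sum_(ab <- reps) 0).
  apply: has_abel_sum_sum => ab ab_in; apply: has_abel_sum_form_count.
  by rewrite pos_def_norm_form // (reps_hnf reps_classes).
have sum_e := has_abel_sum_eta_conv_character.
have sum_e2 := has_abel_sumD sum_e
  (has_abel_sumZ 2 (has_abel_sum_dilate (isT : (0 < 2)%N) sum_e)).
have := has_abel_sumD (has_abel_sum_constant_term (- 3 * hR))
  (has_abel_sumZ 2 sum_e2).
rewrite (_ : _ + _ = \sum_(ab <- reps) (r ab - 4 *: dilate 4 (r ab))).
  by move/(has_abel_sum_unique sum_r0); rewrite big1 // -/L; lra.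
rewrite sumrB -scaler_sumr -linear_sum sum_form_count_divisor_sum //= -/hR.
have dilate_r : dilate 4 (constant_term hR + 2 *: D) =
    constant_term hR + 2 *: dilate 4 D.
  by rewrite linearD linearZ /= dilate_constant_term.
have dilate_e : dilate 2 (D - 2 *: dilate 2 D) = dilate 2 D - 2 *: dilate 4 D.
  by rewrite linearB linearZ /= dilate_dilate.
rewrite eta_conv_character dilate_e dilate_r; apply/funext => n.
rewrite -[LHS]/(constant_term _ n + 2 * (D n - 2 * dilate 2 D n +
  2 * (dilate 2 D n - 2 * dilate 4 D n))).
rewrite -[RHS]/(constant_term _ n + 2 * D n -
  4 * (constant_term _ n + 2 * dilate 4 D n)).
by case: n => [|n]; rewrite /constant_term; ring.
Qed.

Lemma class_number_formula :
  disc%:Z * h%:Z = - \sum_(r < disc) (r : nat)%:Z * chi r.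
Proof.
have disc_neq0 : disc%:R != 0 :> R by rewrite pnatr_eq0; move: k_gt1; lia.
apply/eqP; rewrite -(eqr_int R) intrM -!pmulrn class_number_L_at0 /L_at0.
rewrite mulrC divfK // rmorphN rmorph_sum; apply/eqP; congr (- _).
by apply: eq_bigr => r _; rewrite /= intrM -pmulrn.
Qed.

End ClassNumberFormula.

(** * Character sums over subintervals *)

Lemma modn_mul_inj d m r s : coprime d m -> (r < d)%N -> (s < d)%N ->
  (m * r = m * s %[mod d])%N -> r = s.
Proof.
move=> co_dm; wlog le_rs : r s / (r <= s)%N => [sym r_lt s_lt eq_rs|].
  by case: (leqP r s) => [|/ltnW] le_sr; [exact: sym | apply/esym; exact: sym].
move=> _ s_lt /esym/eqP; rewrite eqn_mod_dvd ?leq_mul2l ?le_rs ?orbT //.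
rewrite -mulnBr Gauss_dvdr // => d_sub; apply/eqP; rewrite eqn_leq le_rs.
rewrite -subn_eq0; case: posnP => // sub_gt0; have := dvdn_leq sub_gt0 d_sub.
by move: s_lt; clear; lia.
Qed.

Definition interval_index (d b r : nat) : nat := ((b * r) %/ d)%N.

Section IntervalIndex.
Variables d b : nat.
Hypothesis d_gt0 : (0 < d)%N.

Local Notation index := (interval_index d).

Lemma interval_index_lt r : (0 < b)%N -> (r < d)%N -> (index b r < b)%N.
Proof. by move=> b_gt0 r_lt; rewrite ltn_divLR // ltn_pmul2l. Qed.

Lemma interval_index_divn N r : (0 < N)%N ->
  (index (N * b) r %/ N = index b r)%N.
Proof.
by move=> N_gt0; rewrite /interval_index -divnMA (mulnC d) -mulnA divnMl.
Qed.

Lemma interval_index_mul N r : (0 < b)%N ->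
  index b ((N * r) %% d) = (index (N * b) r %% b)%N.
Proof.
move=> b_gt0; rewrite /interval_index [(N * b)%N]mulnC -mulnA.
have -> : (b * (N * r) = ((N * r) %/ d * b) * d + b * ((N * r) %% d))%N.
  by rewrite {1}(divn_eq (N * r) d) mulnDr mulnA (mulnC b) mulnAC.
rewrite divnMDl // modnMDl [RHS]modn_small //.
by rewrite ltn_divLR // ltn_pmul2l // ltn_mod.
Qed.

Hypothesis co_db : coprime d b.

Lemma interval_index_reflect r : (0 < r < d)%N ->
  index b (d - r) = (b.-1 - index b r)%N.
Proof.
move=> /andP[r_gt0 r_lt]; rewrite /interval_index.
have mod_gt0 : (0 < (b * r) %% d)%N.
  by rewrite lt0n -/(d %| _)%N Gauss_dvdr // gtnNdvd.
have mod_lt : ((b * r) %% d < d)%N by rewrite ltn_mod.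
have := divn_eq (b * r) d; move: (_ %/ d)%N (_ %% d)%N mod_gt0 mod_lt.
move=> q t t_gt0 t_lt brE.
have lt_q : (q < b)%N.
  by move: brE r_lt t_gt0; clear; nia.
have -> : (b * (d - r) = (b.-1 - q) * d + (d - t))%N.
  have [u bE] : exists u, b = (q + u).+1 by exists (b - q.+1)%N; lia.
  rewrite bE /= addKn mulnBr -bE brE bE; move: t_lt; clear; nia.
by rewrite divnMDl // divn_small ?addn0 // ltn_subrL t_gt0.
Qed.

Lemma interval_index_ltE r i : (0 < r < d)%N -> (i < b)%N ->
  (index b r < i)%N = (r <= (i * d) %/ b)%N.
Proof.
move=> /andP[r_gt0 r_lt] lt_i; have b_gt0 := leq_ltn_trans (leq0n _) lt_i.
rewrite ltn_divLR // leq_divRL // mulnC [RHS]leq_eqVlt; case: eqP => // rbE.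
by have := gtnNdvd r_gt0 r_lt;
  rewrite -(Gauss_dvdr _ co_db) mulnC rbE dvdn_mull.
Qed.

End IntervalIndex.

Section IntervalSums.
Variable p : nat.
Hypotheses (p_prime : prime p) (p_mod4 : (p %% 4 = 3)%N).

Local Notation chi := (legendre p).
Local Notation index := (interval_index p).

Let p_odd : odd p. Proof. by move: p_mod4; clear; lia. Qed.
Let p_gt0 : (0 < p)%N. Proof. exact: prime_gt0. Qed.

Lemma legendre_odd : odd_character p chi.
Proof.
split=> [n|r le_r]; first exact: legendreD.
have subE : ((p - r)%:R : 'F_p) = - r%:R.
  by rewrite natrB // -[RHS]add0r; congr (_ - _); apply/eqP; rewrite Fp_nat_eq0.
rewrite /legendre subE oppr_eq0; case: eqP => [//|/eqP r_neq0].
by rewrite qresN // qnonresE //; case: qres.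
Qed.

Definition interval_sum (b j : nat) : int :=
  \sum_(r < p) chi r * (index b r == j : nat)%:Z.

Lemma sum_interval_index b (G : nat -> int) : (0 < b)%N ->
  \sum_(r < p) chi r * G (index b r) = \sum_(j < b) G j * interval_sum b j.
Proof.
move=> b_gt0; under [RHS]eq_bigr => j _ do rewrite mulr_sumr.
rewrite exchange_big; apply: eq_bigr => r _.
have idx_lt := interval_index_lt p_gt0 b_gt0 (ltn_ord r).
rewrite (bigD1 (Ordinal idx_lt)) //= eqxx mulr1 mulrC big1 ?addr0 // => j.
by rewrite -val_eqE /= eq_sym => /negPf ->; rewrite !mulr0.
Qed.

Lemma interval_sum_reflect b j : coprime p b -> (j < b)%N ->
  interval_sum b (b.-1 - j) = - interval_sum b j.
Proof.
move=> co_pb lt_j; pose F r := chi r * (index b r == (b.-1 - j)%N : nat)%:Z.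
have chi_0 : chi 0%N = 0 by exact: legendre0.
have chi_p : chi p = 0 by apply/eqP; rewrite legendre_eq0.
rewrite -[LHS](@sum_reflect _ p F); last by rewrite /F chi_0 chi_p !mul0r.
rewrite -sumrN; apply: eq_bigr => r _; rewrite /F.
rewrite (chi_reflect legendre_odd) ?(ltnW (ltn_ord r)) // mulNr; congr (- _).
case: (posnP r) => [->|r_gt0]; first by rewrite chi_0 !mul0r.
rewrite interval_index_reflect ?r_gt0 ?ltn_ord //.
congr (_ * (nat_of_bool _)%:Z).
have := interval_index_lt p_gt0 (leq_ltn_trans (leq0n j) lt_j) (ltn_ord r).
by move: (index b r) lt_j; clear; lia.
Qed.

Lemma interval_sum_coarsen N b i : (0 < N)%N -> (0 < b)%N ->
  interval_sum b i = \sum_(j < N * b | (j %/ N)%N == i) interval_sum (N * b) j.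
Proof.
move=> N_gt0 b_gt0; rewrite big_mkcond /=.
transitivity
  (\sum_(j < N * b) ((j %/ N)%N == i : nat)%:Z * interval_sum (N * b) j).
  rewrite -(sum_interval_index (fun j => ((j %/ N)%N == i : nat)%:Z)).
    by apply: eq_bigr => r _; rewrite interval_index_divn.
  by rewrite muln_gt0 N_gt0.
by apply: eq_bigr => j _; case: eqP => _; rewrite ?mul1r ?mul0r.
Qed.

Section Multiplier.
Variable N : nat.
Hypothesis p_N : ~~ (p %| N)%N.

Let N_gt0 : (0 < N)%N. Proof. by case: N p_N => //; rewrite dvdn0. Qed.

Lemma sum_legendre_mul (G : nat -> int) :
  \sum_(r < p) chi r * G r = chi N * \sum_(r < p) chi r * G ((N * r) %% p)%N.
Proof.
pose mul_N (r : 'I_p) : 'I_p := Ordinal (ltn_pmod (N * r) p_gt0).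
have mul_N_inj : injective mul_N.
  move=> r s /(congr1 val) /= eq_rs.
  apply/val_inj/(modn_mul_inj _ _ _ eq_rs) => //.
  by rewrite prime_coprime.
rewrite (reindex_inj mul_N_inj) mulr_sumr; apply: eq_bigr => r _ /=.
by rewrite legendre_modn // legendreM // mulrA.
Qed.

(* The permutation [r |-> N r] of the residues turns [\sum r chi r] into
   [chi N] times itself, and [N r] is [p * index N r] plus a residue. *)
Lemma weighted_interval_sum :
  p%:Z * (\sum_(i < N) (i : nat)%:Z * interval_sum N i) =
  (N%:Z - chi N) * \sum_(r < p) (r : nat)%:Z * chi r.
Proof.
have sum_mod : \sum_(r < p) chi r * ((N * r) %% p)%N%:Z =
    chi N * \sum_(r < p) (r : nat)%:Z * chi r.
  under [in RHS]eq_bigr => r _ do rewrite mulrC.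
  by rewrite (sum_legendre_mul (fun r => r%:Z)) mulrA legendre_sqr // mul1r.
rewrite -(sum_interval_index (fun i => i%:Z)) // mulrBl -sum_mod.
rewrite !mulr_sumr -sumrB.
apply: eq_bigr => r _ /=.
have -> : N%:Z * (r%:Z * chi r) = chi r * (N * r)%N%:Z.
  by rewrite PoszM; ring.
by rewrite {1}(divn_eq (N * r) p) PoszD PoszM /interval_index; ring.
Qed.

Lemma interval_sum_mul b i : (0 < b)%N ->
  interval_sum b i =
    chi N * \sum_(j < N * b | (j %% b)%N == i) interval_sum (N * b) j.
Proof.
move=> b_gt0; rewrite {1}/interval_sum.
rewrite (sum_legendre_mul (fun r => (index b r == i : nat)%:Z)); congr (_ * _).
under eq_bigr => r _ do rewrite interval_index_mul //.
rewrite (sum_interval_index (fun j => ((j %% b)%N == i : nat)%:Z)); last first.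
  by rewrite muln_gt0 N_gt0.
by rewrite [RHS]big_mkcond; apply: eq_bigr => j _; case: eqP;
  rewrite ?mul1r ?mul0r.
Qed.

End Multiplier.
End IntervalSums.

(** * Class numbers as interval sums *)

Lemma root_count_modl k a : root_count (k %% a) a = root_count k a.
Proof.
rewrite /root_count /roots_mod; congr size; apply: eq_filter => b.
by rewrite /root_mod /omega_norm /dvdn modnDmr.
Qed.

Lemma square_free_prime p : prime p -> square_free p.
Proof.
move=> p_prime q q_prime; apply/negP => q2_p.
have : (q %| p)%N by apply: dvdn_trans q2_p; rewrite dvdn_exp.
rewrite dvdn_prime2 // => /eqP q_p; move: q2_p (prime_gt1 p_prime).
by rewrite q_p => /(dvdn_leq (prime_gt0 p_prime)); clear; nia.
Qed.

Lemma square_free_mul_primes p q : prime p -> prime q -> p != q ->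
  square_free (p * q).
Proof.
move=> p_prime q_prime p_neq l l_prime; apply/negP => l2_pq.
have : (l %| p * q)%N by apply: dvdn_trans l2_pq; rewrite dvdn_exp.
rewrite Euclid_dvdM // !dvdn_prime2 // => /orP[] /eqP lE; move: l2_pq;
  rewrite lE -mulnn.
  by rewrite dvdn_pmul2l ?prime_gt0 // dvdn_prime2 // (negPf p_neq).
by rewrite dvdn_pmul2r ?prime_gt0 // dvdn_prime2 // eq_sym (negPf p_neq).
Qed.

Lemma crt_bijective m n (mn_gt0 : (0 < m * n)%N) : coprime m n ->
  bijective (fun uv : 'I_m * 'I_n =>
    Ordinal (ltn_pmod (n * uv.1 + m * uv.2) mn_gt0)).
Proof.
move=> co_mn; apply: inj_card_bij; last by rewrite card_prod !card_ord.
move=> [u v] [u' v'] /(congr1 val) /= eq_crt; congr (_, _); apply: val_inj.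
  apply: (modn_mul_inj co_mn (ltn_ord u) (ltn_ord u')).
  have := congr1 (modn^~ m) eq_crt; rewrite !modn_dvdm ?dvdn_mulr //.
  by rewrite ![(n * _ + _)%N]addnC !(mulnC m) !modnMDl.
rewrite coprime_sym in co_mn.
apply: (modn_mul_inj co_mn (ltn_ord v) (ltn_ord v')).
have := congr1 (modn^~ n) eq_crt; rewrite !modn_dvdm ?dvdn_mull //.
by rewrite !(mulnC n) !modnMDl.
Qed.

Section ClassNumbers.
Variables (R : realType) (p : nat).
Hypotheses (p_prime : prime p) (p_mod4 : (p %% 4 = 3)%N) (p_gt3 : (3 < p)%N).

Local Notation chi := (legendre p).
Local Notation h1 := (class_number (quadratic_field (- p%:Z))).
Local Notation h2 := (class_number (quadratic_field (- (5 * p)%N%:Z))).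
Local Notation tenth_sum := (interval_sum p 10).

Let p_odd : odd p. Proof. by move: p_mod4; clear; lia. Qed.
Let p_gt0 : (0 < p)%N. Proof. exact: prime_gt0. Qed.
Let p_neq5 : p != 5%N. Proof. by apply: contra_eqN p_mod4 => /eqP ->. Qed.
Let five_prime : prime 5. Proof. by []. Qed.

Lemma legendre_splitting : splitting_character ((p + 1) %/ 4) chi.
Proof.
split=> [|m n|n|q q_prime|q q_prime].
- exact: legendre1.
- exact: legendreM.
- exact: legendre_sign.
- exact: root_count_legendre.
rewrite legendre_eq0 // (_ : 4 * _ - 1 = p)%N; last by move: p_mod4; clear; lia.
by rewrite !dvdn_prime2 // eq_sym.
Qed.

Lemma chi5p_splitting : splitting_character ((5 * p + 1) %/ 4) (chi5p p).
Proof.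
split=> [|m n|n|q q_prime|q q_prime].
- by rewrite /chi5p !legendre1.
- by rewrite /chi5p !legendreM // mulrACA.
- by rewrite /chi5p; case/or3P: (legendre_sign 5 n) => /eqP ->;
    case/or3P: (legendre_sign p n) => /eqP ->.
- exact: root_count_chi5p.
rewrite (_ : 4 * _ - 1 = 5 * p)%N; last by move: p_mod4; clear; lia.
by rewrite /chi5p mulf_eq0 !legendre_eq0 // Euclid_dvdM // !dvdn_prime2 //
  ![_ == q]eq_sym.
Qed.

Lemma legendre5_reflect r : (r <= 5 * p)%N ->
  legendre 5 (5 * p - r) = legendre 5 r.
Proof.
move=> le_r; rewrite !legendre5E.
have -> : ((5 * p - r) %% 5 = nth 0 [:: 0; 4; 3; 2; 1] (r %% 5))%N.
  have := ltn_pmod r (isT : (0 < 5)%N); move: le_r; rewrite {1 3}(divn_eq r 5).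
  by move: (r %/ 5)%N; case: (r %% 5)%N => [|[|[|[|[|i]]]]] t //=; lia.
have := ltn_pmod r (isT : (0 < 5)%N).
by case: (r %% 5)%N => [|[|[|[|[|i]]]]].
Qed.

Lemma chi5p_odd : odd_character (5 * p) (chi5p p).
Proof.
split=> [n|r le_r]; rewrite /chi5p.
  rewrite -[legendre 5 (_ + n)]legendre_modn // -[chi (_ + n)]legendre_modn //.
  by rewrite modnMDl mulnC modnMDl !legendre_modn.
rewrite legendre5_reflect // -mulrN; congr (_ * _).
have le_mod : (r %% p <= p)%N by rewrite ltnW // ltn_mod.
rewrite -[in RHS]legendre_modn //
  -(chi_reflect (legendre_odd p_prime p_mod4)) //.
rewrite -[LHS]legendre_modn // -[RHS]legendre_modn //; congr (chi _); apply/eqP.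
rewrite -(eqn_modDr r) subnK // modnMl.
by rewrite {2}(divn_eq r p) addnCA [(p - _ + _)%N]subnK // -mulSnr modnMl.
Qed.

Lemma class_number_legendre :
  p%:Z * h1%:Z = - \sum_(r < p) (r : nat)%:Z * chi r.
Proof.
have discE : (4 * ((p + 1) %/ 4) - 1 = p)%N by move: p_mod4; clear; lia.
have := @class_number_formula R _ _ _ _ legendre_splitting.
rewrite discE; apply.
- by move: discE p_gt3; clear; lia.
- exact: square_free_prime.
- exact: legendre_odd.
Qed.

Lemma class_number_chi5p :
  (5 * p)%N%:Z * h2%:Z = - \sum_(r < 5 * p) (r : nat)%:Z * chi5p p r.
Proof.
have discE : (4 * ((5 * p + 1) %/ 4) - 1 = 5 * p)%N by move: p_mod4; clear; lia.
have := @class_number_formula R _ _ _ _ chi5p_splitting; rewrite discE; apply.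
- by move: discE p_gt3; clear; lia.
- by apply: square_free_mul_primes => //; rewrite eq_sym.
- exact: chi5p_odd.
Qed.

Lemma weighted_interval_sum_class_number N : ~~ (p %| N)%N ->
  \sum_(i < N) (i : nat)%:Z * interval_sum p N i = (chi N - N%:Z) * h1%:Z.
Proof.
move=> p_N; have p_neq0 : p%:Z != 0 by move: p_gt0; clear; lia.
apply: (mulfI p_neq0).
rewrite weighted_interval_sum // mulrCA class_number_legendre.
by ring.
Qed.

Lemma legendre_2 : chi 2 = if (p %% 8 == 3)%N then -1 else 1.
Proof.
have := root_count_legendre p_prime p_mod4 (isT : prime 2).
set k := ((p + 1) %/ 4)%N.
have -> : (root_count k 2 = if odd k then 0 else 2)%N.
  by rewrite -root_count_modl modn2; case: odd.
have -> : odd k = (p %% 8 == 3)%N by rewrite /k; move: p_mod4; clear; lia.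
by case: ifP => _; lia.
Qed.

Lemma legendre_5_reciprocity : chi 5 = legendre 5 p.
Proof.
have := root_count_legendre p_prime p_mod4 five_prime.
set k := ((p + 1) %/ 4)%N.
have pE : p = (4 * k - 1)%N by rewrite /k; move: p_mod4; clear; lia.
have k_gt0 : (0 < k)%N by rewrite /k; move: p_mod4; clear; lia.
have p_mod5 : (p %% 5 != 0)%N by rewrite -/(5 %| p)%N dvdn_prime2 // eq_sym.
have divE := divn_eq k 5; have mod_lt : (k %% 5 < 5)%N by rewrite ltn_mod.
have countE : root_count k 5 = nth 0%N [:: 2; 0; 0; 2; 1]%N (k %% 5).
  by rewrite -root_count_modl; case: (k %% 5)%N mod_lt => [|[|[|[|[|i]]]]].
have modE : (p %% 5 = nth 0 [:: 4; 3; 2; 1; 0] (k %% 5))%N.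
  rewrite pE; move: k_gt0; rewrite divE.
  move: (k %/ 5)%N (k %% 5)%N mod_lt => t i.
  by case: i => [|[|[|[|[|i]]]]] //= _; rewrite modnMDl /=; lia.
rewrite legendre5E modE countE in p_mod5 *; move: mod_lt p_mod5.
by case: (k %% 5)%N => [|[|[|[|[|i]]]]] //= _ _; lia.
Qed.

Lemma chi5p_crt u v :
  chi5p p ((5 * u + p * v) %% (p * 5)) = chi u * legendre 5 v.
Proof.
rewrite /chi5p -[legendre 5 _]legendre_modn // -[chi (_ %% _)]legendre_modn //.
rewrite (modn_dvdm _ (dvdn_mull p (dvdnn 5)))
  (modn_dvdm _ (dvdn_mulr 5 (dvdnn p))).
rewrite !legendre_modn //.
have -> : legendre 5 (5 * u + p * v) = legendre 5 p * legendre 5 v.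
  by rewrite -legendre_modn // mulnC modnMDl legendre_modn // legendreM.
have -> : chi (5 * u + p * v) = chi 5 * chi u.
  by rewrite -legendre_modn // addnC mulnC modnMDl legendre_modn // legendreM.
have sqr_chi5 : chi 5 * chi 5 = 1 by apply: legendre_sqr; rewrite ?dvdn_prime2.
by rewrite -legendre_5_reciprocity mulrACA sqr_chi5 mul1r mulrC.
Qed.

Lemma modn_crtE u v : ((5 * u + p * v) %% (p * 5))%N%:Z =
  5 * u%:Z + p%:Z * v%:Z - 5 * p%:Z * ((interval_index p 5 u + v) %/ 5)%N%:Z.
Proof.
have -> : ((interval_index p 5 u + v) %/ 5 = (5 * u + p * v) %/ (p * 5))%N.
  rewrite divnMA (_ : 5 * u + p * v = v * p + 5 * u)%N; last by clear; lia.
  by rewrite divnMDl // [in RHS]addnC.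
have := divn_eq (5 * u + p * v) (p * 5).
by move: (_ %/ _)%N (_ %% _)%N => a b; clear; lia.
Qed.

Lemma sum_chi5p : \sum_(r < 5 * p) (r : nat)%:Z * chi5p p r =
  - ((5 * p)%N%:Z * (2 * interval_sum p 5 1)).
Proof.
have p5_gt0 : (0 < p * 5)%N by rewrite muln_gt0 p_gt0.
have co_p5 : coprime p 5 by rewrite prime_coprime // dvdn_prime2.
pose carry i v := ((i + v) %/ 5)%N%:Z.
pose G i := carry i 1%N - carry i 2%N - carry i 3%N + carry i 4%N.
rewrite mulnC (reindex _ (onW_bij _ (crt_bijective p5_gt0 co_p5))) /=.
rewrite -(pair_bigA _ (fun (u : 'I_p) (v : 'I_5) =>
  ((5 * u + p * v) %% (p * 5))%N%:Z * chi5p p ((5 * u + p * v) %% (p * 5)))) /=.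
transitivity (- ((p * 5)%N%:Z * \sum_(u < p) chi u * G (interval_index p 5 u))).
  rewrite mulr_sumr -sumrN; apply: eq_bigr => u _.
  under eq_bigr => v _ do rewrite chi5p_crt modn_crtE.
  rewrite !big_ord_recr big_ord0 /= !legendre5E /= PoszM /G /carry.
  ring.
have reflect i : (i < 5)%N -> interval_sum p 5 (4 - i) = - interval_sum p 5 i.
  exact: interval_sum_reflect.
have G_val i : (i < 5)%N -> G i = nth 0 [:: 0; 1; 0; -1; 0] i.
  by case: i => [|[|[|[|[|i]]]]].
rewrite sum_interval_index //; under eq_bigr => i _ do rewrite G_val //.
rewrite !big_ord_recr big_ord0 /= (reflect 1%N isT).
by rewrite !mul0r !mul1r !addr0 !add0r mulN1r opprK mulr_natl mulr2n mulnC.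
Qed.

Lemma class_number_fifth : h2%:Z = 2 * interval_sum p 5 1.
Proof.
have p5_neq0 : (5 * p)%N%:Z != 0 by move: p_gt0; clear; lia.
by apply: (mulfI p5_neq0); rewrite class_number_chi5p sum_chi5p opprK.
Qed.

Lemma coprime_10 : coprime p 10.
Proof.
rewrite (@coprimeMr p 2 5) !prime_coprime // !dvdn_prime2 //.
by rewrite p_neq5 andbT; apply: contra_eqN p_mod4 => /eqP ->.
Qed.

Lemma tenth_sum_reflect i : (i < 10)%N -> tenth_sum (9 - i) = - tenth_sum i.
Proof. exact: interval_sum_reflect coprime_10. Qed.

Lemma upper_half_sum : interval_sum p 2 1 =
  tenth_sum 5 + tenth_sum 6 + tenth_sum 7 + tenth_sum 8 + tenth_sum 9.
Proof.
rewrite (@interval_sum_coarsen p p_prime 5) // big_mkcond.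
by rewrite !big_ord_recr big_ord0 /= !add0r.
Qed.

Lemma fifth_sum_coarsen i : (i < 5)%N ->
  interval_sum p 5 i = tenth_sum (2 * i) + tenth_sum (2 * i + 1).
Proof.
move=> lt_i; rewrite (@interval_sum_coarsen p p_prime 2) // big_mkcond.
rewrite !big_ord_recr big_ord0; case: i lt_i => [|[|[|[|[|i]]]]] // _ /=;
  by rewrite ?addr0 ?add0r.
Qed.

Lemma fifth_sum_mul i : (i < 5)%N ->
  interval_sum p 5 i = chi 2 * (tenth_sum i + tenth_sum (i + 5)).
Proof.
have p_2 : ~~ (p %| 2)%N by rewrite gtnNdvd // ltnW.
move=> lt_i; rewrite (@interval_sum_mul p p_prime p_mod4 2) // big_mkcond.
congr (_ * _); rewrite !big_ord_recr big_ord0.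
by case: i lt_i => [|[|[|[|[|i]]]]] // _ /=; rewrite ?addr0 ?add0r ?addr0.
Qed.

(* [h1] is computed from halves and from fifths, and [chi 2] relates the fifths
   to the tenths. *)
Lemma tenth_sum_equations (s := tenth_sum) :
  [/\ s 0 + s 1 + s 2 + s 3 + s 4 = (2 - chi 2) * h1%:Z,
      4 * (s 0 + s 1) + 2 * (s 2 + s 3) = (5 - chi 5) * h1%:Z,
      s 0 + s 1 = chi 2 * (s 0 - s 4),
      s 2 + s 3 = chi 2 * (s 1 - s 3) &
      h2%:Z = 2 * (s 2 + s 3)].
Proof.
have s5 : s 5%N = - s 4%N by rewrite -tenth_sum_reflect.
have s6 : s 6%N = - s 3%N by rewrite -tenth_sum_reflect.
have s7 : s 7%N = - s 2%N by rewrite -tenth_sum_reflect.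
have s8 : s 8%N = - s 1%N by rewrite -tenth_sum_reflect.
have s9 : s 9%N = - s 0%N by rewrite -tenth_sum_reflect.
have p_2 : ~~ (p %| 2)%N by rewrite gtnNdvd // ltnW.
have p_5 : ~~ (p %| 5)%N by rewrite dvdn_prime2.
have sums2 := weighted_interval_sum_class_number p_2.
have sums5 := weighted_interval_sum_class_number p_5.
rewrite !big_ord_recr big_ord0 /= upper_half_sum -/s s5 s6 s7 s8 s9 in sums2.
have fifth0 : interval_sum p 5 0 = s 0%N + s 1%N by exact: fifth_sum_coarsen.
have fifth1 : interval_sum p 5 1 = s 2%N + s 3%N by exact: fifth_sum_coarsen.
have fifth2 : interval_sum p 5 2 = s 4%N + s 5%N by exact: fifth_sum_coarsen.
have fifth3 : interval_sum p 5 3 = s 6%N + s 7%N by exact: fifth_sum_coarsen.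
have fifth4 : interval_sum p 5 4 = s 8%N + s 9%N by exact: fifth_sum_coarsen.
rewrite !big_ord_recr big_ord0 /= fifth1 fifth2 fifth3 fifth4 in sums5.
rewrite s5 s6 s7 s8 s9 in sums5.
split.
- by rewrite -[RHS]opprK -mulNr opprB -sums2; ring.
- by rewrite -[RHS]opprK -mulNr opprB -sums5; ring.
- by rewrite -s5 -fifth0 -fifth_sum_mul.
- by rewrite -s6 -fifth1 -fifth_sum_mul.
- by rewrite class_number_fifth fifth1.
Qed.

Lemma delta_tenth_sum k : chi 10 = 1 -> (k <= 4)%N ->
  delta p h1%:R h2%:R k = (tenth_sum k)%:~R.
Proof.
move=> chi10 le_k; have chi_25 : chi 2 * chi 5 = 1 by rewrite -legendreM.
have chi5E : chi 5 = chi 2.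
  by move: chi_25; rewrite legendre_2; case: ifP => _; clear; lia.
have := tenth_sum_equations; rewrite chi5E legendre_2 /delta.
have toQ (x y : int) : x = y -> x%:~R = y%:~R :> rat by move=> ->.
case: ifP => _ [/toQ half /toQ fifth /toQ double0 /toQ double1 /toQ h2E];
  by case: k le_k => [|[|[|[|[|k]]]]] //= _; lra.
Qed.

End ClassNumbers.

(** * Residues in an interval and digits *)

Lemma count_iota_sum (P : pred nat) n :
  (count P (iota 0 n))%:Z = \sum_(r < n) (P r : nat)%:Z.
Proof.
rewrite -{1}[n]subn0 -/(index_iota 0 n) -sum1_count big_mkcond big_mkord.
rewrite (big_morph Posz PoszD (erefl _)).
by apply: eq_bigr => r _; case: (P r).
Qed.

Lemma count_le_iota n x : (x < n)%N ->
  count (fun r => (0 < r <= x)%N) (iota 0 n) = x.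
Proof.
move=> lt_x; rewrite -(subnKC lt_x) iotaD count_cat /=.
rewrite (eq_in_count (a2 := predT)) ?count_predT ?size_iota.
  rewrite (eq_in_count (a2 := pred0)) ?count_pred0 ?addn0 // => r.
  by rewrite mem_iota /=; lia.
by move=> r; rewrite mem_iota /=; lia.
Qed.

Section ResidueCounts.
Variables p b : nat.
Hypotheses (p_prime : prime p) (p_mod4 : (p %% 4 = 3)%N).

Local Notation chi := (legendre p).
Local Notation index := (interval_index p b).

Let p_odd : odd p. Proof. by move: p_mod4; clear; lia. Qed.
Let p_gt0 : (0 < p)%N. Proof. exact: prime_gt0. Qed.

Definition residue_count (j : nat) : nat :=
  count (fun r => (chi r == 1) && (index r == j)) (iota 0 p).

Definition interval_count (j : nat) : nat :=
  count (fun r => (0 < r)%N && (index r == j)) (iota 0 p).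

Lemma legendre_indicator (r : 'I_p) :
  2 * (chi r == 1 : nat)%:Z = ((0 < r)%N : nat)%:Z + chi r.
Proof.
case: (posnP r) => [->|r_gt0]; first by rewrite legendre0.
have : chi r != 0 by rewrite legendre_eq0 // gtnNdvd.
by case/or3P: (legendre_sign p r) => /eqP ->.
Qed.

Lemma residue_countE j :
  2 * (residue_count j)%:Z = (interval_count j)%:Z + interval_sum p b j.
Proof.
rewrite /residue_count /interval_count !count_iota_sum mulr_sumr -big_split.
apply: eq_bigr => r _ /=; have := legendre_indicator r.
by case: (index r == j); rewrite ?andbT ?andbF ?mulr1 ?mulr0.
Qed.

Lemma card_residues : (size [seq r <- iota 0 p | chi r == 1] = (p.-1)./2)%N.
Proof.
have count_pos : count (fun r => 0 < r)%N (iota 0 p) = p.-1.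
  rewrite -[RHS](@count_le_iota p) ?ltn_predL //.
  by apply: eq_in_count => r; rewrite mem_iota; move: p_gt0; clear; lia.
apply/double_inj; rewrite even_halfK; last by move: p_odd; clear; lia.
apply/eqP; rewrite -eqz_nat size_filter -mul2n PoszM count_iota_sum mulr_sumr.
under eq_bigr => r _ do rewrite legendre_indicator.
rewrite big_split /= (odd_character_sum (legendre_odd p_prime p_mod4)) addr0.
by rewrite -count_iota_sum count_pos.
Qed.

Hypothesis co_pb : coprime p b.

Lemma interval_count_reflect j : (j < b)%N ->
  interval_count (b.-1 - j) = interval_count j.
Proof.
move=> lt_j; have b_gt0 := leq_ltn_trans (leq0n j) lt_j.
apply/eqP; rewrite -eqz_nat !count_iota_sum.
pose F r := ((0 < r < p)%N && (index r == (b.-1 - j)%N) : nat)%:Z.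
transitivity (\sum_(r < p) F (p - r)%N ==
    \sum_(r < p) ((0 < r)%N && (index r == j) : nat)%:Z).
  rewrite sum_reflect /F ?ltnn ?andbF //; congr (_ == _); apply: eq_bigr => r _.
  by rewrite ltn_ord andbT.
apply/eqP/eq_bigr => r _; rewrite /F.
case: (posnP r) => [->|r_gt0]; first by rewrite subn0 ltnn andbF.
have r_lt := ltn_ord r; rewrite interval_index_reflect ?r_gt0 ?r_lt //.
have := interval_index_lt p_gt0 b_gt0 r_lt.
by move: (index r) lt_j r_gt0 r_lt; clear; lia.
Qed.

Lemma interval_countE j : (j.+1 < b)%N ->
  (interval_count j)%:Z = ((j.+1 * p) %/ b)%N%:Z - ((j * p) %/ b)%N%:Z.
Proof.
move=> lt_j; have lt_p i : (i < b)%N -> ((i * p) %/ b < p)%N.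
  by move=> lt_i; rewrite ltn_divLR ?(leq_ltn_trans _ lt_i) // mulnC ltn_pmul2l.
rewrite -{1}(count_le_iota (lt_p _ lt_j))
  -{1}(count_le_iota (lt_p _ (ltnW lt_j))).
rewrite !count_iota_sum -sumrB; apply: eq_bigr => r _.
case: (posnP r) => [->|r_gt0] //=.
rewrite -!(interval_index_ltE p_gt0 co_pb) ?r_gt0 ?ltn_ord //; last exact: ltnW.
by move: (index r); clear; lia.
Qed.

End ResidueCounts.

Section PowerOrbit.
Variables p b m : nat.
Hypotheses (p_prime : prime p) (p_mod4 : (p %% 4 = 3)%N).
Hypothesis ord_b : ((p.-1)./2).-primitive_root (b%:R : 'F_p).
Hypothesis m_qr : legendre p m = 1.

Local Notation chi := (legendre p).

Let p_odd : odd p. Proof. by move: p_mod4; clear; lia. Qed.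
Let p_gt0 : (0 < p)%N. Proof. exact: prime_gt0. Qed.

Definition power_orbit (j : nat) : nat := ((b ^ j * m) %% p)%N.

Lemma legendre_primitive : chi b = 1.
Proof.
have b_unit : (b%:R : 'F_p) != 0.
  apply/eqP => b0; have := prim_expr_order ord_b; rewrite b0 expr0n.
  by rewrite eqn0Ngt half_pred_gt0 //= => /eqP; rewrite eq_sym oner_eq0.
by rewrite /legendre (negPf b_unit) /qres (prim_expr_order ord_b) eqxx.
Qed.

Lemma legendre_power_orbit j : chi (b ^ j * m) = 1.
Proof.
elim: j => [|j IHj]; first by rewrite mul1n.
by rewrite expnS -mulnA legendreM // legendre_primitive mul1r.
Qed.

Lemma perm_power_orbit : perm_eq [seq power_orbit j | j <- iota 0 (p.-1)./2]
  [seq r <- iota 0 p | chi r == 1].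
Proof.
have uniq_orbit : uniq [seq power_orbit j | j <- iota 0 (p.-1)./2].
  have m_unit : (m%:R : 'F_p) != 0.
    by rewrite Fp_nat_eq0 // -legendre_eq0 // m_qr.
  rewrite map_inj_in_uniq ?iota_uniq // => i j.
  rewrite !mem_iota !add0n => /andP[_ lt_i] /andP[_ lt_j] eq_orbit.
  have : (b%:R : 'F_p) ^+ i * m%:R = b%:R ^+ j * m%:R.
    rewrite -!natrX -!natrM -[LHS]natr_Zp -[RHS]natr_Zp !val_Fp_nat //.
    by congr (_%:R); exact: eq_orbit.
  move/(mulIf m_unit)/eqP.
  by rewrite (eq_prim_root_expr ord_b) !modn_small // => /eqP.
have sub_residues : {subset [seq power_orbit j | j <- iota 0 (p.-1)./2]
    <= [seq r <- iota 0 p | chi r == 1]}.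
  move=> r /mapP[j _ ->]; rewrite mem_filter mem_iota ltn_mod p_gt0 andbT.
  by rewrite legendre_modn // legendre_power_orbit.
have [|_ eq_mem] := uniq_min_size uniq_orbit sub_residues.
  by rewrite size_map size_iota card_residues.
by apply: uniq_perm => //; rewrite filter_uniq // iota_uniq.
Qed.

Lemma count_power_orbit j :
  count (fun i => interval_index p b (power_orbit i) == j) (iota 0 (p.-1)./2) =
  residue_count p b j.
Proof.
rewrite -(count_map power_orbit (fun r => interval_index p b r == j)).
rewrite (seq.permP perm_power_orbit) count_filter.
by apply: eq_count => r /=; rewrite andbC.
Qed.

End PowerOrbit.

Lemma legendre_quadratic_residue p m : prime p -> odd p -> ~~ (p %| m)%N ->
  (exists x, x ^ 2 = m %[mod p])%N -> legendre p m = 1.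
Proof.
move=> p_prime p_odd p_m [x xE]; have p_x : ~~ (p %| x)%N.
  by apply: contra p_m; rewrite /dvdn -xE => /eqP x0; rewrite -modnXm x0 mod0n.
by rewrite -legendre_modn // -xE legendre_modn // -mulnn legendreM //
  legendre_sqr.
Qed.

Definition base_expansion (R : realType) (b : nat) (x : R) (a : nat -> nat) :
    Prop :=
  (forall j, (0 < j)%N -> (a j < b)%N) /\
  ((fun n : nat => \sum_(1 <= j < n.+1) (a j)%:R / b%:R ^+ j : R)
     @ \oo --> x)%classic.

Section DigitExpansion.
Local Open Scope classical_set_scope.
Local Open Scope ring_scope.
Variables (R : realType) (b : nat) (x : R) (a : nat -> nat).
Hypotheses (b_gt0 : (0 < b)%N) (a_digits : base_expansion b x a).

Let partial_sum (n : nat) : R := \sum_(1 <= j < n.+1) (a j)%:R / b%:R ^+ j.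

Fixpoint digit_prefix (n : nat) : nat :=
  if n is n'.+1 then (b * digit_prefix n' + a n)%N else 0%N.

Lemma partial_sumE n : partial_sum n = (digit_prefix n)%:R / b%:R ^+ n.
Proof.
elim: n => [|n IHn]; first by rewrite /partial_sum big_geq // mul0r.
rewrite /partial_sum big_nat_recr //= -/(partial_sum n) IHn natrD natrM exprS.
have b_neq0 : b%:R != 0 :> R by rewrite pnatr_eq0 -lt0n.
by field; rewrite expf_neq0 ?b_neq0.
Qed.

Lemma digit_prefix_bound n t :
  (digit_prefix n * b ^ t <= digit_prefix (n + t)
     < (digit_prefix n).+1 * b ^ t)%N.
Proof.
elim: t => [|t IHt]; first by rewrite addn0 !muln1 leqnn ltnSn.
have [a_lt _] := a_digits; have := a_lt (n + t).+1 isT.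
rewrite addnS /= expnS; move: IHt.
move: (digit_prefix (n + t)) (a _) (b ^ t)%N (digit_prefix n) => u c B v.
by clear; nia.
Qed.

Lemma digit_prefix_floor n :
  (digit_prefix n)%:R <= b%:R ^+ n * x <= (digit_prefix n).+1%:R.
Proof.
have pow_gt0 i : 0 < b%:R ^+ i :> R by rewrite exprn_gt0 // ltr0n.
have bounds N : (n <= N)%N ->
    (digit_prefix n)%:R <= b%:R ^+ n * partial_sum N <= (digit_prefix n).+1%:R.
  move=> le_N; have := digit_prefix_bound n (N - n).
  rewrite subnKC // => /andP[lo hi].
  have -> : b%:R ^+ n * partial_sum N = (digit_prefix N)%:R / b%:R ^+ (N - n).
    rewrite partial_sumE -[in b%:R ^+ N](subnKC le_N) exprD.
    by field; rewrite !gt_eqF.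
  rewrite ler_pdivlMr // ler_pdivrMr // -!natrX -!natrM !ler_nat lo.
  exact: ltnW.
have cvg_pow : b%:R ^+ n * partial_sum N @[N --> \oo] --> b%:R ^+ n * x.
  by case: a_digits => _ cvg_x; exact: cvgM (cvg_cst _) cvg_x.
rewrite -(cvg_lim _ cvg_pow) //; apply/andP; split.
  by apply: limr_ge; [exact: cvgP cvg_pow | exists n => // N /bounds /andP[]].
by apply: limr_le; [exact: cvgP cvg_pow | exists n => // N /bounds /andP[]].
Qed.

End DigitExpansion.

(* The expansion of [m / p] does not terminate, so the prefixes are the integer
   parts of [b ^ n m / p]. *)
Lemma digit_fraction (R : realType) (b p m : nat) (a : nat -> nat) n :
  (0 < b)%N -> (0 < p)%N -> (forall i, ~~ (p %| b ^ i * m)%N) ->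
  base_expansion b (m%:R / p%:R : R) a ->
  a n.+1 = interval_index p b (power_orbit p b m n).
Proof.
move=> b_gt0 p_gt0 nonterminating a_digits.
have prefixE i : digit_prefix b a i = ((b ^ i * m) %/ p)%N.
  have := digit_prefix_floor b_gt0 a_digits i.
  rewrite mulrA ler_pdivlMr ?ler_pdivrMr ?ltr0n // -natrX -!natrM !ler_nat.
  move=> /andP[lo]; rewrite leq_eqVlt => /orP[/eqP hi|hi].
    by case/negP: (nonterminating i); rewrite hi dvdn_mull.
  apply/eqP; rewrite eqn_leq leq_divRL // lo andTb.
  by rewrite -ltnS ltn_divLR.
have /eqP := prefixE n.+1; rewrite /= prefixE expnS -mulnA.
rewrite {2}(divn_eq (b ^ n * m) p) mulnDr mulnA divnMDl // eqn_add2l.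
by move/eqP.
Qed.

Theorem theorem1 (R : realType) (p m : nat) (a : nat -> nat)
  (p_prime : prime p) (p_mod4 : (p %% 4 = 3)%N) (p_gt3 : (3 < p)%N)
  (ord10 : ((p.-1)./2).-primitive_root (10%:R : 'F_p))
  (m_range : (0 < m < p)%N)
  (m_qr : exists x : nat, (x ^ 2 = m %[mod p])%N)
  (a_digits : decimal_expansion (m%:R / p%:R : R) a) :
  let n := digit_count a (p.-1)./2 in
  let h1 := (class_number (quadratic_field (- p%:Z)))%:R : rat in
  let h2 := (class_number (quadratic_field (- (5 * p)%N%:Z)))%:R : rat in
  let d := delta p h1 h2 in
  forall k : nat, (k <= 4)%N ->
    (n k)%:R =
      2%:R^-1 * (((k.+1 * p) %/ 10)%N%:R - ((k * p) %/ 10)%N%:R + d k) :> rat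
    /\ (n (9 - k)%N)%:R = (n k)%:R - d k :> rat.
Proof.
move=> n h1 h2 d k le_k.
have p_odd : odd p by move: p_mod4; clear; lia.
have p_m : ~~ (p %| m)%N by case/andP: m_range => *; rewrite gtnNdvd.
have chi_m := legendre_quadratic_residue p_prime p_odd p_m m_qr.
have nonterminating i : ~~ (p %| 10 ^ i * m)%N.
  by rewrite -legendre_eq0 // (legendre_power_orbit p_prime p_mod4 ord10 chi_m).
have countE j : n j = residue_count p 10 j.
  rewrite -(count_power_orbit p_prime p_mod4 ord10 chi_m) /n /digit_count.
  rewrite /index_iota subSS subn0 -[1%N]addn0 iotaDl count_map.
  apply: eq_count => i /=.
  by rewrite add1n
    (digit_fraction _ _ (prime_gt0 p_prime) nonterminating a_digits).
have coprime_10 := coprime_10 p_prime p_mod4.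
have /(congr1 (fun z : int => z%:~R : rat)) := residue_countE 10 p_prime k.
have /(congr1 (fun z : int => z%:~R : rat)) := residue_countE 10 p_prime
  (9 - k).
rewrite (@interval_count_reflect p 10) ?(@interval_sum_reflect p _ _ 10) //;
  try lia.
rewrite (@interval_countE p 10) //; last by lia.
rewrite !countE /d (delta_tenth_sum R) //; last exact: legendre_primitive ord10.
by split; lra.
Qed.
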